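(* The Bergman complex of the rank $4$ matroid of the complex root system $\mathrm{G}_{32}$ has $170$ vertices, $1800$ edges and $3360$ triangles, so its (reduced) Euler characteristic equals $3360-1800+170-1=1729$. The $170$ rays of the Bergman fan ${\rm Berg}(\mathrm{G}_{32})\subset\mathbb{TP}^{39}$ are: (a) $40$ rays spanned by the unit vectors $e_\ell$, one for each line $\ell\subset\mathbb{F}_3^4$; (b) $90$ rays spanned by $\sum_{\ell\subset b}e_\ell$, one for each non-isotropic plane $b\subset\mathbb{F}_3^4$; (ä) $40$ rays spanned by $\sum_{\ell\subset h^\perp,\ \ell\neq h}e_\ell$, one for each hyperplane $h^\perp$ of $\mathbb{F}_3^4$, where $h$ is a line (each is a sum of $12$ unit vectors). The $1800$ edges are: $240$ edges (aa), pairs of distinct orthogonal lines; $360$ edges (ab), a line contained in a non-isotropic plane; $480$ edges (aä), a line $\ell\ne h$ contained in a hyperplane $h^\perp$; $360$ edges (bä), a non-isotropic plane contained in a hyperplane; and $360$ edges (ab$^\perp$), a non-isotropic plane together with a line contained in its orthogonal complement. The $3360$ triangles are: $480$ triangles (aaä), two distinct orthogonal lines $\ell,\ell'\neq h$ together with a hyperplane $h^\perp$ containing both; $1440$ triangles (abä), a line contained in a non-isotropic plane contained in a hyperplane; and $1440$ triangles (aab), a non-isotropic plane $b$ together with one line in $b$ and one line in $b^\perp$.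
   Context: $K$ is an algebraically closed field of characteristic $0$, $\omega\in K$ a primitive third root of unity, $\sqrt{-3}=\omega-\omega^2$. On $\mathbb{F}_3^4$ use the symplectic form $\langle x,y\rangle=x_1y_3+x_2y_4-x_3y_1-x_4y_2$; orthogonality refers to this form. ''Line'' means one-dimensional subspace ($40$ of them), ''plane'' two-dimensional subspace ($40$ isotropic, on which the form vanishes, and $90$ non-isotropic), ''hyperplane'' three-dimensional subspace (each is $h^\perp$ for a unique line $h$). The arrangement $\mathrm{G}_{32}$ consists of the $40$ hyperplanes in $\mathbb{P}^3$ defined by the following linear forms $u_\ell$ in $c_0,\dots,c_3$, indexed by the lines $\ell$ (exponents of $\omega$ in $\mathbb{F}_3$; $i,j\in\mathbb{F}_3$; the line is given by a spanning vector): $(1,0,0,0)\mapsto\sqrt{-3}\,c_0$, $(0,1,0,0)\mapsto\sqrt{-3}\,c_1$, $(1,2,0,0)\mapsto\sqrt{-3}\,c_2$, $(1,1,0,0)\mapsto\sqrt{-3}\,c_3$, $(i,j,0,1)\mapsto c_1+\omega^{i-j}c_2+\omega^{-i-j}c_3$, $(i,j,1,0)\mapsto c_2-\omega^{j}c_3+\omega^{i-j}c_0$, $(i,j,1,1)\mapsto c_3+\omega^{i}c_0-\omega^{j}c_1$, $(i,j,1,2)\mapsto c_0+\omega^{-i-j}c_1-\omega^{-i}c_2$. Its matroid is the rank $4$ linear matroid on these $40$ forms. $\mathbb{TP}^{39}=\mathbb{R}^{40}/\mathbb{R}(1,\dots,1)$ with unit vectors $e_\ell$. ${\rm Berg}(\mathrm{G}_{32})\subset\mathbb{TP}^{39}$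 is the tropical linear space of this matroid (the constant-coefficient min-convention tropicalization of the image of $\mathbb{P}^3\hookrightarrow\mathbb{P}^{39}$, $c\mapsto(u_\ell)$), equipped with its unique coarsest fan structure; it is a simplicial fan, and the Bergman complex is the simplicial complex over which it is the fan. *)

(* Defs.v *)
From HB Require Import structures.
From mathcomp Require Import all_boot all_order all_algebra finmap.
From mathcomp Require Import boolp classical_sets functions cardinality fsbigop.
From mathcomp Require Import reals.

Set Implicit Arguments.
Unset Strict Implicit.
Unset Printing Implicit Defensive.

Import Order.TTheory GRing.Theory Num.Theory.
Local Open Scope ring_scope.

Definition vec4 (F : nzRingType) (a b c d : F) : 'rV[F]_4 :=
  \row_(i < 4) [:: a; b; c; d]`_i.

Notation V34 := 'rV['F_3]_4.

(* [{vspace V34}] is a subtype of a finite type of matrices. *)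
Section FiniteVspace.
Import VectorInternalTheory.
HB.instance Definition _ := [Countable of {vspace V34} by <:].
HB.instance Definition _ := [Finite of {vspace V34} by <:].
End FiniteVspace.

Definition sform (x y : V34) : 'F_3 :=
  x 0 0 * y 0 2 + x 0 1 * y 0 3 - x 0 2 * y 0 0 - x 0 3 * y 0 1.

(* The span of all vectors orthogonal to U; these already form a subspace. *)
Definition perp (U : {vspace V34}) : {vspace V34} :=
  span [seq x <- enum {: V34} |
          [forall y : V34, (y \in U) ==> (sform x y == 0)]].

Definition isotropic (U : {vspace V34}) : bool :=
  [forall x : V34, forall y : V34,
    (x \in U) && (y \in U) ==> (sform x y == 0)].

Definition line := {U : {vspace V34} | \dim U == 1%N}.

Definition niplane := {U : {vspace V34} | (\dim U == 2%N) && ~~ isotropic U}.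

(* The 40 pairs (spanning vector of a line, linear form); a linear form in
   c_0, ..., c_3 is the row of its coefficients.  An exponent of omega is an
   element of F_3, coerced to its representative in {0, 1, 2}. *)
Definition G32_table (K : fieldType) (omega : K) : seq (V34 * 'rV[K]_4) :=
  let s := omega - omega ^+ 2 in
  let w (e : 'F_3) := omega ^+ (e : nat) in
  [:: (vec4 1 0 0 0, vec4 s 0 0 0); (vec4 0 1 0 0, vec4 0 s 0 0);
      (vec4 1 2 0 0, vec4 0 0 s 0); (vec4 1 1 0 0, vec4 0 0 0 s)]
  ++ [seq (vec4 i j 0 1, vec4 0 1 (w (i - j)) (w (- i - j)))
       | i <- enum 'F_3, j <- enum 'F_3]
  ++ [seq (vec4 i j 1 0, vec4 (w (i - j)) 0 1 (- w j))
       | i <- enum 'F_3, j <- enum 'F_3]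
  ++ [seq (vec4 i j 1 1, vec4 (w i) (- w j) 0 1)
       | i <- enum 'F_3, j <- enum 'F_3]
  ++ [seq (vec4 i j 1 2, vec4 1 (w (- i - j)) (- w (- i)) 0)
       | i <- enum 'F_3, j <- enum 'F_3].

(* Each line is spanned by the vector of exactly one entry of the table. *)
Definition G32_form (K : fieldType) (omega : K) (l : line) : 'rV[K]_4 :=
  let t := G32_table omega in
  (nth (0, 0) t (find (fun p => <[p.1]>%VS == val l) t)).2.

Definition mx_dependent (K : fieldType) (n : nat) (E : finType)
    (u : E -> 'rV[K]_n) (A : {set E}) : bool :=
  ~~ free [seq u i | i <- enum A].

Definition mx_circuit (K : fieldType) (n : nat) (E : finType)
    (u : E -> 'rV[K]_n) (C : {set E}) : bool :=
  minset (mx_dependent u) C.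

(* A subset of R^E / R(1, ..., 1) is represented by its preimage in R^E, a set
   invariant under translation by the constant vectors.  In particular a cone
   of the quotient is a cone of R^E containing R(1, ..., 1), and the origin of
   the quotient is R(1, ..., 1) itself. *)

Local Open Scope classical_set_scope.

Section Fans.
Variables (R : realType) (E : finType).
Local Notation V := {ffun E -> R^o}.
Implicit Types (s t : set V) (F : set (set V)).

Definition all_ones : V := [ffun=> 1].

Definition unit_vec (i : E) : V := [ffun j => (j == i)%:R].

Definition cone (vs : seq V) : set V :=
  [set x | exists (c : R) (a : 'I_(size vs) -> R),
     (forall i, 0 <= a i) /\
     x = c *: all_ones + \sum_(i < size vs) a i *: vs`_i].

Definition polyhedral_cone s := exists vs : seq V, s = cone vs.

Definition pairing (f x : V) : R := \sum_(i : E) f i * x i.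

Definition face_of t s :=
  exists f : V, (forall x, s x -> 0 <= pairing f x) /\
                t = [set x | s x /\ pairing f x = 0].

Definition fan F :=
  [/\ finite_set F,
      forall s, F s -> polyhedral_cone s,
      forall s t, F s -> face_of t s -> F t &
      forall s t, F s -> F t -> face_of (s `&` t) s /\ face_of (s `&` t) t].

Definition fan_structure (X : set V) F := fan F /\ \bigcup_(s in F) s = X.

Definition refines F' F := forall s', F' s' -> exists s, F s /\ s' `<=` s.

Definition coarsest_fan_structure (X : set V) F :=
  fan_structure X F /\ forall F', fan_structure X F' -> refines F' F.

(* Linear independence in the quotient by R(1, ..., 1). *)
Definition simplicial_cone s :=
  exists vs : seq V, free (all_ones :: vs) /\ s = cone vs.

Definition simplicial_fan F := forall s, F s -> simplicial_cone s.

Definition ray (v : V) : set V := cone [:: v].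

Definition is_ray s := exists v : V, free [:: all_ones; v] /\ s = ray v.

Definition rays F : set (set V) := [set r | F r /\ is_ray r].

(* The simplicial complex over which a simplicial fan is the fan: its vertices
   are the rays, its simplices the sets of rays of the cones (the origin gives
   the empty simplex). *)
Definition fan_complex F : set (set (set V)) :=
  [set [set r | rays F r /\ r `<=` s] | s in F].

End Fans.
Arguments unit_vec R {E} i.

(* A simplicial complex on vertices in T is the set of its simplices. *)
Definition simplices (T : Type) (D : set (set T)) (d : nat) : set (set T) :=
  [set S | D S /\ (S #= `I_d.+1)%card].

(* (-1) ^ (dim S) = (-1) ^ (#|S| + 1); the empty simplex contributes -1. *)
Definition reduced_euler_char (T : choiceType) (D : set (set T)) : int :=
  \sum_(S \in D) (-1 : int) ^+ (#|` fset_set S|).+1.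

(* The points at which the minimum over every circuit is attained at least twice
   (min-convention). *)
Definition tropical_linear_space (R : realType) (K : fieldType) (n : nat)
    (E : finType) (u : E -> 'rV[K]_n) : set {ffun E -> R^o} :=
  [set x | forall C : {set E}, mx_circuit u C ->
     exists i j, [/\ i \in C, j \in C, i != j, x i = x j &
       forall k, k \in C -> (x i : R) <= x k]].
Arguments tropical_linear_space R {K n E} u.

Definition Berg_G32 (R : realType) (K : fieldType) (omega : K) :
    set {ffun line -> R^o} :=
  tropical_linear_space R (G32_form omega).
Arguments Berg_G32 R {K} omega.

Definition vertex := (line + niplane + line)%type.
Definition vA (l : line) : vertex := inl (inl l).
Definition vB (b : niplane) : vertex := inl (inr b).
(* [vH h] stands for the hyperplane orthogonal to h. *)
Definition vH (h : line) : vertex := inr h.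

Definition vertex_vec (R : realType) (v : vertex) : {ffun line -> R^o} :=
  match v with
  | inl (inl l) => unit_vec R l
  | inl (inr b) => \sum_(l : line | (val l <= val b)%VS) unit_vec R l
  | inr h =>
      \sum_(l : line | (val l <= perp (val h))%VS && (l != h)) unit_vec R l
  end.

Definition vertex_ray (R : realType) (v : vertex) : set {ffun line -> R^o} :=
  ray (vertex_vec R v).
Arguments vertex_ray R v : clear implicits.

Local Close Scope classical_set_scope.
Local Open Scope set_scope.

Definition edges_aa : {set {set vertex}} :=
  [set [set vA p.1; vA p.2] | p : line * line
     & (p.1 != p.2) && (val p.1 <= perp (val p.2))%VS].
Definition edges_ab : {set {set vertex}} :=
  [set [set vA p.1; vB p.2] | p : line * niplane
     & (val p.1 <= val p.2)%VS].
Definition edges_ah : {set {set vertex}} :=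
  [set [set vA p.1; vH p.2] | p : line * line
     & (p.1 != p.2) && (val p.1 <= perp (val p.2))%VS].
Definition edges_bh : {set {set vertex}} :=
  [set [set vB p.1; vH p.2] | p : niplane * line
     & (val p.1 <= perp (val p.2))%VS].
Definition edges_ab_perp : {set {set vertex}} :=
  [set [set vA p.1; vB p.2] | p : line * niplane
     & (val p.1 <= perp (val p.2))%VS].

Definition triangles_aah : {set {set vertex}} :=
  [set [set vA p.1.1; vA p.1.2; vH p.2] | p : line * line * line
     & [&& p.1.1 != p.1.2, (val p.1.1 <= perp (val p.1.2))%VS,
           p.1.1 != p.2, p.1.2 != p.2,
           (val p.1.1 <= perp (val p.2))%VS &
           (val p.1.2 <= perp (val p.2))%VS]].
Definition triangles_abh : {set {set vertex}} :=
  [set [set vA p.1.1; vB p.1.2; vH p.2] | p : line * niplane * line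
     & (val p.1.1 <= val p.1.2)%VS && (val p.1.2 <= perp (val p.2))%VS].
Definition triangles_aab : {set {set vertex}} :=
  [set [set vA p.1.1; vA p.1.2; vB p.2] | p : line * line * niplane
     & (val p.1.1 <= val p.2)%VS && (val p.1.2 <= perp (val p.2))%VS].

(* Main.v *)
(* A point of R^40 lies on Berg(G32) iff its superlevel sets are flats of the matroid.
   A linear dependence among the forms u_l is detected by normal vectors: writing
   conj u_h for the form obtained from u_h by omega |-> omega^2, the product
   u_l . conj u_h vanishes iff l is a line of h^perp distinct from h.  For a
   non-isotropic plane b and lines m <> m' of b^perp, the projection of conj u_m'
   orthogonal to u_m is killed exactly by m and by the lines of b.  These vectors cut
   out the 400 hyperplanes of the matroid, so that everything reduces to the incidence
   relations between the 40 lines and the 90 planes.  Sorting the coordinates of a point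
   of Berg(G32) greedily yields a flag of flats, and the chain of indicator vectors of
   such a flag is a nonnegative combination of the three vectors of a triangle.

   The cones over the triangles and their faces form a fan, because coordinate
   differences separate the vertices of a triangle, and because a vertex v occurs in a
   point x with positive coefficient iff the minimum of x over the flat of v exceeds the
   minimum over every larger connected flat.  Any other fan structure F refines it: if x
   is a relative interior point of a cone s of F, then the support of F near x is
   invariant under translation along s; hence s lies in the span of every maximal cone
   around x, and thus, walls being contained in at least three triangles, in the span
   of the smallest cone containing x. *)
From HB Require Import structures.
From Stdlib Require Import NArith ZArith.
Require Import Defs.
From mathcomp Require Import all_boot all_order all_algebra finmap.
From mathcomp Require Import zify ssrZ ring lra.

Set Implicit Arguments.
Unset Strict Implicit.
Unset Printing Implicit Defensive.

(** * The incidence geometry and its flats *)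

(** Two quantifiers in the definitions shape the proof. Membership in the tropical linear space
    ranges over all circuits, too many to list. Two facts replace them: a form dependent on others
    has a coordinate bounded below by theirs ([tropical_dependent]), and a vector that kills all
    forms above the level of [u i], but not [u i], prevents a circuit from having its minimum at [i]
    alone ([tropical_separated]). Coarseness ranges over arbitrary fans with the given support.
    Limits along segments are taken without topology, by a pigeonhole over finitely many cones
    together with closedness of polyhedral cones; the inequalities for this come from
    Fourier-Motzkin elimination. As the claims concern every coarsest fan, uniqueness of the
    coarsest fan reduces them to one explicit fan. The fan argument is carried out for any family of
    sets with suitable membership conditions: statements on real vectors become statements on pairs
    of elements [p], [q] that lie in the same sets of the family or do not. The record below
    separates this from $\mathbb{F}_3^4$, where its fields are checked by evaluation on codes. *)

Section IncidenceGeometry.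
Local Open Scope set_scope.

(* [inF l h]: l is a line of h^perp distinct from h; [inP l b]: l is a line of b;
   [perpP b h]: b is contained in h^perp. *)
Record incidence_geometry (L P : finType) (inF : rel L) (inP : L -> P -> bool)
    (perpP : P -> L -> bool) : Prop := IncidenceGeometry {
  ig_sym : symmetric inF;
  ig_irr : irreflexive inF;
  ig_card_line : #|L| = 40;
  ig_card_plane : #|P| = 90;
  ig_card_inF : forall h, #|[set l | inF l h]| = 12;
  ig_card_inP : forall b, #|[set l | inP l b]| = 4;
  ig_card_perpP : forall b, #|[set h | perpP b h]| = 4;
  ig_card_inF2 : forall l h, inF l h -> #|[set k | inF k l && inF k h]| = 2;
  ig_plane_inFN : forall b l l', inP l b -> inP l' b -> ~~ inF l l';
  ig_plane_perpN : forall b l, perpP b l -> ~~ inP l b;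
  ig_plane_inF : forall b l h, inP l b -> perpP b h -> inF l h;
  ig_plane_uniq : forall b b' l l', l != l' ->
    inP l b -> inP l' b -> inP l b' -> inP l' b' -> b = b';
  ig_plane_perp : forall b l l' h, l != l' -> inP l b -> inP l' b -> inF l h -> inF l' h ->
    perpP b h;
  ig_plane_exists : forall l l', l != l' -> ~~ inF l l' -> exists b, inP l b && inP l' b;
  ig_plane_flag : forall l h, inF l h -> exists b, inP l b && perpP b h;
  ig_inF_triple : forall l1 l2 l3, inF l1 l2 -> l3 != l1 -> l3 != l2 ->
    inF l1 l3 = inF l2 l3 -> exists h, [/\ inF l1 h, inF l2 h & inF l3 h];
  ig_plane_line : forall b l, ~~ inP l b -> ~~ perpP b l -> exists h, perpP b h && inF l h;
  ig_plane_separated : forall b l, ~~ inP l b -> exists h, perpP b h && ~~ inF l h;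
  ig_line_separated : forall l l', l != l' -> exists h, inF l h && ~~ inF l' h;
  ig_ort_separated : forall l l' k, inF l l' -> k != l -> k != l' ->
    exists h, [/\ inF l h, inF l' h & ~~ inF k h];
  ig_perp_plane : forall b l, perpP b l -> exists l', [/\ perpP b l', l' != l, ~~ inF l l' &
    forall k, inF k l -> inF k l' -> inP k b] }.

End IncidenceGeometry.

Section Geometry.
Local Open Scope set_scope.
Variables (L P : finType) (inF : rel L) (inP : L -> P -> bool) (perpP : P -> L -> bool).
Hypothesis IG : incidence_geometry inF inP perpP.
Local Notation vtx := (L + P + L)%type.
Implicit Types (l h k : L) (b : P) (u v w : vtx) (T : {set vtx}) (X S W : {set L}).

Definition vL l : vtx := inl (inl l).
Definition vP b : vtx := inl (inr b).
Definition vF h : vtx := inr h.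

Definition flat v : {set L} :=
  match v with
  | inl (inl l) => [set l]
  | inl (inr b) => [set l | inP l b]
  | inr h => [set l | inF l h]
  end.

Definition tri_LLF := [set [set vL p.1.1; vL p.1.2; vF p.2] | p : L * L * L
  & [&& inF p.1.1 p.1.2, inF p.1.1 p.2 & inF p.1.2 p.2]].
Definition tri_LPF := [set [set vL p.1.1; vP p.1.2; vF p.2] | p : L * P * L
  & inP p.1.1 p.1.2 && perpP p.1.2 p.2].
Definition tri_LLP := [set [set vL p.1.1; vL p.1.2; vP p.2] | p : L * L * P
  & inP p.1.1 p.2 && perpP p.2 p.1.2].
Definition triangles := tri_LLF :|: tri_LPF :|: tri_LLP.

Lemma triangleP T : T \in triangles ->
  [\/ exists l l' h, [/\ inF l l', inF l h, inF l' h & T = [set vL l; vL l'; vF h]],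
      exists l b h, [/\ inP l b, perpP b h & T = [set vL l; vP b; vF h]] |
      exists l l' b, [/\ inP l b, perpP b l' & T = [set vL l; vL l'; vP b]]].
Proof.
rewrite !inE -orbA => /or3P[] /imsetP[[[x y] z]]; rewrite inE /=.
- by move=> /and3P[? ? ?] ->; constructor 1; exists x, y, z.
- by move=> /andP[? ?] ->; constructor 2; exists x, y, z.
- by move=> /andP[? ?] ->; constructor 3; exists x, y, z.
Qed.

Lemma triangle_LLF l l' h : inF l l' -> inF l h -> inF l' h ->
  [set vL l; vL l'; vF h] \in triangles.
Proof.
move=> a b c; rewrite !inE; apply/orP; left; apply/orP; left.
by apply/imsetP; exists (l, l', h); rewrite // inE a b c.
Qed.

Lemma triangle_LPF l b h : inP l b -> perpP b h -> [set vL l; vP b; vF h] \in triangles.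
Proof.
move=> a c; rewrite !inE; apply/orP; left; apply/orP; right.
by apply/imsetP; exists (l, b, h); rewrite // inE a c.
Qed.

Lemma triangle_LLP l l' b : inP l b -> perpP b l' -> [set vL l; vL l'; vP b] \in triangles.
Proof.
move=> a c; rewrite !inE; apply/orP; right.
by apply/imsetP; exists (l, l', b); rewrite // inE a c.
Qed.

Lemma inF_neq l h : inF l h -> l != h.
Proof. by apply: contraTneq => ->; rewrite (ig_irr IG). Qed.

Lemma flat_sub b h : perpP b h -> flat (vP b) \subset flat (vF h).
Proof. by move=> bh; apply/subsetP=> l; rewrite !inE => /(ig_plane_inF IG)/(_ bh). Qed.

Lemma outside S X : #|X| < #|S| -> exists2 i, i \in S & i \notin X.
Proof.
move=> XS; have /subsetPn[i iS iX] : ~~ (S \subset X); last by exists i.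
by apply: contraL XS => /subset_leq_card; rewrite -leqNgt.
Qed.

Lemma card_flat v : #|flat v| \in [:: 1; 4; 12].
Proof.
by case: v => [[l|b]|h]; rewrite /= ?cards1 ?(ig_card_inP IG) ?(ig_card_inF IG).
Qed.

Lemma flat_neq0 v : flat v != set0.
Proof. by rewrite -card_gt0; move: (card_flat v); rewrite !inE => /or3P[]/eqP->. Qed.

Lemma flat_neqT v : flat v != [set: L].
Proof.
apply/eqP=> /(congr1 (fun S => #|S|)); rewrite cardsT (ig_card_line IG) => e.
by move: (card_flat v); rewrite e.
Qed.

Lemma plane_meet b b' : 1 < #|flat (vP b) :&: flat (vP b')| -> b = b'.
Proof.
case/card_gt1P=> l [l' []]; rewrite !inE => /andP[? ?] /andP[? ?] ll'.
exact: (ig_plane_uniq IG ll').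
Qed.

Lemma flat_inj : injective flat.
Proof.
move=> u v e; have := congr1 (fun S => #|S|) e.
case: u v e => [[l|b]|h] [[l'|b']|h'] /= e;
  rewrite ?cards1 ?(ig_card_inP IG) ?(ig_card_inF IG) // => _.
- by rewrite (set1_inj e).
- by rewrite (@plane_meet b b') //= -e setIid (ig_card_inP IG).
- congr inr; apply/eqP/negPn/negP => /(ig_line_separated IG)[k /andP[hk h'k]].
  by move/setP/(_ k): e; rewrite !inE ![inF k _](ig_sym IG) hk (negbTE h'k).
Qed.

Definition laminar2 S X := [\/ S \subset X, X \subset S | S :&: X = set0].

Lemma laminar2C S X : laminar2 S X -> laminar2 X S.
Proof. by case; [constructor 2|constructor 1|rewrite setIC; constructor 3]. Qed.

Lemma laminar2_set1 l X : laminar2 [set l] X.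
Proof.
have [lX|lX] := boolP (l \in X); first by constructor 1; rewrite sub1set.
constructor 3; apply/setP=> k; rewrite !inE; apply: contraNF lX.
by case/andP=> /eqP->.
Qed.

Lemma flat_laminar T u w : T \in triangles -> u \in T -> w \in T ->
  laminar2 (flat u) (flat w).
Proof.
have refl S : laminar2 S S by constructor 1.
have H1 l v : laminar2 (flat (vL l)) (flat v) := laminar2_set1 l (flat v).
have H2 l v := laminar2C (H1 l v).
case/triangleP=> -[x [y [z []]]].
- move=> _ _ _ ->; rewrite !inE -!orbA => /or3P[]/eqP-> /or3P[]/eqP->;
  by [apply: H1|apply: H2|apply: refl].
- move=> _ yz ->; rewrite !inE -!orbA => /or3P[]/eqP-> /or3P[]/eqP->;
    try by [apply: H1|apply: H2|apply: refl].
    by constructor 1; apply: flat_sub.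
  by constructor 2; apply: flat_sub.
- move=> _ _ ->; rewrite !inE -!orbA => /or3P[]/eqP-> /or3P[]/eqP->;
  by [apply: H1|apply: H2|apply: refl].
Qed.

Lemma card_triangle T : T \in triangles -> #|T| = 3.
Proof.
case/triangleP=> -[x [y [z []]]].
- move=> /inF_neq xy _ _ ->; rewrite setUC cardsU1 cards2 !inE /=.
  by rewrite (_ : vL x != vL y = true) //; apply: contra xy => /eqP[->].
- by move=> _ _ ->; rewrite setUC cardsU1 cards2 !inE.
- move=> xz zy ->; rewrite setUC cardsU1 cards2 !inE /=.
  rewrite (_ : vL x != vL y = true) //; apply: contraL zy => /eqP[<-].
  by apply: contraL xz; apply: (ig_plane_perpN IG).
Qed.

(** At such a [j], every combination of the indicators of the flats of [T] with nonnegative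
    coefficients attains its minimum over [W]: the flats contributing at [j] contribute on all of
    [W]. *)
Definition uncovered_by T W :=
  exists2 j, j \in W & forall u, u \in T -> j \in flat u -> W \subset flat u.

(** [j] is taken outside the largest member of the chain that does not contain [W]. *)
Lemma uncovered_chain (X Y Z W : {set L}) : X \subset Y -> Y \subset Z -> W != set0 ->
  exists2 j, j \in W & [/\ j \in X -> W \subset X, j \in Y -> W \subset Y &
     j \in Z -> W \subset Z].
Proof.
move=> XY YZ /set0Pn[i iW].
have [WX|/subsetPn[j jW jX]] := boolP (W \subset X).
  have WY := subset_trans WX XY; exists i => //; split=> // _; exact: subset_trans YZ.
have [WY|/subsetPn[j' jW' jY']] := boolP (W \subset Y).
  by exists j => //; split=> // [|_]; [rewrite (negbTE jX)|exact: subset_trans YZ].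
have [WZ|/subsetPn[j'' jW'' jZ'']] := boolP (W \subset Z).
  by exists j' => //; split=> // [/(subsetP XY)|]; rewrite (negbTE jY').
exists j'' => //; split=> [/(subsetP XY)/(subsetP YZ)|/(subsetP YZ)|];
  by rewrite (negbTE jZ'').
Qed.

(** A single point is its own witness. Otherwise [W] has at least four points, and the flats of [T]
    that do not contain [W] fail to cover it, by the chain lemma or by counting. *)
Lemma flat_uncovered T W : T \in triangles -> W = [set: L] \/ (exists w, W = flat w) ->
  uncovered_by T W.
Proof.
move=> TT HW.
have [[l ->]|W4] : (exists l, W = [set l]) \/ 4 <= #|W|.
- case: HW => [->|[[[l|b]|h] ->]]; rewrite ?cardsT ?(ig_card_line IG);
   [by right|by left; exists l|right|right]; rewrite /= ?(ig_card_inP IG) //.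
  by rewrite (ig_card_inF IG).
- by exists l; rewrite ?set11 // => u _; rewrite sub1set.
have W0 : W != set0 by rewrite -card_gt0 (leq_trans _ W4).
case/triangleP: TT => -[x [y [z []]]].
- move=> _ xz yz ->; have [Wz|/subsetPn[j jW jz]] := boolP (W \subset flat (vF z)).
    have [|j jW] := @outside W [set x; y].
      by rewrite (leq_ltn_trans _ W4) // cards2; case: (x != y).
    rewrite !inE negb_or => /andP[jx jy]; exists j => // u.
    by rewrite !inE -orbA => /or3P[]/eqP-> //; rewrite !inE ?(negbTE jx) ?(negbTE jy).
  exists j => // u; rewrite !inE -orbA => /or3P[]/eqP->; rewrite ?(negbTE jz) // !inE => /eqP e.
    by move: jz; rewrite e inE xz.
  by move: jz; rewrite e inE yz.
- move=> xy yz ->; have xY : flat (vL x) \subset flat (vP y) by rewrite sub1set inE.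
  have [j jW [jx jy jz]] := uncovered_chain xY (flat_sub yz) W0.
  by exists j => // u; rewrite !inE -orbA => /or3P[]/eqP->.
- move=> xz zy ->; have yz := ig_plane_perpN IG zy.
  have [Wz|nWz] := boolP (W \subset flat (vP z)).
    have [|j jW] := @outside W [set x]; first by rewrite cards1 (leq_trans _ W4).
    rewrite inE => jx; exists j => // u; rewrite !inE -orbA => /or3P[]/eqP-> //.
      by rewrite inE (negbTE jx).
    rewrite inE => /eqP e; move: yz; have := subsetP Wz _ jW; rewrite e inE => ->//.
  suff [j jW] : exists2 j, j \in W & j \notin y |: flat (vP z).
    rewrite !inE negb_or => /andP[jy jz]; exists j => // u.
    rewrite !inE -orbA => /or3P[]/eqP->; rewrite ?inE ?(negbTE jy) ?(negbTE jz) //.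
    by move/eqP=> e; move: jz; rewrite e xz.
  have c5 : #|y |: flat (vP z)| = 5 by rewrite cardsU1 inE yz (ig_card_inP IG).
  case: HW nWz W4 => [->|[[[l|b]|h] ->]] nWz W4.
  + by apply: outside; rewrite c5 cardsT (ig_card_line IG).
  + by rewrite cards1 in W4.
  (* A plane [b] covered by the plane [z] and one further line would share at least three lines with
     [z] and hence equal it. *)
  + apply/subsetPn; apply: contra nWz => sub; suff -> : b = z by [].
    apply: plane_meet; have := cardsID (flat (vP z)) (flat (vP b)).
    rewrite [#|flat (vP b)|](ig_card_inP IG) => c4.
    have : #|flat (vP b) :\: flat (vP z)| <= #|[set y]|.
      apply: subset_leq_card; apply/subsetP=> k; rewrite in_setD => /andP[kz kb].
      by move: (subsetP sub _ kb); rewrite in_setU1 (negbTE kz) orbF inE.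
    rewrite cards1; move: c4; case: #|_ :\: _| => [|[|//]]; rewrite ?addn0 ?addn1.
      by move=> ->.
    by case=> ->.
  + by apply: outside; rewrite c5 (ig_card_inF IG).
Qed.

Lemma plane_point b x y : exists q, [/\ inP q b, q != x & q != y].
Proof.
have [|q] := @outside (flat (vP b)) [set x; y].
  by rewrite (ig_card_inP IG) cards2; case: (x != y).
by rewrite !inE => qb /norP[qx qy]; exists q.
Qed.

Lemma hyperplane_point h b x y : exists q, [/\ inF q h, ~~ inP q b, q != x & q != y].
Proof.
have [|q] := @outside (flat (vF h)) (x |: (y |: flat (vP b))).
  by rewrite (ig_card_inF IG) !cardsU1 (ig_card_inP IG); do 2!case: (_ \notin _).
by rewrite !inE => qh /norP[qx /norP[qy qb]]; exists q.
Qed.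

Lemma other_point h b x y : exists q, [/\ ~~ inF q h, ~~ inP q b, q != x & q != y].
Proof.
have [|q _] := @outside [set: L] (x |: (y |: (flat (vP b) :|: flat (vF h)))).
  rewrite cardsT (ig_card_line IG) !cardsU1.
  have : #|flat (vP b) :|: flat (vF h)| <= 16.
    by rewrite (leq_trans (leq_card_setU _ _)) // (ig_card_inP IG) (ig_card_inF IG).
  by move=> H; rewrite (@leq_ltn_trans (1 + (1 + 16))) // !leq_add ?leq_b1.
by rewrite !inE => /norP[qx /norP[qy /norP[qb qh]]]; exists q.
Qed.

Lemma third_line l h : inF l h -> exists2 k, inF k l & inF k h.
Proof.
move=> /(ig_card_inF2 IG) c2.
have /set0Pn[k] : [set k | inF k l && inF k h] != set0 by rewrite -card_gt0 c2.
by rewrite inE => /andP[]; exists k.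
Qed.

(** For a combination [x] of the three indicators, [x p - x q] is then the coefficient of [v]. *)
Definition separates v w1 w2 := exists p q, [/\ p \in flat v, q \notin flat v,
  (p \in flat w1) = (q \in flat w1) & (p \in flat w2) = (q \in flat w2)].

(* Keeps [inE] from unfolding membership in [triangles]. *)
Definition is_triangle T : Prop := T \in triangles.

(** The span of the neighbouring cone lies in the hyperplane $x_p=x_q$, which does not contain the
    indicator of [v]. So the spans of the two cones meet only in the span of their common wall. *)
Definition wall_at v w1 w2 := exists v' p q, [/\ is_triangle [set w1; w2; v'],
  (p \in flat v) != (q \in flat v), (p \in flat w1) = (q \in flat w1),
  (p \in flat w2) = (q \in flat w2) & (p \in flat v') = (q \in flat v')].

(** Up to symmetry, eight such lemmas cover the vertices of the three types of triangles. The
    neighbour across the wall comes from an incidence. The point [q] mostly comes from counting: 4,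
    12 or 40 candidates against at most 2, 6 or 18 excluded ones. *)
Lemma LLF_sep l l' h : inF l l' -> inF l h -> inF l' h ->
  separates (vL l) (vL l') (vF h) /\ wall_at (vL l) (vL l') (vF h).
Proof.
move=> ll' lh l'h; have [b /andP[l'b bh]] := ig_plane_flag IG l'h.
have lb : inP l b = false by apply: contraTF ll' => lb; apply: (ig_plane_inFN IG lb l'b).
have [q [qh qb ql ql']] := hyperplane_point h b l l'; split.
  exists l, q; rewrite !inE eqxx (negbTE ql) (negbTE ql') (negbTE (inF_neq ll')) lh qh.
  by split.
exists (vP b), l, q; rewrite !inE eqxx (negbTE ql) (negbTE ql') (negbTE (inF_neq ll')).
rewrite lh qh lb (negbTE qb); split=> //.
by rewrite -setUA [_ :|: [set vP b]]setUC setUA; apply: triangle_LPF.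
Qed.

Lemma LLF_sep_hyperplane l l' h : inF l l' -> inF l h -> inF l' h ->
  separates (vF h) (vL l) (vL l') /\ wall_at (vF h) (vL l) (vL l').
Proof.
move=> ll' lh l'h; have [b /andP[lb bl']] := ig_plane_flag IG ll'.
have [p [ph pb pl pl']] := hyperplane_point h b l l'.
have [q [qh qb ql ql']] := other_point h b l l'; split.
  exists p, h; rewrite !inE ph (ig_irr IG) ![h == _]eq_sym (negbTE pl) (negbTE pl').
  by rewrite (negbTE (inF_neq lh)) (negbTE (inF_neq l'h)).
exists (vP b), p, q; rewrite !inE ph (negbTE qh) (negbTE pl) (negbTE pl').
rewrite (negbTE ql) (negbTE ql') (negbTE pb) (negbTE qb); split=> //.
exact: triangle_LLP.
Qed.

Lemma LPF_sep_line l b h : inP l b -> perpP b h ->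
  separates (vL l) (vP b) (vF h) /\ wall_at (vL l) (vP b) (vF h).
Proof.
move=> lb bh; have [l2 [l2b l2l _]] := plane_point b l l.
have [q [qb ql ql2]] := plane_point b l l2.
have bF k : inP k b -> inF k h by move=> kb; apply: (ig_plane_inF IG kb bh).
split; first by exists l, q; rewrite !inE eqxx (negbTE ql) lb qb !bF.
exists (vL l2), l, q; rewrite !inE eqxx (negbTE ql) lb qb !bF // [l == _]eq_sym.
rewrite (negbTE l2l) (negbTE ql2); split=> //.
by rewrite setUC setUA; apply: triangle_LPF.
Qed.

Lemma LPF_sep_plane l b h : inP l b -> perpP b h ->
  separates (vP b) (vL l) (vF h) /\ wall_at (vP b) (vL l) (vF h).
Proof.
move=> lb bh; have bF k : inP k b -> inF k h by move=> kb; apply: (ig_plane_inF IG kb bh).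
have lh := bF _ lb; have [l2 l2l l2h] := third_line lh.
have l2b : inP l2 b = false by apply: contraTF l2l => l2b; apply: (ig_plane_inFN IG l2b lb).
have [p [pb pl _]] := plane_point b l l.
have [q [qh qb ql ql2]] := hyperplane_point h b l l2.
have pl2 : p == l2 = false by apply: contraTF pb => /eqP->; rewrite l2b.
split.
  by exists p, q; rewrite !inE pb (negbTE qb) (negbTE pl) (negbTE ql) qh bF.
exists (vL l2), p, q; rewrite !inE pb (negbTE qb) (negbTE pl) (negbTE ql) qh bF // pl2 (negbTE ql2).
split=> //; rewrite -setUA [_ :|: [set vL l2]]setUC setUA; apply: triangle_LLF => //.
by rewrite (ig_sym IG).
Qed.

(** The line [h] has two roles: it names the hyperplane $h^\perp$ containing [b], and it is itself a
    line of $b^\perp$. Exchanging the roles gives the neighbour; [LLP_sep_perp] uses the same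
    exchange backwards. *)
Lemma LPF_sep_hyperplane l b h : inP l b -> perpP b h ->
  separates (vF h) (vL l) (vP b) /\ wall_at (vF h) (vL l) (vP b).
Proof.
move=> lb bh; have hb := ig_plane_perpN IG bh.
have [p [ph pb pl _]] := hyperplane_point h b l l.
have [q [qh qb ql qh']] := other_point h b l h.
have hl : h == l = false by apply: contraNF hb => /eqP->.
split.
  by exists p, h; rewrite !inE ph (ig_irr IG) (negbTE pb) (negbTE hb) (negbTE pl) hl.
exists (vL h), p, q; rewrite !inE ph (negbTE qh) (negbTE pl) (negbTE ql) (negbTE pb) (negbTE qb).
rewrite (negbTE qh') (negbTE (inF_neq ph)); split=> //.
by rewrite -setUA [_ :|: [set vL h]]setUC setUA; apply: triangle_LLP.
Qed.

Lemma LLP_sep_line l l' b : inP l b -> perpP b l' ->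
  separates (vL l) (vL l') (vP b) /\ wall_at (vL l) (vL l') (vP b).
Proof.
move=> lb bl'; have l'b := ig_plane_perpN IG bl'.
have [l2 [l2b l2l _]] := plane_point b l l.
have [q [qb ql ql2]] := plane_point b l l2.
have nl' k : inP k b -> k == l' = false.
  by move=> kb; apply: contraTF kb => /eqP->.
split; first by exists l, q; rewrite !inE eqxx (negbTE ql) lb qb !nl'.
exists (vL l2), l, q; rewrite !inE eqxx (negbTE ql) lb qb !nl' // [l == _]eq_sym.
rewrite (negbTE l2l) (negbTE ql2); split=> //.
by rewrite setUC setUA; apply: triangle_LLP.
Qed.

Lemma LLP_sep_perp l l' b : inP l b -> perpP b l' ->
  separates (vL l') (vL l) (vP b) /\ wall_at (vL l') (vL l) (vP b).
Proof.
move=> lb bl'; have l'b := ig_plane_perpN IG bl'.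
have [q [qh qb ql ql']] := other_point l' b l l'.
have l'l : l' == l = false by apply: contraNF l'b => /eqP->.
split.
  by exists l', q; rewrite !inE eqxx (negbTE ql) (negbTE qb) (negbTE ql') l'l (negbTE l'b).
exists (vF l'), l', q; rewrite !inE eqxx (negbTE ql) (negbTE qb) (negbTE ql') l'l (negbTE l'b).
rewrite (negbTE qh) (ig_irr IG); split=> //; exact: triangle_LPF.
Qed.

Lemma LLP_sep_plane l l' b : inP l b -> perpP b l' ->
  separates (vP b) (vL l) (vL l') /\ wall_at (vP b) (vL l) (vL l').
Proof.
move=> lb bl'; have l'b := ig_plane_perpN IG bl'.
have ll' := ig_plane_inF IG lb bl'; have [h hl hl'] := third_line ll'.
have [p [pb pl _]] := plane_point b l l.
have pl' : p == l' = false by apply: contraTF pb => /eqP->.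
(* [q] must lie on the same side of $h^\perp$ as [p], since [vF h] is the new vertex of the
   neighbour and may not distinguish them. *)
have [q [qh qb ql ql']] : exists q, [/\ inF q h = inF p h, ~~ inP q b, q != l & q != l'].
  case: (boolP (inF p h)) => ph.
    by have [q [qh qb ql ql']] := hyperplane_point h b l l'; exists q.
  by have [q [/negbTE qh qb ql ql']] := other_point h b l l'; exists q.
split.
  by exists p, q; rewrite !inE pb (negbTE qb) (negbTE pl) (negbTE ql) pl' (negbTE ql').
exists (vF h), p, q; rewrite !inE pb (negbTE qb) (negbTE pl) (negbTE ql) pl' (negbTE ql') qh.
by split=> //; apply: triangle_LLF; rewrite // (ig_sym IG).
Qed.

Lemma triangle_sep T v : T \in triangles -> v \in T -> exists w1 w2,
  [/\ T = [set v; w1; w2], separates v w1 w2 & wall_at v w1 w2].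
Proof.
case/triangleP=> -[x [y [z []]]].
- move=> xy xz yz ->; rewrite !inE -orbA => /or3P[]/eqP->.
  + by exists (vL y), (vF z); have [] := LLF_sep xy xz yz.
  + exists (vL x), (vF z); have yx : inF y x by rewrite (ig_sym IG).
    by have [] := LLF_sep yx yz xz; rewrite (setUC [set vL x]).
  + by exists (vL x), (vL y); have [] := LLF_sep_hyperplane xy xz yz; rewrite setUC setUA.
- move=> xy yz ->; rewrite !inE -orbA => /or3P[]/eqP->.
  + by exists (vP y), (vF z); have [] := LPF_sep_line xy yz.
  + by exists (vL x), (vF z); have [] := LPF_sep_plane xy yz; rewrite (setUC [set vL x]).
  + by exists (vL x), (vP y); have [] := LPF_sep_hyperplane xy yz; rewrite setUC setUA.
- move=> xy yz ->; rewrite !inE -orbA => /or3P[]/eqP->.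
  + by exists (vL y), (vP z); have [] := LLP_sep_line xy yz.
  + by exists (vL x), (vP z); have [] := LLP_sep_perp xy yz; rewrite (setUC [set vL x]).
  + by exists (vL x), (vL y); have [] := LLP_sep_plane xy yz; rewrite setUC setUA.
Qed.

Lemma flat_separated T v : T \in triangles -> v \in T -> exists p q,
  [/\ p \in flat v, q \notin flat v &
    forall w, w \in T -> w != v -> (p \in flat w) = (q \in flat w)].
Proof.
move=> TT vT; have [w1 [w2 [-> [p [q [pv qv e1 e2]]] _]]] := triangle_sep TT vT.
exists p, q; split=> // w; rewrite !inE => /orP[/orP[/eqP->|/eqP->]|/eqP->] //.
by rewrite eqxx.
Qed.

Lemma flat_wall T v : T \in triangles -> v \in T -> exists T' p q,
  [/\ T' \in triangles, T :\ v \subset T', (p \in flat v) != (q \in flat v) &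
    forall u, u \in T' -> (p \in flat u) = (q \in flat u)].
Proof.
move=> TT vT; have [w1 [w2 [-> _ [v' [p [q [T' pq e1 e2 e3]]]]]]] := triangle_sep TT vT.
exists [set w1; w2; v'], p, q; split=> //.
  by apply/subsetP=> u; rewrite !inE => /andP[/negbTE->] /= ->.
by move=> w; rewrite !inE => /orP[/orP[/eqP->|/eqP->]|/eqP->].
Qed.

Lemma some_line_plane l : exists h, inF l h.
Proof.
have /set0Pn[h] : flat (vF l) != set0 by apply: flat_neq0.
by rewrite inE (ig_sym IG); exists h.
Qed.

Lemma vertex_in_triangle v : exists2 T, T \in triangles & v \in T.
Proof.
case: v => [[l|b]|h].
- have [h lh] := some_line_plane l; have [b /andP[lb bh]] := ig_plane_flag IG lh.
  by exists [set vL l; vP b; vF h]; rewrite ?triangle_LPF // !inE eqxx.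
- have /set0Pn[l] : flat (vP b) != set0 by apply: flat_neq0.
  rewrite inE => lb; have /set0Pn[h] : [set h | perpP b h] != set0.
    by rewrite -card_gt0 (ig_card_perpP IG).
  rewrite inE => bh.
  by exists [set vL l; vP b; vF h]; rewrite ?triangle_LPF // !inE eqxx orbT.
- have [l hl] := some_line_plane h; have lh : inF l h by rewrite (ig_sym IG).
  have [b /andP[lb bh]] := ig_plane_flag IG lh.
  by exists [set vL l; vP b; vF h]; rewrite ?triangle_LPF // !inE eqxx !orbT.
Qed.

Definition edge_LL := [set [set vL p.1; vL p.2] | p : L * L & inF p.1 p.2].
Definition edge_LP := [set [set vL p.1; vP p.2] | p : L * P & inP p.1 p.2].
Definition edge_LF := [set [set vL p.1; vF p.2] | p : L * L & inF p.1 p.2].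
Definition edge_PF := [set [set vP p.1; vF p.2] | p : P * L & perpP p.1 p.2].
Definition edge_LP_perp := [set [set vL p.1; vP p.2] | p : L * P & perpP p.2 p.1].
Definition edges := edge_LL :|: edge_LP :|: edge_LF :|: edge_PF :|: edge_LP_perp.

Lemma pair_LP l b l' b' : [set vL l; vP b] = [set vL l'; vP b'] -> l = l' /\ b = b'.
Proof.
move=> e; move/setP: (e) => /(_ (vL l)); move/setP: e => /(_ (vP b)).
by rewrite !inE !eqxx /= orbF => /esym/eqP[->] /esym/eqP[->].
Qed.

Lemma pair_LF l (b : L) l' (b' : L) : [set vL l; vF b] = [set vL l'; vF b'] -> l = l' /\ b = b'.
Proof.
move=> e; move/setP: (e) => /(_ (vL l)); move/setP: e => /(_ (vF b)).
by rewrite !inE !eqxx /= orbF => /esym/eqP[->] /esym/eqP[->].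
Qed.

Lemma pair_PF (l : P) (b : L) (l' : P) (b' : L) :
  [set vP l; vF b] = [set vP l'; vF b'] -> l = l' /\ b = b'.
Proof.
move=> e; move/setP: (e) => /(_ (vP l)); move/setP: e => /(_ (vF b)).
by rewrite !inE !eqxx /= orbF => /esym/eqP[->] /esym/eqP[->].
Qed.

Lemma pair_LL l k l' k' : [set vL l; vL k] = [set vL l'; vL k'] ->
  (l', k') = (l, k) \/ (l', k') = (k, l).
Proof.
move=> e; have E x : (x == l) || (x == k) = (x == l') || (x == k').
  by move/setP: (e) => /(_ (vL x)); rewrite !inE.
have := E l; have := E k; have := E l'; have := E k'; rewrite !eqxx ?orbT /=.
move=> /orP[]/eqP-> /orP[]/eqP->; rewrite ?orbb; [|by right|by left|].
  by move=> /esym/eqP-> _; left.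
by move=> _ /esym/eqP->; left.
Qed.

End Geometry.
Arguments vL {L P} l.
Arguments vP {L P} b.
Arguments vF {L P} h.

(** * Double counting and the numbers of simplices *)

Section Counting.
Local Open Scope set_scope.
Variables A B : finType.

Lemma card_rel_l (r : A -> B -> bool) :
  #|[set p : A * B | r p.1 p.2]| = \sum_a #|[set b | r a b]|.
Proof.
rewrite -sum1dep_card -(pair_big_dep xpredT r (fun _ _ => 1)) /=.
by apply: eq_bigr => a _; rewrite sum1dep_card.
Qed.

Lemma card_rel_r (r : A -> B -> bool) :
  #|[set p : A * B | r p.1 p.2]| = \sum_b #|[set a | r a b]|.
Proof.
rewrite -sum1dep_card -(pair_big_dep xpredT r (fun _ _ => 1)) /=.
rewrite (exchange_big_dep xpredT) //=; apply: eq_bigr => b _.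
by rewrite sum1dep_card.
Qed.

(** Meant for simplices with two interchangeable lines; [s] swaps the lines. *)
Lemma card_two_to_one (f : A -> B) (X : {set A}) (s : A -> A) :
  (forall x, x \in X -> [/\ s x \in X, s x != x & f (s x) = f x]) ->
  {in X &, forall x y, f x = f y -> y = x \/ y = s x} -> #|X| = 2 * #|f @: X|.
Proof.
move=> sX fX; rewrite -sum1_card (partition_big_imset f) /= mulnC.
rewrite (eq_bigr (fun=> 2)) ?sum_nat_const // => _ /imsetP[x xX ->].
have [sxX sx fsx] := sX _ xX; rewrite sum1dep_card.
rewrite (_ : [set _ | _] = [set x; s x]) ?cards2 1?eq_sym ?sx //.
apply/setP=> y; rewrite !inE; apply/andP/orP.
  by move=> [yX /eqP/esym/(fX _ _ xX yX)[]->]; [left|right].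
by case=> /eqP->; rewrite ?xX ?sxX ?fsx.
Qed.

Lemma card_disjointU (X Y : {set A}) : (forall x, x \in X -> x \in Y -> False) ->
  #|X :|: Y| = #|X| + #|Y|.
Proof.
move=> XY; rewrite cardsU (_ : X :&: Y = set0) ?cards0 ?subn0 //.
by apply/setP=> x; rewrite !inE; apply/negP=> /andP[/XY].
Qed.
End Counting.

Section GeometryCounting.
Local Open Scope set_scope.
Variables (L P : finType) (inF : rel L) (inP : L -> P -> bool) (perpP : P -> L -> bool).
Hypothesis IG : incidence_geometry inF inP perpP.
Local Notation vtx := (L + P + L)%type.
Implicit Types (l h k : L) (b : P) (T X : {set vtx}).

Lemma card_inF_pairs : #|[set p : L * L | inF p.1 p.2]| = 480.
Proof.
rewrite card_rel_r (eq_bigr (fun=> 12)) => [|h _]; last exact: (ig_card_inF IG).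
by rewrite sum_nat_const (ig_card_line IG).
Qed.

Lemma card_inP_pairs : #|[set p : L * P | inP p.1 p.2]| = 360.
Proof.
rewrite card_rel_r (eq_bigr (fun=> 4)) => [|h _]; last exact: (ig_card_inP IG).
by rewrite sum_nat_const (ig_card_plane IG).
Qed.

Lemma card_perpP_pairs : #|[set p : P * L | perpP p.1 p.2]| = 360.
Proof.
rewrite card_rel_l (eq_bigr (fun=> 4)) => [|h _]; last exact: (ig_card_perpP IG).
by rewrite sum_nat_const (ig_card_plane IG).
Qed.

Lemma card_edge_LL : #|edge_LL P inF| = 240.
Proof.
have : #|[set p : L * L | inF p.1 p.2]| = 2 * #|edge_LL P inF|.
  apply: (card_two_to_one (s := fun p => (p.2, p.1))).
    move=> [l k]; rewrite !inE /= => lk; rewrite (ig_sym IG) lk setUC; split=> //.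
    by apply: contraTneq lk => -[->]; rewrite (ig_irr IG).
  by move=> [l k] [l' k'] _ _ /= /pair_LL.
by rewrite card_inF_pairs -[480]/(2 * 240) => /eqP; rewrite eqn_pmul2l // => /eqP.
Qed.

Lemma card_edge_LP : #|edge_LP inP| = 360.
Proof.
rewrite card_in_imset ?card_inP_pairs // => -[l b] [l' b'] _ _ /= /pair_LP[-> ->] //.
Qed.

Lemma card_edge_LF : #|edge_LF P inF| = 480.
Proof.
rewrite card_in_imset ?card_inF_pairs // => -[l b] [l' b'] _ _ /= /pair_LF[-> ->] //.
Qed.

Lemma card_edge_PF : #|edge_PF perpP| = 360.
Proof.
rewrite card_in_imset ?card_perpP_pairs // => -[l b] [l' b'] _ _ /= /pair_PF[-> ->] //.
Qed.

Lemma card_edge_LP_perp : #|edge_LP_perp perpP| = 360.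
Proof.
rewrite card_in_imset => [|[l b] [l' b'] _ _ /= /pair_LP[-> ->] //].
rewrite (card_rel_r (fun l b => perpP b l)) -card_perpP_pairs card_rel_l //.
Qed.

(** The types of the vertices tell the kinds of edges apart, except for the two kinds joining a line
    and a plane. These are disjoint because no line of $b^\perp$ lies in [b]. *)
Lemma card_edges : #|edges inF inP perpP| = 1800.
Proof.
rewrite !card_disjointU ?card_edge_LL ?card_edge_LP ?card_edge_LF ?card_edge_PF
  ?card_edge_LP_perp //.
- move=> X /imsetP[[l l'] _ ->] /imsetP[[k b] _ /setP/(_ (vP b))]; by rewrite !inE eqxx orbT.
- move=> X; rewrite inE => /orP[] /imsetP[[l l'] _ ->] /imsetP[[k h] _ /setP/(_ (vF h))];
    by rewrite !inE eqxx orbT.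
- move=> X; rewrite !inE -orbA => /or3P[] /imsetP[[l l'] _ ->] /imsetP[[b h] _ e].
  + by move/setP/(_ (vF h)): e; rewrite !inE eqxx orbT.
  + by move/setP/(_ (vF h)): e; rewrite !inE eqxx orbT.
  + by move/setP/(_ (vP b)): e; rewrite !inE eqxx.
- move=> X; rewrite !inE -!orbA => /or4P[] /imsetP[[l l'] H1 ->] /imsetP[[k b] H2 /= e].
  + by move/setP/(_ (vP b)): e; rewrite !inE eqxx orbT.
  + case/pair_LP: e => e1 e2; move: H1 H2; rewrite !inE /= e1 e2 => kb.
    by move/(ig_plane_perpN IG)/negP.
  + by move/setP/(_ (vP b)): e; rewrite !inE eqxx orbT.
  + by move/setP/(_ (vL k)): e; rewrite !inE eqxx.
Qed.

Lemma card_tri_LPF : #|tri_LPF inP perpP| = 1440.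
Proof.
rewrite card_in_imset => [|[[l b] h] [[l' b'] h'] _ _ /= e].
  rewrite (card_rel_l (fun q h => inP q.1 q.2 && perpP q.2 h)).
  rewrite (eq_bigr (fun q : L * P => if inP q.1 q.2 then 4 else 0)).
    by rewrite -big_mkcond sum_nat_const -cardsE card_inP_pairs.
  move=> [l b] _ /=; case: (inP l b) => /=; first exact: (ig_card_perpP IG).
  by rewrite -[RHS](cards0 L); apply: eq_card => x; rewrite !inE.
have /setP E := e; have El := E (vL l); have Eb := E (vP b); have Eh := E (vF h).
move: El Eb Eh; rewrite !inE !eqxx /= !orbF ?orbT => /esym/eqP[->] /esym/eqP[->].
by move=> /esym/eqP[->].
Qed.

(** The two lines are not interchangeable, as one lies in [b] and the other in $b^\perp$. Hence each
    of the 90 planes accounts for $4\cdot 4$ triangles. *)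
Lemma card_tri_LLP : #|tri_LLP inP perpP| = 1440.
Proof.
rewrite card_in_imset => [|[[l k] b] [[l' k'] b'] /=].
  rewrite (card_rel_r (fun (q : L * L) b => inP q.1 b && perpP b q.2)).
  rewrite (eq_bigr (fun=> 16)) ?sum_nat_const ?(ig_card_plane IG) // => b _.
  transitivity #|setX [set l | inP l b] [set k | perpP b k]|.
    by apply: eq_card => q; rewrite !inE.
  by rewrite cardsX (ig_card_inP IG) (ig_card_perpP IG).
rewrite !inE /= => /andP[lb bk] /andP[lb' bk'] e.
have /setP/(_ (vP b)) := e; rewrite !inE !eqxx /= => /esym/eqP[be].
subst b'; have E x : (x == l) || (x == k) = (x == l') || (x == k').
  by move/setP: (e) => /(_ (vL x)); rewrite !inE /= !orbF.
have e' : [set vL l; vL k] = [set vL l'; vL k'] :> {set vtx}.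
  by apply/setP=> -[[x|x]|x]; rewrite !inE //=; apply: E.
case: (pair_LL e') => -[e1 e2]; first by rewrite e1 e2.
by have := ig_plane_perpN IG bk'; rewrite e2 lb.
Qed.

(** For orthogonal [l], [k], the admissible [h] are the two remaining lines of the isotropic plane
    through them. This gives $480\cdot 2$ ordered triples, two for each triangle. *)
Lemma card_tri_LLF : #|tri_LLF P inF| = 480.
Proof.
have : #|[set p : L * L * L | [&& inF p.1.1 p.1.2, inF p.1.1 p.2 & inF p.1.2 p.2]]| =
    2 * #|tri_LLF P inF|.
  apply: (card_two_to_one (s := fun p => (p.1.2, p.1.1, p.2))).
    move=> [[l k] h]; rewrite !inE /= => /and3P[lk lh kh].
    rewrite (ig_sym IG) lk lh kh [[set vL k] :|: _]setUC; split=> //.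
    by apply: contraTneq lk => -[->]; rewrite (ig_irr IG).
  move=> [[l k] h] [[l' k'] h'] _ _ /= e.
  have /setP/(_ (vF h)) := e; rewrite !inE !eqxx /= => /esym/eqP[he].
  have e' : [set vL l; vL k] = [set vL l'; vL k'] :> {set vtx}.
    apply/setP=> -[[x|x]|x]; rewrite !inE //=.
    by move/setP: (e) => /(_ (vL x)); rewrite !inE /= !orbF.
  by case: (pair_LL e') => -[-> ->]; rewrite he; [left|right].
rewrite (card_rel_l (fun q h => [&& inF q.1 q.2, inF q.1 h & inF q.2 h])).
rewrite (eq_bigr (fun q : L * L => if inF q.1 q.2 then 2 else 0)).
  rewrite -big_mkcond sum_nat_const -cardsE card_inF_pairs mulnC => /eqP.
  by rewrite eqn_pmul2l // => /eqP.
move=> [l k] _ /=; case: (boolP (inF l k)) => lk /=.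
  rewrite -(ig_card_inF2 IG lk); apply: eq_card => x.
  by rewrite !inE (ig_sym IG l) (ig_sym IG k).
by rewrite -[RHS](cards0 L); apply: eq_card => x; rewrite !inE.
Qed.

Lemma card_triangles : #|triangles inF inP perpP| = 3360.
Proof.
rewrite !card_disjointU ?card_tri_LLF ?card_tri_LPF ?card_tri_LLP //.
  move=> X /imsetP[[[l l'] h] _ ->] /imsetP[[[k b] h'] _ /setP/(_ (vP b))].
  by rewrite !inE eqxx orbT.
move=> X; rewrite inE => /orP[] /imsetP[[[l l'] h] _ ->] /imsetP[[[k k'] b] _ /setP/(_ (vF h))];
  by rewrite !inE eqxx ?orbT.
Qed.

Lemma pair_sub3 (V : finType) (A : {set V}) x y z : A \subset [set x; y; z] -> #|A| = 2 ->
  [\/ A = [set x; y], A = [set x; z] | A = [set y; z]].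
Proof.
move=> sA /eqP/cards2P[a [b [ab E]]]; subst A; move: sA ab; rewrite subUset !sub1set !inE -!orbA.
case/andP=> /or3P[]/eqP-> /or3P[]/eqP->; rewrite ?eqxx // => _.
- by constructor 1.
- by constructor 2.
- by constructor 1; rewrite setUC.
- by constructor 3.
- by constructor 2; rewrite setUC.
- by constructor 3; rewrite setUC.
Qed.

Definition simplices_of (F : {set {set vtx}}) : {set {set vtx}} :=
  [set X : {set vtx} | [exists T in F, X \subset T]].

Lemma edge_in_triangle X : X \in edges inF inP perpP ->
  exists2 T, T \in triangles inF inP perpP & X \subset T.
Proof.
have sub2 (x y z : vtx) : [set x; y] \subset [set x; y; z] by rewrite subsetUl.
have sub3 (x y z : vtx) : [set x; z] \subset [set x; y; z].
  by rewrite subUset !sub1set !inE !eqxx !orbT.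
have sub4 (x y z : vtx) : [set y; z] \subset [set x; y; z].
  by rewrite subUset !sub1set !inE !eqxx !orbT.
have linP b : exists l, inP l b.
  have /set0Pn[l] : [set l | inP l b] != set0 by rewrite -card_gt0 (ig_card_inP IG).
  by rewrite inE; exists l.
have linF b : exists l, perpP b l.
  have /set0Pn[l] : [set l | perpP b l] != set0 by rewrite -card_gt0 (ig_card_perpP IG).
  by rewrite inE; exists l.
rewrite !in_setU -!orbA => /or4P[|||/orP[]] /imsetP[[x y]]; rewrite inE /= => xy ->.
- have [z zx zy] := third_line IG xy; exists [set vL x; vL y; vF z] => //.
  by apply: triangle_LLF; rewrite // (ig_sym IG).
- have [z yz] := linF y; exists [set vL x; vP y; vF z] => //; exact: triangle_LPF.
- have [z /andP[xz zy]] := ig_plane_flag IG xy; exists [set vL x; vP z; vF y] => //.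
  exact: triangle_LPF.
- have [z zx] := linP x; exists [set vL z; vP x; vF y] => //; exact: triangle_LPF.
- have [z zy] := linP y; exists [set vL z; vL x; vP y] => //; exact: triangle_LLP.
Qed.

Lemma simplices_card2 :
  [set X in simplices_of (triangles inF inP perpP) | #|X| == 2] = edges inF inP perpP.
Proof.
have e1 x y : inF x y -> [set vL x; vL y] \in edges inF inP perpP.
  move=> xy; rewrite !in_setU -!orbA; apply/or4P; constructor 1.
  by apply/imsetP; exists (x, y); rewrite ?inE.
have e2 x y : inP x y -> [set vL x; vP y] \in edges inF inP perpP.
  move=> xy; rewrite !in_setU -!orbA; apply/or4P; constructor 2.
  by apply/imsetP; exists (x, y); rewrite ?inE.
have e3 x y : inF x y -> [set vL x; vF y] \in edges inF inP perpP.
  move=> xy; rewrite !in_setU -!orbA; apply/or4P; constructor 3.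
  by apply/imsetP; exists (x, y); rewrite ?inE.
have e4 x y : perpP x y -> [set vP x; vF y] \in edges inF inP perpP.
  move=> xy; rewrite !in_setU -!orbA; apply/or4P; constructor 4; apply/orP; left.
  by apply/imsetP; exists (x, y); rewrite ?inE.
have e5 x y : perpP y x -> [set vL x; vP y] \in edges inF inP perpP.
  move=> xy; rewrite !in_setU -!orbA; apply/or4P; constructor 4; apply/orP; right.
  by apply/imsetP; exists (x, y); rewrite ?inE.
apply/setP=> X; rewrite inE; apply/andP/idP => [[]|XE].
  rewrite inE => /exists_inP[T /triangleP TT XT] /eqP X2.
  case: TT XT => -[x [y [z []]]].
  - by move=> xy xz yz -> /pair_sub3/(_ X2)[]->; [apply: e1|apply: e3|apply: e3].
  - move=> xy yz -> /pair_sub3/(_ X2)[]->; [exact: e2|apply: e3|exact: e4].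
    exact: (ig_plane_inF IG xy yz).
  - move=> xz zy -> /pair_sub3/(_ X2)[]->; [apply: e1|exact: e2|exact: e5].
    exact: (ig_plane_inF IG xz zy).
have [T TT XT] := edge_in_triangle XE; split.
  by rewrite inE; apply/exists_inP; exists T.
move: XE; rewrite !in_setU -!orbA => /or4P[|||/orP[]] /imsetP[[x y]]; rewrite inE /= => xy ->;
  rewrite cards2 // (_ : _ != _) //.
by apply: contraTneq xy => -[->]; rewrite (ig_irr IG).
Qed.

Lemma simplices_card3 :
  [set X in simplices_of (triangles inF inP perpP) | #|X| == 3] = triangles inF inP perpP.
Proof.
apply/setP=> X; rewrite inE; apply/andP/idP => [[]|XT].
  rewrite inE => /exists_inP[T TT XT] /eqP X3.
  by rewrite (_ : X = T) //; apply/eqP; rewrite eqEcard XT (card_triangle IG TT) X3.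
by rewrite (card_triangle IG XT) inE; split=> //; apply/exists_inP; exists X.
Qed.

Lemma simplices_card1 :
  [set X in simplices_of (triangles inF inP perpP) | #|X| == 1] = [set [set v] | v : vtx].
Proof.
apply/setP=> X; rewrite inE; apply/andP/imsetP => [[_ /cards1P[v ->]]|[v _ ->]].
  by exists v.
rewrite cards1 inE; split=> //; have [T TT vT] := vertex_in_triangle IG v.
by apply/exists_inP; exists T; rewrite ?sub1set.
Qed.

Lemma simplices_card0 :
  [set X in simplices_of (triangles inF inP perpP) | #|X| == 0] = [set set0].
Proof.
apply/setP=> X; rewrite !inE cards_eq0 andb_idl // => /eqP->.
have /card_gt0P[T TT] : 0 < #|triangles inF inP perpP| by rewrite card_triangles.
by apply/exists_inP; exists T; rewrite ?sub0set.
Qed.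

Lemma simplices_card_le3 X : X \in simplices_of (triangles inF inP perpP) -> #|X| < 4.
Proof.
rewrite inE => /exists_inP[T TT XT].
by rewrite ltnS -(card_triangle IG TT) subset_leq_card.
Qed.

Lemma card_vertices : #|[set [set v] | v : vtx]| = 170.
Proof.
rewrite card_imset; last exact: set1_inj.
by rewrite !card_sum (ig_card_line IG) (ig_card_plane IG).
Qed.

End GeometryCounting.

From mathcomp Require Import boolp classical_sets functions cardinality fsbigop.
From mathcomp Require Import reals.

Import Order.TTheory GRing.Theory Num.Theory.
Local Open Scope classical_set_scope.
Local Open Scope ring_scope.

(** * Cones and coarsest fans *)

Section Cones.
Variables (R : realType) (E : finType).
Local Notation V := {ffun E -> R^o}.
Implicit Types (x y v f g : V) (vs L : seq V) (s t : set V).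

Lemma pairing_linear f : linear (pairing f : V -> R^o).
Proof.
move=> a x y; rewrite /pairing scaler_sumr -big_split; apply: eq_bigr => i _ /=.
by rewrite !ffunE /GRing.scale /=; ring.
Qed.
HB.instance Definition _ f :=
  GRing.isLinear.Build R V R^o _ (pairing f) (@pairing_linear f).

Lemma pairingC f x : pairing f x = pairing x f.
Proof. by apply: eq_bigr => i _; rewrite mulrC. Qed.

Lemma pairingDr f x y : pairing f (x + y) = pairing f x + pairing f y.
Proof. exact: linearD. Qed.

Lemma pairingZr f a x : pairing f (a *: x) = a * pairing f x.
Proof. exact: linearZ. Qed.

Lemma pairingBl f g x : pairing (f - g) x = pairing f x - pairing g x.
Proof. by rewrite pairingC linearB /= !(pairingC x). Qed.

Lemma pairingZl f a x : pairing (a *: f) x = a * pairing f x.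
Proof. by rewrite pairingC pairingZr pairingC. Qed.

Lemma pairing_unit (i : E) x : pairing (unit_vec R i) x = x i.
Proof.
rewrite /pairing (bigD1 i) //= ffunE eqxx mul1r big1 ?addr0 // => j ji.
by rewrite ffunE (negbTE ji) mul0r.
Qed.

Lemma cone_cons v vs x :
  cone (v :: vs) x <-> exists a : R, 0 <= a /\ cone vs (x - a *: v).
Proof.
split=> [[c [a [a0 ->]]]|[a [a0 [c [b [b0 e]]]]]].
  exists (a ord0); split=> //; exists c, (a \o lift ord0); split=> [i|]; first exact: a0.
  by rewrite big_ord_recl /= [a ord0 *: v + _]addrC addrA addrK.
exists c, (fun i : 'I_(size vs).+1 => if unlift ord0 i is Some j then b j else a).
split=> [i|]; first by case: unliftP.
rewrite big_ord_recl unlift_none /=.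
under eq_bigr do rewrite liftK.
by rewrite -(subrK (a *: v) x) e -addrA [_ + a *: v]addrC.
Qed.

Definition Hcone L : set V := [set x | forall f, f \in L -> 0 <= pairing f x].

(* Fourier-Motzkin elimination of the coefficient of each generator. *)
Lemma polyhedral_Hcone s : polyhedral_cone s -> exists L, s = Hcone L.
Proof.
move=> [vs ->]; elim: vs => [|v vs [L IH]].
  (* Without generators the cone is the line of constant vectors, cut out by all coordinate
     differences. *)
  exists [seq unit_vec R p.1 - unit_vec R p.2 | p <- enum {: E * E}].
  apply/seteqP; split=> x /=.
    move=> [c [a [_ ->]]] f /mapP[[i j] _ ->] /=.
    by rewrite big_ord0 addr0 pairingBl !pairing_unit !ffunE subrr.
  move=> xL.
  have xE i j : x j <= x i.
    have /xL : unit_vec R i - unit_vec R j \in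
        [seq unit_vec R p.1 - unit_vec R p.2 | p <- enum {: E * E}].
      by apply/mapP; exists (i, j); rewrite ?mem_enum.
    by rewrite pairingBl !pairing_unit subr_ge0.
  case: (pickP {: E}) => [i0 _|E0].
    exists (x i0), (fun=> 0); split=> //.
    rewrite big_ord0 addr0; apply/ffunP=> i; rewrite !ffunE /GRing.scale /= mulr1.
    by apply/eqP; rewrite eq_le !xE.
  by exists 0, (fun=> 0); split=> //; apply/ffunP=> i; have := E0 i.
exists ([seq f <- L | 0 <= pairing f v] ++
  [seq pairing p.2 v *: p.1 - pairing p.1 v *: p.2 |
     p <- [seq (f, g) | f <- [seq f <- L | pairing f v < 0],
                        g <- [seq g <- L | 0 < pairing g v]]]).
apply/seteqP; split=> x.
  move=> /cone_cons[a [a0]]; rewrite IH => xL f.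
  have {}xL g : g \in L -> a * pairing g v <= pairing g x.
    by move=> /xL; rewrite linearB /= pairingZr subr_ge0.
  rewrite mem_cat => /orP[|/mapP[[g h] /allpairsP[[g' h'] /= []]]].
    by rewrite mem_filter => /andP[fv /xL]; apply: le_trans; rewrite mulr_ge0.
  rewrite !mem_filter => /andP[gv /xL gx] /andP[hv /xL hx] [-> ->] -> /=.
  by rewrite pairingBl !pairingZl; nra.
move=> xL; apply/cone_cons.
pose N := [seq f <- L | pairing f v < 0].
(* The functionals negative at [v] bound the coefficient of [v] from below and those positive at [v]
   bound it from above; [a] is the least value meeting the lower bounds and $0$. *)
pose a := \big[Num.max/0]_(f <- N) (pairing f x / pairing f v).
have a0 : 0 <= a.
  by rewrite /a; elim: (N) => [|f N' IN]; rewrite ?big_nil // big_cons le_max IN orbT.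
have aN f : f \in N -> pairing f x / pairing f v <= a.
  rewrite /a; elim: (N) => // g N' IN; rewrite inE big_cons le_max => /orP[/eqP->|/IN->].
    by rewrite lexx.
  by rewrite orbT.
exists a; split=> //; rewrite IH => f fL; rewrite linearB /= pairingZr subr_ge0.
have xL1 g : g \in L -> 0 <= pairing g v -> 0 <= pairing g x.
  by move=> gL gv; apply: xL; rewrite mem_cat mem_filter gv gL.
have xL2 g h : g \in N -> h \in L -> 0 < pairing h v ->
    pairing g v * pairing h x <= pairing h v * pairing g x.
  move=> gN hL hv; rewrite -subr_ge0 -!pairingZl -pairingBl; apply: xL.
  rewrite mem_cat; apply/orP; right; apply/mapP; exists (g, h) => //.
  by apply/allpairsP; exists (g, h); rewrite /= gN mem_filter hv hL.
have [fv|fv|fv] := ltgtP (pairing f v) 0.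
- by rewrite -ler_ndivrMr // aN // mem_filter fv.
- rewrite -ler_pdivlMr //.
  suff : all [pred g | pairing g x / pairing g v <= pairing f x / pairing f v] N.
    have f0 : 0 <= pairing f x / pairing f v by rewrite divr_ge0 ?xL1 // ltW.
    rewrite /a; elim: (N) => [|g N' IN] /=; rewrite ?big_nil // big_cons ge_max.
    by move=> /andP[-> /IN].
  apply/allP=> g gN /=; have := xL2 _ _ gN fL fv; move: gN; rewrite mem_filter => /andP[gv _].
  by rewrite ler_ndivrMr // mulrAC ler_pdivrMr // mulrC [pairing g x * _]mulrC.
- by rewrite fv mulr0 xL1 // fv.
Qed.

Lemma polyhedral_add s x y : polyhedral_cone s -> s x -> s y -> s (x + y).
Proof.
move=> /polyhedral_Hcone[L ->] sx sy f fL.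
by rewrite pairingDr addr_ge0 ?sx ?sy.
Qed.

Lemma polyhedral_scale s (a : R) x : polyhedral_cone s -> 0 <= a -> s x -> s (a *: x).
Proof.
move=> /polyhedral_Hcone[L ->] a0 sx f fL.
by rewrite pairingZr mulr_ge0 ?sx.
Qed.

Lemma polyhedral_const s (c : R) : polyhedral_cone s -> s (c *: @all_ones R E).
Proof.
move=> [vs ->]; exists c, (fun=> 0); split=> //.
by rewrite big1 ?addr0 // => i _; rewrite scale0r.
Qed.

(** An inequality violated at [x] stays violated at [x + e *: v] for all small [e]. Closedness is
    needed only along a segment, and only for some arbitrarily small parameters, as the pigeonhole
    supplies them. *)
Lemma polyhedral_closed s x v : polyhedral_cone s ->
  (forall d : R, 0 < d -> exists e, [/\ 0 < e, e < d & s (x + e *: v)]) -> s x.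
Proof.
move=> /polyhedral_Hcone[L ->] sx f fL; rewrite leNgt; apply/negP=> fx.
have [fv|fv] := leP (pairing f v) 0.
  have [e [e0 _ /(_ f fL)]] := sx 1 ltr01.
  by rewrite pairingDr pairingZr; nra.
have [|e [e0 ed /(_ f fL)]] := sx (- pairing f x / pairing f v).
  by rewrite divr_gt0 // oppr_gt0.
by rewrite pairingDr pairingZr; move: ed; rewrite ltr_pdivlMr //; lra.
Qed.

(** Relative interior of a cone: from [x] one can move a little against every direction of the
    cone. *)
Definition relint s : set V :=
  [set x | s x /\ forall y, s y -> exists2 e : R, 0 < e & s (x - e *: y)].

Lemma relint_exists s : polyhedral_cone s -> exists x, relint s x.
Proof.
move=> [vs ->]; exists (\sum_(i < size vs) vs`_i); split.
  exists 0, (fun=> 1); split=> //; rewrite scale0r add0r.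
  by apply: eq_bigr => i _; rewrite scale1r.
move=> _ [c [a [a0 ->]]].
(* [S] bounds every [a i], so that subtracting $S^{-1}y$ keeps the coefficients $1-a_i/S$
   nonnegative. The summand $1$ keeps [S] positive when all [a i] vanish. *)
pose S := 1 + \sum_(i < size vs) a i.
have S0 : 0 < S by rewrite ltr_pwDl // sumr_ge0.
exists S^-1; first by rewrite invr_gt0.
exists (- (S^-1 * c)), (fun i => 1 - S^-1 * a i); split=> [i|].
  rewrite subr_ge0 mulrC ler_pdivrMr // mul1r /S (bigD1 i) //=.
  by rewrite addrCA lerDl addr_ge0 // sumr_ge0.
rewrite scalerDr scalerA opprD addrCA scaleNr; congr (_ + _).
rewrite scaler_sumr -sumrB; apply: eq_bigr => i _.
by rewrite scalerBl scale1r scalerA.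
Qed.

Lemma relint_shift s x y (t : R) :
  polyhedral_cone s -> relint s x -> s y -> 0 <= t -> relint s (x + t *: y).
Proof.
move=> ps [sx xi] sy t0; split.
  by apply: polyhedral_add => //; apply: polyhedral_scale.
move=> z /xi[e e0 sz]; exists e => //; rewrite addrAC.
by apply: polyhedral_add => //; apply: polyhedral_scale.
Qed.

(** A functional that is nonnegative on [s], zero at [x] and positive at [y] would be negative at
    [x - e *: y], which still lies in [s]. *)
Lemma relint_face s t x : face_of t s -> relint s x -> t x -> t = s.
Proof.
move=> [f [f0 ->]] [sx xi] [_ fx]; apply/seteqP; split=> [y []//|y sy]; split=> //.
apply/eqP; rewrite eq_le f0 // andbT; have [e e0 /f0] := xi _ sy.
by rewrite linearB /= fx sub0r pairingZr oppr_ge0 pmulr_rle0.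
Qed.

(** Stands in for a compactness argument: a segment leaving a point meets one of finitely many cones
    arbitrarily close to its start. *)
Lemma pigeonhole_near0 (T : choiceType) (F : set T) (P : T -> R -> Prop) :
  finite_set F -> (forall e : R, 0 < e -> exists2 s, F s & P s e) ->
  exists2 s, F s & forall d : R, 0 < d -> exists e, [/\ 0 < e, e < d & P s e].
Proof.
move=> /finite_seqP[l ->] H.
have {H} : forall d : R, 0 < d -> exists e, [/\ 0 < e, e < d & exists2 s, s \in l & P s e].
  move=> d d0; have [|s sl Ps] := H (d / 2); first by rewrite divr_gt0.
  by exists (d / 2); split; [lra|lra|exists s].
elim: l => [|s l IH] H; first by have [e [_ _ []]] := H 1 ltr01.
have [Hs|/existsNP[d0 /not_implyP[d00 Hs]]] :=
  pselect (forall d : R, 0 < d -> exists e, [/\ 0 < e, e < d & P s e]).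
  by exists s => //=; rewrite mem_head.
case: IH => [d dp|t tl Pt]; last by exists t => //=; rewrite inE [t \in l]tl orbT.
(* No parameter below [d0] belongs to [s]; with the bound [d0] added, only the remaining members of
   the list can occur. *)
have [|e [e0 ed [t]]] := H (Num.min d d0); first by rewrite lt_min dp.
move: ed; rewrite lt_min inE => /andP[ed ed0] /orP[/eqP->|tl] Pt.
  by case: Hs; exists e.
by exists e; split=> //; exists t.
Qed.

(** Refinement in both directions puts a cone [t] of one structure between cones [s] and [s'] of the
    other. As $s = s\cap s'$ is a face of [s'], the same functional makes it a face of [t], hence a
    cone of the structure of [t]. *)
Lemma coarsest_unique (X : set V) F G :
  coarsest_fan_structure X F -> coarsest_fan_structure X G -> F = G.
Proof.
have H F' G' : coarsest_fan_structure X F' -> coarsest_fan_structure X G' -> F' `<=` G'.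
  move=> [FX cF] [GX cG] s Fs.
  have [t [Gt st]] := cG _ FX _ Fs.
  have [s' [Fs' ts']] := cF _ GX _ Gt.
  have ss' : s `&` s' = s by apply/seteqP; split=> [x []//|x sx]; split=> //; apply/ts'/st.
  have [f [f0 sE]] : face_of s s' by rewrite -ss'; case: FX => -[_ _ _ H] _; case: (H s s').
  case: GX => -[_ _ H _] _; apply: (H t) => //; exists f; split=> [x /ts'/f0//|].
  rewrite {1}sE; apply/seteqP; split=> x [].
    by move=> s'x fx; split=> //; apply: st; rewrite sE.
  by move=> /ts' s'x fx.
by move=> cF cG; apply/seteqP; split; apply: H.
Qed.
End Cones.

(** * Fans over simplicial complexes whose vertices are sets *)

Section Complexes.
Variables (R : realType) (E I : finType) (m : I -> {set E}) (Tri : {set {set I}}).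
Local Notation V := {ffun E -> R^o}.
Implicit Types (x y : V) (s t : set V) (A B T : {set I}) (u v w : I) (a b : I -> R).

Definition ind v : V := [ffun i => (i \in m v)%:R].

Definition comb A (c : R) a : V := c *: @all_ones R E + \sum_(v in A) a v *: ind v.

Definition mcone A : set V :=
  [set x | exists c a, (forall v, v \in A -> 0 <= a v) /\ x = comb A c a].

Definition faces : {set {set I}} := [set A : {set I} | [exists T in Tri, A \subset T]].

Definition fan0 : set (set V) := [set mcone A | A in [set` faces]].

(** [separated] makes coefficients readable as coordinate differences. [uncovered] and [laminar]
    make two cones meet in a common face. [pure] and [wall] serve the comparison with an arbitrary
    fan structure. *)
Hypothesis separated : forall T v, T \in Tri -> v \in T ->
  exists p q, [/\ p \in m v, q \notin m v &
    forall w, w \in T -> w != v -> (p \in m w) = (q \in m w)].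
Hypothesis uncovered : forall T (W : {set E}), T \in Tri ->
  W = [set: E]%SET \/ (exists w, W = m w) ->
  exists2 j, j \in W & forall u, u \in T -> j \in m u -> W \subset m u.
Hypothesis laminar : forall T u w, T \in Tri -> u \in T -> w \in T ->
  [\/ m u \subset m w, m w \subset m u | (m u :&: m w)%SET = finset.set0].
Hypothesis m_inj : injective m.
Hypothesis m_neqT : forall v, m v != [set: E]%SET.
Hypothesis m_neq0 : forall v, m v != finset.set0.
Hypothesis pure : exists k, forall T, T \in Tri -> #|T| = k.
Hypothesis wall : forall T v, T \in Tri -> v \in T ->
  exists T' p q, [/\ T' \in Tri, T :\ v \subset T',
    (p \in m v) != (q \in m v) & forall u, u \in T' -> (p \in m u) = (q \in m u)].

Lemma combE A c a i : comb A c a i = c + \sum_(v in A | i \in m v) a v.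
Proof.
rewrite !ffunE sum_ffunE /GRing.scale /= mulr1; congr (_ + _).
rewrite [RHS]big_mkcondr; apply: eq_bigr => v _.
by rewrite !ffunE /GRing.scale /=; case: ifP => _; rewrite ?mulr1 ?mulr0.
Qed.

Lemma facesP A : reflect (exists2 T, T \in Tri & A \subset T) (A \in faces).
Proof. by rewrite inE; apply: (iffP exists_inP). Qed.

Lemma faces_sub A B : A \subset B -> B \in faces -> A \in faces.
Proof.
move=> AB /facesP[T TT BT]; apply/facesP; exists T => //; exact: fintype.subset_trans BT.
Qed.

Lemma comb_supp A B c a : B \subset A -> (forall v, v \in A -> v \notin B -> a v = 0) ->
  comb A c a = comb B c a.
Proof.
move=> BA a0; congr (_ + _).
rewrite (big_setID B) /= (finset.setIidPr BA) [X in _ + X]big1 ?addr0 //.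
by move=> v; rewrite inE => /andP[vB vA]; rewrite a0 // scale0r.
Qed.

Lemma comb_linear A c a d b (t : R) :
  comb A c a + t *: comb A d b = comb A (c + t * d) (fun v => a v + t * b v).
Proof.
rewrite /comb scalerDr scalerA addrACA -scalerDl scaler_sumr -big_split /=.
by congr (_ + _); apply: eq_bigr => v _; rewrite scalerA -scalerDl.
Qed.

Lemma mcone_comb A c a : (forall v, v \in A -> 0 <= a v) -> mcone A (comb A c a).
Proof. by move=> a0; exists c, a. Qed.

Lemma mcone_supp A x : mcone A x -> exists B c a,
  [/\ B \subset A, forall v, v \in B -> 0 < a v & x = comb B c a].
Proof.
move=> [c [a [a0 ->]]]; exists [set v in A | 0 < a v]%SET, c, a.
split=> [||]; first by apply/fintype.subsetP=> v; rewrite inE => /andP[].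
  by move=> v; rewrite inE => /andP[].
apply: comb_supp; first by apply/fintype.subsetP=> v; rewrite inE => /andP[].
by move=> v vA; rewrite inE vA /= => av; apply/eqP; rewrite eq_le a0 // leNgt av.
Qed.

Lemma mcone_sub_mono A B : A \subset B -> mcone A `<=` mcone B.
Proof.
move=> AB _ [c [a [a0 ->]]]; exists c, (fun v => if v \in A then a v else 0).
split=> [v _|]; first by case: ifP => // /a0.
rewrite (comb_supp _ AB); last by move=> v _ /negbTE->.
by congr (_ + _); apply: eq_bigr => v ->.
Qed.

Lemma sum_enum_ind A (f : nat -> V) : \sum_(i < size [seq ind v | v <- enum A]) f i =
  \sum_(v in A) f (index v (enum A)).
Proof.
rewrite size_map -(big_enum _ _ _ (fun v => f (index v (enum A)))) /=.
case E0: (enum A) => [|v0 l]; first by rewrite big_ord0 big_nil.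
rewrite -E0 (big_nth v0) big_mkord; apply: eq_bigr => i _.
by rewrite index_uniq ?enum_uniq.
Qed.

Lemma nth_ind A v : v \in A -> [seq ind w | w <- enum A]`_(index v (enum A)) = ind v.
Proof. by move=> vA; rewrite (nth_map v) ?nth_index ?index_mem ?mem_enum. Qed.

(** Passes from coefficients on list positions to coefficients on vertices. The second clause
    transports nonnegativity, the third the vanishing of all coefficients. *)
Lemma sum_ord_ind A (a : 'I_(size [seq ind v | v <- enum A]) -> R) : exists b,
  [/\ \sum_(i < size [seq ind v | v <- enum A]) a i *: [seq ind v | v <- enum A]`_i =
      \sum_(v in A) b v *: ind v,
      forall v, v \in A -> exists i, b v = a i &
      forall i, exists2 v, v \in A & a i = b v].
Proof.
exists (fun v => if insub (index v (enum A)) is Some i then a i else 0).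
have sz v : v \in A -> (index v (enum A) < size [seq ind v | v <- enum A])%N.
  by move=> vA; rewrite size_map index_mem mem_enum.
split=> [|v vA|i]; last 1 first.
- have iA : (i < size (enum A))%N by rewrite -(size_map ind).
  have [v0 _] : exists v : I, true.
    by move: (leq_ltn_trans (leq0n i) iA); case: (enum A) => // v0 l _; exists v0.
  exists (nth v0 (enum A) i); first by rewrite -mem_enum mem_nth.
  by rewrite index_uniq ?enum_uniq // valK.
- pose f n := if insub n is Some i then a i *: [seq ind v | v <- enum A]`_n else 0.
  transitivity (\sum_(i < size [seq ind v | v <- enum A]) f i).
    by apply: eq_bigr => i _; rewrite /f valK.
  rewrite sum_enum_ind; apply: eq_bigr => v vA; rewrite /f nth_ind //.
  by case: insub => //; rewrite scale0r.
- by rewrite (insubT (fun n => (n < size _)%N) (sz v vA)); eexists.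
Qed.

Lemma mconeE A : mcone A = cone [seq ind v | v <- enum A].
Proof.
apply/seteqP; split=> x [c [a [a0 ->]]].
  case E0: (enum A) => [|v0 l].
    exists c, (fun=> 0); split=> //; congr (_ + _); rewrite big_ord0.
    by rewrite -big_enum E0 big_nil.
  rewrite -E0; exists c, (fun i => a (nth v0 (enum A) i)); split=> [i|].
    by apply: a0; rewrite -mem_enum mem_nth // -(size_map ind).
  congr (_ + _); rewrite (sum_enum_ind A (fun i => a (nth v0 (enum A) i) *: _`_i)).
  by apply: eq_bigr => v vA; rewrite nth_ind // nth_index ?mem_enum.
have [b [-> bA _]] := sum_ord_ind a; exists c, b; split=> // v /bA[i ->]; exact: a0.
Qed.

Lemma polyhedral_mcone A : polyhedral_cone (mcone A).
Proof. by exists [seq ind v | v <- enum A]; exact: mconeE. Qed.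

Lemma comb_sep T A v c a p q : A \subset T -> v \in A ->
  p \in m v -> q \notin m v ->
  (forall w, w \in T -> w != v -> (p \in m w) = (q \in m w)) ->
  comb A c a p - comb A c a q = a v.
Proof.
move=> AT vA pv qv pq; rewrite !combE !big_mkcondr /= !(bigD1 v vA) /= pv (negbTE qv).
rewrite (eq_bigr (fun w => if q \in m w then a w else 0)); first by lra.
by move=> w /andP[wA wv]; rewrite pq // (fintype.subsetP AT).
Qed.

Lemma comb_coef A c a d b v : A \in faces -> v \in A ->
  comb A c a = comb A d b -> a v = b v.
Proof.
move=> /facesP[T TT AT] vA e.
have [p [q [pv qv pq]]] := separated TT (fintype.subsetP AT _ vA).
by rewrite -(comb_sep c a AT vA pv qv pq) e (comb_sep d b AT vA pv qv pq).
Qed.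

Lemma comb_support A B c a d b v : A \in faces -> B \in faces ->
  (forall u, u \in A -> 0 <= a u) -> (forall u, u \in B -> 0 <= b u) ->
  comb A c a = comb B d b -> v \in A -> 0 < a v -> v \in B.
Proof.
move=> /facesP[T TT AT] /facesP[T' TT' BT'] a0 b0 e vA av; apply: contraT => vB.
have [W [HW vW Wmin]] : exists W : {set E}, [/\ W = [set: E]%SET \/ (exists w, W = m w),
   m v \proper W & forall u, u \in B -> m v \subset m u -> W \subset m u].
  have [/existsP[w0 w0P]|/existsPn nw] := boolP [exists w, (w \in B) && (m v \subset m w)].
    case: (@arg_minnP _ w0 (fun w => (w \in B) && (m v \subset m w)) (fun w => #|m w|) w0P).
    move=> w /andP[wB vw] wmin.
    exists (m w); split; first by right; exists w.
      rewrite finset.properEneq vw andbT; apply: contraNneq vB => /m_inj->//.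
    move=> u uB vu; have uP : (u \in B) && (m v \subset m u) by rewrite uB.
    (* Both sets contain the nonempty set [m v], so they are nested, and the one of least
       cardinality lies inside the other. *)
    have [//|uw|dis] := laminar TT' (fintype.subsetP BT' _ wB) (fintype.subsetP BT' _ uB).
      by have /eqP-> : m u == m w by rewrite eqEcard uw wmin.
    have /finset.set0Pn[i iv] := m_neq0 v.
    have iu := fintype.subsetP vu _ iv; have iw := fintype.subsetP vw _ iv.
    by move: dis => /setP/(_ i); rewrite !inE iu iw.
  exists [set: E]%SET; split; [by left| |].
    by rewrite finset.properEneq m_neqT finset.subsetT.
  by move=> u uB vu; have := nw u; rewrite uB vu.
(* [i] realises the minimum over [m v] as seen by [B], and [j] the minimum over [W] as seen by
   [A]. *)
have [i iv iB] := uncovered TT' (or_intror (ex_intro _ v erefl)).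
have [j jW jA] := uncovered TT HW.
have : comb B d b i <= comb B d b j.
  rewrite !combE lerD2l !big_mkcondr /=; apply: ler_sum => u uB.
  have := iB _ (fintype.subsetP BT' _ uB).
  case: (i \in m u) => [/(_ isT) vu|_]; last by case: ifP => // _; apply: b0.
  by rewrite (fintype.subsetP (Wmin _ uB vu) _ jW).
rewrite -e !combE lerD2l leNgt => /negP[].
rewrite !big_mkcondr /= !(bigD1 v vA) /= iv.
case: ifP => [/(jA _ (fintype.subsetP AT _ vA))|_].
  by move: vW; rewrite fintype.properE => /andP[_ /negP].
rewrite add0r ltr_pwDl //; apply: ler_sum => u /andP[uA _].
have := jA _ (fintype.subsetP AT _ uA).
case: (j \in m u) => [/(_ isT) Wu|_]; last by case: ifP => // _; apply: a0.
by rewrite (fintype.subsetP (fintype.subset_trans (proper_sub vW) Wu) _ iv).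
Qed.

Lemma mconeI A B : A \in faces -> B \in faces ->
  mcone A `&` mcone B = mcone (A :&: B)%SET.
Proof.
move=> fA fB; apply/seteqP; split=> x.
  move=> [[c [a [a0 ->]]] [d [b [b0 e]]]].
  exists c, a; split=> [v /setIP[vA _]|]; first exact: a0.
  apply: comb_supp; first exact: finset.subsetIl.
  move=> v vA; rewrite inE vA /= => vB; apply/eqP; rewrite eq_le a0 // andbT leNgt.
  by apply: contra vB => av; apply: (comb_support fA fB a0 b0 e).
by move=> xAB; split; apply: mcone_sub_mono xAB; rewrite ?finset.subsetIl ?finset.subsetIr.
Qed.

Lemma mcone_sub A B : A \in faces -> B \in faces -> mcone A `<=` mcone B -> A \subset B.
Proof.
move=> fA fB AB; apply/fintype.subsetP=> v vA.
have a0 u : u \in A -> 0 <= (1 : R) by [].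
have [d [b [b0 e]]] := AB _ (mcone_comb 0 a0).
by apply: (comb_support fA fB a0 b0 e).
Qed.

(** The cone contains all constant vectors, so a functional nonnegative on it vanishes on
    [all_ones]. It is then determined on the cone by its nonnegative values at the indicators, and
    the face is spanned by those where it vanishes. *)
Lemma face_of_mcone A t : face_of t (mcone A) -> exists2 B : {set I}, B \subset A & t = mcone B.
Proof.
move=> [f [f0 ->]].
have f1 : pairing f (@all_ones R E) = 0.
  have p c : 0 <= c * pairing f (@all_ones R E).
    by rewrite -pairingZr f0 //; apply: polyhedral_const; apply: polyhedral_mcone.
  by have := p 1; have := p (-1); lra.
have fi v : v \in A -> 0 <= pairing f (ind v).
  move=> vA; have := f0 (comb A 0 (fun w => (w == v)%:R)).
  rewrite pairingDr pairingZr f1 mulr0 add0r linear_sum /= (bigD1 v) //= eqxx scale1r.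
  rewrite big1 ?addr0 => [|w /andP[_ /negbTE->]]; last by rewrite scale0r linear0.
  by apply; apply: mcone_comb => w _; rewrite ler0n.
have fE B c a : pairing f (comb B c a) = \sum_(v in B) a v * pairing f (ind v).
  rewrite pairingDr pairingZr f1 mulr0 add0r linear_sum /=.
  by apply: eq_bigr => v _; rewrite pairingZr.
exists [set v in A | pairing f (ind v) == 0]%SET.
  by apply/fintype.subsetP=> v; rewrite inE => /andP[].
apply/seteqP; split=> x.
  move=> [[c [a [a0 ->]]]]; rewrite fE => /eqP.
  rewrite psumr_eq0 => [|v vA]; last by rewrite mulr_ge0 ?a0 ?fi.
  move=> /allP fa; exists c, a; split=> [v|]; first by rewrite inE => /andP[/a0].
  apply: comb_supp; first by apply/fintype.subsetP=> v; rewrite inE => /andP[].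
  move=> v vA; rewrite inE vA /= => fv.
  have := fa v; rewrite mem_index_enum vA mulf_eq0 (negbTE fv) orbF => /(_ isT).
  by move/eqP.
move=> xB; split; last first.
  case: xB => [c [a [_ ->]]]; rewrite fE big1 // => v; rewrite inE => /andP[_ /eqP->].
  by rewrite mulr0.
by apply: mcone_sub_mono xB; apply/fintype.subsetP=> v; rewrite inE => /andP[].
Qed.

(** The separating coordinate differences, summed over [A :\: B], form a functional whose value is
    the sum of the coefficients outside [B]. *)
Lemma mcone_face A B : A \in faces -> B \subset A -> face_of (mcone B) (mcone A).
Proof.
move=> /facesP[T TT AT] BA.
have [p] : exists p : I -> E * E, forall v, v \in T -> [/\ (p v).1 \in m v, (p v).2 \notin m v &
    forall w, w \in T -> w != v -> ((p v).1 \in m w) = ((p v).2 \in m w)].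
  suff /choice[p pP] : forall v, exists p : E * E, v \in T -> [/\ p.1 \in m v, p.2 \notin m v &
      forall w, w \in T -> w != v -> (p.1 \in m w) = (p.2 \in m w)] by exists p.
  move=> v; have [vT|vT] := boolP (v \in T).
    by have [p [q H]] := separated TT vT; exists (p, q).
  by have /finset.set0Pn[i _] := m_neq0 v; exists (i, i).
move=> pP; pose f := \sum_(v in A :\: B) (unit_vec R (p v).1 - unit_vec R (p v).2).
have fE c a : pairing f (comb A c a) = \sum_(v in A :\: B) a v.
  rewrite pairingC linear_sum /=; apply: eq_bigr => v; rewrite inE => /andP[_ vA].
  have [p1 p2 p3] := pP _ (fintype.subsetP AT _ vA).
  by rewrite pairingC pairingBl !pairing_unit (comb_sep _ _ AT vA p1 p2 p3).
exists f; split=> [_ [c [a [a0 ->]]]|].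
  by rewrite fE sumr_ge0 // => v; rewrite inE => /andP[_ /a0].
apply/seteqP; split=> x.
  move=> xB; split; first exact: (mcone_sub_mono BA).
  case: xB => c [a [_ ->]].
  have -> : comb B c a = comb A c (fun v => if v \in B then a v else 0).
    rewrite (comb_supp _ BA); last by move=> v _ /negbTE->.
    by congr (_ + _); apply: eq_bigr => v ->.
  by rewrite fE big1 // => v; rewrite inE => /andP[/negbTE->].
move=> [[c [a [a0 ->]]]]; rewrite fE => /eqP.
rewrite psumr_eq0 => [|v]; last by rewrite inE => /andP[_ /a0].
move=> /allP az; exists c, a; split=> [v vB|]; first exact/a0/(fintype.subsetP BA).
apply: (comb_supp _ BA) => v vA vB; apply/eqP.
by have := az v; rewrite mem_index_enum inE vA vB; apply.
Qed.

Lemma fan_fan0 : fan fan0.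
Proof.
split.
- exact/finite_image/finite_finset.
- by move=> _ [A _ <-]; apply: polyhedral_mcone.
- move=> _ t [A fA <-] /face_of_mcone[B BA ->]; exists B => //=.
  exact: faces_sub BA fA.
- move=> _ _ [A fA <-] [B fB <-]; rewrite mconeI //.
  by split; apply: mcone_face => //; rewrite ?finset.subsetIl ?finset.subsetIr.
Qed.

Section Coarsest.
Variables (F : set (set V)).
Hypothesis fanF : fan_structure (\bigcup_(s in fan0) s) F.

Let inF s x : F s -> s x -> exists2 A, A \in faces & mcone A x.
Proof.
move=> Fs sx; have : (\bigcup_(s in F) s) x by exists s.
by case: fanF => _ ->; move=> [_ [A fA <-]]; exists A.
Qed.

Lemma comb_near A T c a (e : R) : A \subset T ->
  (forall v, v \in A -> 0 < a v) -> 0 < e ->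
  exists2 b, comb A c a + e *: comb T 0 (fun=> 1) = comb T c b & forall v, v \in T -> 0 < b v.
Proof.
move=> AT a0 e0; pose a' v := if v \in A then a v else 0.
have -> : comb A c a = comb T c a'.
  rewrite [RHS](comb_supp _ AT) => [|v _ /negbTE vA]; last by rewrite /a' vA.
  by congr (_ + _); apply: eq_bigr => v; rewrite /a' => ->.
rewrite comb_linear mulr0 addr0; exists (fun v => a' v + e * 1) => // v _.
by rewrite mulr1 ltr_wpDl // /a'; case: ifP => // /a0/ltW.
Qed.

(* A relative interior point x of a cone s of F and a maximal cone T of fan0
   around x: the points x + e v for v interior to T lie in cones of F having s as a
   face, so that translating them slightly by y stays in the union of the fan,
   hence in T. *)
Lemma relint_span_max s A T c a y : F s -> A \subset T -> T \in Tri ->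
  (forall v, v \in A -> 0 < a v) -> relint s (comb A c a) -> s y ->
  exists d b, y = comb T d b.
Proof.
move=> Fs AT TT a0 rx sy; case: (fanF) => -[finF pF _ FI] XF.
have fT : T \in faces by apply/facesP; exists T.
set x := comb A c a in rx *.
have [s' Fs' s'x] : exists2 s', F s' & forall d : R, 0 < d ->
    exists e, [/\ 0 < e, e < d & s' (x + e *: comb T 0 (fun=> 1))].
  apply: (pigeonhole_near0 (P := fun s' e => s' (x + e *: comb T 0 (fun=> 1))) finF) => e e0.
  rewrite /x; have [b -> b0] := comb_near c AT a0 e0.
  suff [t Ft tx] : (\bigcup_(s in F) s) (comb T c b) by exists t.
  rewrite XF; exists (mcone T); first by exists T.
  by apply: mcone_comb => v /b0/ltW.
have sx : s' x by apply: polyhedral_closed s'x; apply: pF.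
have ss' : s `&` s' = s.
  by apply: (relint_face _ rx); [case: (FI s s')|split=> //; case: rx].
have s'y : s' y by move: sy; rewrite -ss' => -[].
have [e [e0 _ s'w]] := s'x 1 ltr01.
have [b wE b0] := comb_near c AT a0 e0.
move: s'w; rewrite /x wE => s'w.
have [_ [B fB <-] Bw] : exists2 t, fan0 t & forall d : R, 0 < d ->
    exists e, [/\ 0 < e, e < d & t (comb T c b + e *: y)].
  apply: (pigeonhole_near0 (P := fun t e => t (comb T c b + e *: y))).
    by case: fan_fan0.
  move=> h h0; have [|A' fA' A'x] := inF (x := comb T c b + h *: y) Fs'.
    by apply: polyhedral_add; [apply: pF| |apply: polyhedral_scale (ltW h0) _ => //; apply: pF].
  by exists (mcone A') => //; exists A'.
(* By closedness the starting point itself lies in the cone over [B]. All its coefficients on [T]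
   are positive, hence [T] is contained in [B], and purity leaves only equality. *)
have BT : T = B.
  have [d [b' [b'0 e']]] := polyhedral_closed (polyhedral_mcone B) Bw.
  have TB : T \subset B.
    apply/fintype.subsetP=> v vT.
    by apply: (comb_support fT fB _ b'0 e' vT (b0 _ vT)) => u /b0/ltW.
  have /facesP[T' TT' BT'] := fB; have [k kP] := pure.
  by apply/eqP; rewrite eqEcard TB (kP _ TT) -(kP _ TT') subset_leq_card.
have [h [h0 _ [d [b' [_ e']]]]] := Bw 1 ltr01.
rewrite -BT in e'.
exists (h^-1 * (d - c)), (fun v => h^-1 * (b' v - b v)).
have -> : y = 0 *: y + h^-1 *: ((comb T c b + h *: y) + (-1) *: comb T c b).
  by rewrite scaleN1r addrAC subrr add0r scalerA mulVf ?gt_eqF // scale0r scale1r add0r.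
rewrite e' comb_linear; apply/ffunP=> i; rewrite scale0r add0r combE.
rewrite [LHS]ffunE combE /GRing.scale /= mulrDr mulr_sumr.
by rewrite mulN1r; congr (_ + _); apply: eq_bigr => v _; rewrite mulN1r.
Qed.

(** For each [v] of [T] outside [A], the neighbour across the wall opposite to [v] also contains
    [A], so [y] lies in its span too and satisfies $y_p=y_q$. This equation forces the coefficient
    of [v] to vanish. *)
Lemma relint_span s A c a y : F s -> A \in faces ->
  (forall v, v \in A -> 0 < a v) -> relint s (comb A c a) -> s y ->
  exists d b, y = comb A d b.
Proof.
move=> Fs /facesP[T TT AT] a0 rx sy.
have [d [b yE]] := relint_span_max Fs AT TT a0 rx sy.
exists d, b; rewrite yE; apply: (comb_supp _ AT) => v vT vA.
have [T' [p [q [TT' sT' pq pq']]]] := wall TT vT.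
have AT' : A \subset T'.
  by apply: fintype.subset_trans sT'; rewrite finset.subsetD1 AT.
have [d' [b' yE']] := relint_span_max Fs AT' TT' a0 rx sy.
have yp : y p = y q.
  by rewrite yE' !combE; congr (_ + _); apply: eq_bigl => u; case: (boolP (u \in T')) => // /pq'->.
move: yp; rewrite yE !combE !big_mkcondr /= !(bigD1 v vT) /=.
rewrite (eq_bigr (fun w => if q \in m w then b w else 0)) => [|w /andP[wT wv]]; last first.
  by rewrite pq' // (fintype.subsetP sT') // !inE wv.
by move: pq; case: (p \in m v); case: (q \in m v) => //= _; lra.
Qed.

(** [s] lies in the span of the cone over [B]; the signs remain. If [y] in [s] had a negative
    coefficient, moving from [x] along [y] stays in the relative interior of [s] and reaches a point
    of smaller support [B']. Then [y] lies in the span of [B'], so the coefficient that has just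
    vanished is zero in [y] as well, a contradiction. *)
Lemma fan0_coarser : refines F fan0.
Proof.
move=> s Fs; case: (fanF) => -[_ pF _ _] _.
have ps := pF _ Fs; have [x rx] := relint_exists ps.
have [A fA /mcone_supp[B [c [a [BA a0 xE]]]]] := inF Fs rx.1.
have {fA}fB := faces_sub BA fA; rewrite {}xE in rx.
exists (mcone B); split=> [|y sy]; first by exists B.
have [d [b yE]] := relint_span Fs fB a0 rx sy.
exists d, b; split=> // v0 v0B; rewrite leNgt; apply/negP=> bv0.
have v0P : (v0 \in B) && (b v0 < 0) by rewrite v0B.
(* Ratio test as in the simplex method: [v] is the vertex whose coefficient reaches zero first. *)
case: (@Order.TotalTheory.arg_minP _ _ _ v0 (fun v => (v \in B) && (b v < 0))
  (fun v => a v / - b v) v0P) => v /andP[vB bv] vmin.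
pose t := a v / - b v; have t0 : 0 <= t by rewrite divr_ge0 ?ltW ?a0 ?oppr_gt0.
have := relint_shift ps rx sy t0; rewrite yE comb_linear.
set a' := fun _ => _; pose B' := [set u in B | 0 < a' u]%SET.
have a'v : a' v = 0 by rewrite /a' /t; field; rewrite lt_eqF.
have a'0 u : u \in B -> 0 <= a' u.
  move=> uB; rewrite /a'; have [bu|bu] := leP 0 (b u).
    by apply: addr_ge0; [exact/ltW/a0|exact: mulr_ge0].
  have := vmin u; rewrite uB bu => /(_ isT); rewrite -/t ler_pdivlMr ?oppr_gt0 //; lra.
have B'B : B' \subset B by apply/fintype.subsetP=> u; rewrite inE => /andP[].
rewrite (comb_supp _ B'B) => [rx'|u uB]; last first.
  by rewrite inE uB /= => a'u; apply/eqP; rewrite eq_le a'0 // leNgt a'u.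
have [|d' [b' yE']] := relint_span Fs (faces_sub B'B fB) _ rx' sy.
  by move=> u; rewrite inE => /andP[].
suff : b v = 0 by move=> bv0'; move: bv; rewrite bv0' ltxx.
have vB' : v \notin B' by rewrite inE a'v ltxx andbF.
rewrite -[RHS](_ : (if v \in B' then b' v else 0) = 0); last by rewrite (negbTE vB').
apply: (comb_coef (c := d) (d := d') (b := fun v => if v \in B' then b' v else 0) fB vB).
rewrite -yE yE' [RHS](comb_supp _ B'B) => [|u _ /negbTE-> //].
by congr (_ + _); apply: eq_bigr => u ->.
Qed.
End Coarsest.

Lemma coarsest_fan0 : coarsest_fan_structure (\bigcup_(s in fan0) s) fan0.
Proof.
by split=> [|F FX]; [split=> //; apply: fan_fan0|apply: fan0_coarser].
Qed.

Hypothesis vertex_face : forall v, [set v]%SET \in faces.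
Variable e0 : E.

Lemma all_ones_neq0 : @all_ones R E != 0.
Proof. by apply/eqP=> /ffunP/(_ e0)/eqP; rewrite !ffunE oner_eq0. Qed.

Lemma free_ind A : A \in faces -> free (@all_ones R E :: [seq ind v | v <- enum A]).
Proof.
move=> fA; set X := _ :: _; apply/(@freeP R _ _ (in_tuple X)) => k.
rewrite big_ord_recl /=; set a := fun i => k (lift ord0 i).
have [b [bE _ ab]] := sum_ord_ind a; rewrite [X in _ + X]bE => e.
have b0 v : v \in A -> b v = 0.
  move=> vA; apply: (comb_coef (c := k ord0) (d := 0) (b := fun=> 0) fA vA).
  rewrite [LHS]e /comb scale0r add0r big1 // => u _; exact: scale0r.
move=> i; case: (unliftP ord0 i) => [j ->|->].
  by have [v vA] := ab j; rewrite /a (b0 v vA).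
apply/eqP; move: e; rewrite big1 => [|v vA]; last by rewrite b0 // scale0r.
by rewrite addr0 => /eqP; rewrite scaler_eq0 (negbTE all_ones_neq0) orbF.
Qed.

Lemma simplicial_fan0 : simplicial_fan fan0.
Proof.
move=> _ [A fA <-]; exists [seq ind v | v <- enum A]; split; first exact: free_ind.
exact: mconeE.
Qed.

Definition iray v : set V := ray (ind v).

Lemma irayE v : iray v = mcone [set v]%SET.
Proof. by rewrite mconeE enum_set1. Qed.

Lemma iray_sub v A : A \in faces -> (iray v `<=` mcone A) <-> v \in A.
Proof.
move=> fA; rewrite -finset.sub1set irayE; split; last exact: mcone_sub_mono.
exact: mcone_sub.
Qed.

Lemma iray_inj : injective iray.
Proof.
by move=> u v e; apply/finset.set1P/(iray_sub u (vertex_face v)); rewrite -irayE e.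
Qed.

(** A cone that is a ray has exactly one vertex: with two, both indicators would lie in the plane of
    [all_ones] and [w], against their independence; with none, [w] would be constant. *)
Lemma rays_fan0 : rays fan0 = range iray.
Proof.
apply/seteqP; split=> [r [[A fA <-]]|_ [v _ <-]]; last first.
  split; first by exists [set v]%SET; [exact: vertex_face|rewrite irayE].
  exists (ind v); split=> //; have := free_ind (vertex_face v).
  by rewrite enum_set1.
move=> [w [fw Aw]].
have cA v : v \in A -> exists c h, ind v = c *: all_ones R E + h *: w.
  move=> vA; have : mcone A (ind v).
    by apply: (proj2 (iray_sub v fA) vA); exists 0, (fun=> 1); split=> //;
      rewrite big_ord1 /= scale0r add0r scale1r.
  rewrite Aw => -[c [a [_ ->]]]; exists c, (a ord0); by rewrite big_ord1.
have wP c : w = c *: all_ones R E -> False.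
  move=> wE; move: fw; rewrite free_cons wE seq1_free scaler_eq0 negb_or span_seq1.
  move=> /andP[/negP + /andP[c0 _]]; apply.
  by apply/vlineP; exists c^-1; rewrite scalerA mulVf // scale1r.
(* The first indicator tells [p] from [q], hence so does [w]. The second does not, so its
   coefficient along [w] is zero and it would be constant, but it tells [p'] from [q']. *)
have aux (c h d k wp wq wp' wq' z : R) : true%:R = c + h * wp -> false%:R = c + h * wq ->
    z = d + k * wp -> z = d + k * wq -> true%:R = d + k * wp' -> false%:R = d + k * wq' -> False.
  move=> /= e1 e2 e3 e4 e5 e6; have hk : k * (wp - wq) = 0 by lra.
  have hh : h * (wp - wq) = 1 by lra.
  have wpq : wp - wq != 0 by apply: contra_eq_neq hh => ->; rewrite mulr0 eq_sym oner_eq0.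
  move/eqP: hk; rewrite mulf_eq0 (negbTE wpq) orbF => /eqP k0.
  by move: e5 e6; rewrite k0 !mul0r !addr0 => <- /eqP; rewrite eq_sym oner_eq0.
have A1 v u : v \in A -> u \in A -> u = v.
  move=> vA uA; apply/eqP; apply: contraT => uv.
  have /facesP[T TT AT] := fA; have vT := fintype.subsetP AT _ vA.
  have uT := fintype.subsetP AT _ uA.
  have [p [q [pv qv pq]]] := separated TT vT.
  have [p' [q' [pu qu pq']]] := separated TT uT.
  have [c [h vE]] := cA _ vA; have [d [k uE]] := cA _ uA.
  have H i := congr1 (fun x : V => x i) vE; have H' i := congr1 (fun x : V => x i) uE.
  have := H p; have := H q; have := H' p; have := H' q; have := H' p'; have := H' q'.
  rewrite !ffunE /GRing.scale /= pv (negbTE qv) pu (negbTE qu) (pq _ uT uv) !mulr1.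
  by move=> e1 e2 e3 e4 e5 e6; case: (aux _ _ _ _ _ _ _ _ _ e6 e5 e4 e3 e2 e1).
have [A0|[v vA]] := finset.set_0Vmem A.
  exfalso; have : mcone A w.
    rewrite Aw; exists 0, (fun=> 1); split=> //.
    by rewrite big_ord1 scale0r add0r scale1r.
  rewrite A0 => -[c [a [_]]]; rewrite /comb big_set0 addr0; exact: wP.
exists v => //; rewrite irayE; congr mcone; apply/setP=> u; rewrite inE.
by apply/eqP/idP => [->//|uA]; apply: A1.
Qed.

Definition ray_set A : set (set V) := [set iray v | v in [set` A]].

Lemma fan_complex_fan0 : fan_complex fan0 = [set ray_set A | A in [set` faces]].
Proof.
have rE A : A \in faces -> [set r | rays fan0 r /\ r `<=` mcone A] = ray_set A.
  move=> fA; rewrite rays_fan0; apply/seteqP; split=> r.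
    by move=> [[v _ <-] /(iray_sub _ fA) vA]; exists v.
  by move=> [v vA <-]; split; [exists v|apply/(iray_sub v fA)].
apply/seteqP; split=> D.
  by move=> [_ [A fA <-] <-]; exists A => //; rewrite rE.
by move=> [A fA <-]; exists (mcone A); [exists A|rewrite rE].
Qed.

Lemma ray_set_inj : injective ray_set.
Proof.
move=> A B e; apply/setP=> v.
have H (C : {set I}) : (v \in C) <-> ray_set C (iray v).
  by split=> [vC|[u uC /iray_inj <-//]]; exists v.
by apply/idP/idP => /H; rewrite ?e => ?; apply/H; rewrite ?e.
Qed.

Lemma card_ray_set A : (ray_set A #= `I_(#|A|))%card.
Proof.
have -> : ray_set A = [set iray (enum_val i) | i in [set: 'I_#|A|]].
  apply/seteqP; split=> _ [v vA <-]; last by exists (enum_val v) => //; exact: enum_valP.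
  by exists (enum_rank_in vA v); rewrite ?enum_rankK_in.
apply: card_eq_trans (card_esym card_II); apply: inj_card_eq => i j _ _ /iray_inj.
exact: enum_val_inj.
Qed.

Lemma simplices_fan0 d : simplices (fan_complex fan0) d =
  [set ray_set A | A in [set` [set A in faces | #|A| == d.+1]%SET]].
Proof.
rewrite /simplices fan_complex_fan0; apply/seteqP; split=> D.
  move=> [[A fA <-] cA]; exists A => //=; rewrite inE; apply/andP; split=> //.
  apply/eqP/card_eq_II; exact: card_eq_trans (card_esym (card_ray_set A)) cA.
move=> [A]; rewrite /= inE => /andP[fA /eqP cA] <-; split; first by exists A.
by rewrite -cA; apply: card_ray_set.
Qed.

Lemma card_ray_set_image (B : {set {set I}}) :
  ([set ray_set A | A in [set` B]] #= `I_(#|B|))%card.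
Proof.
have -> : [set ray_set A | A in [set` B]] = [set ray_set (enum_val i) | i in [set: 'I_#|B|]].
  apply/seteqP; split=> _ [A AB <-]; last by exists (enum_val A) => //; exact: enum_valP.
  by exists (enum_rank_in AB A); rewrite ?enum_rankK_in.
apply: card_eq_trans (card_esym card_II); apply: inj_card_eq => i j _ _ /ray_set_inj.
exact: enum_val_inj.
Qed.

Lemma reduced_euler_char_fan0 : reduced_euler_char (fan_complex fan0) =
  \sum_(A in faces) (-1 : int) ^+ #|A|.+1.
Proof.
rewrite /reduced_euler_char fan_complex_fan0 fsbig_image; last first.
  by move=> A B _ _; apply: ray_set_inj.
rewrite (fsbig_fwiden (enum faces)) ?enum_uniq //; first last.
- by move=> A [] /=; rewrite mem_enum.
- by move=> A /=; rewrite mem_enum.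
rewrite big_enum; apply: eq_bigr => A _; congr (_ ^+ _.+1).
exact: card_fset_set (card_ray_set A).
Qed.

End Complexes.
Arguments mcone R {E I} m A.
Arguments fan0 R {E I} m Tri.
Arguments iray R {E I} m v.
Arguments ray_set R {E I} m A.

(** * Bergman fans from normal vectors *)

Section FreeFamilies.
Variables (K : fieldType) (E : finType) (u : E -> 'rV[K]_4).
Implicit Types (s : seq E) (n : 'cV[K]_4).

Lemma span_annihilated n (X : seq 'rV[K]_4) v : v \in <<X>>%VS ->
  (forall w, w \in X -> w *m n = 0) -> v *m n = 0.
Proof.
move=> vX Xn; rewrite (@coord_span _ _ _ (in_tuple X) v vX) mulmx_suml big1 // => i _.
by rewrite -scalemxAl Xn ?scaler0 // mem_nth.
Qed.

Lemma free_cons_annihilated n i s : free (map u s) -> (forall k, k \in s -> u k *m n = 0) ->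
  u i *m n != 0 -> free (map u (i :: s)).
Proof.
move=> fs sn; rewrite free_cons fs andbT; apply: contra => uis; apply/eqP.
by apply: span_annihilated uis _ => _ /mapP[k ks ->]; apply: sn.
Qed.

Lemma dim_rV4 : \dim (fullv : {vspace 'rV[K]_4}) = 4%N.
Proof. by rewrite dimvf /dim /= mul1n. Qed.

Lemma not_free_size5 s : (4 < size s)%N -> ~~ free (map u s).
Proof.
rewrite -(size_map u); apply: contraL => /eqP <-.
by have := dimvS (subvf <<map u s>>%VS); rewrite dim_rV4 -leqNgt.
Qed.

(** Four independent forms would span the whole space and force [n] to vanish. *)
Lemma not_free_annihilated n s : n != 0 -> size s = 4%N ->
  (forall k, k \in s -> u k *m n = 0) -> ~~ free (map u s).
Proof.
move=> n0 s4 sn; apply: contra n0 => /eqP fs; apply/eqP/row_matrixP=> i.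
rewrite rowE row0; apply: (@span_annihilated _ (map u s)); last first.
  by move=> _ /mapP[k ks ->]; apply: sn.
suff -> : <<map u s>>%VS = fullv by rewrite memvf.
by apply/eqP; rewrite eqEdim subvf fs size_map s4 dim_rV4.
Qed.

Lemma dependent_seq s : uniq s -> mx_dependent u [set i in s]%SET = ~~ free (map u s).
Proof.
move=> us; rewrite /mx_dependent; congr negb; apply/perm_free/perm_map/uniq_perm => //.
  exact: enum_uniq.
by move=> i; rewrite mem_enum inE.
Qed.

Lemma dependent_set1U i (A : {set E}) : i \notin A ->
  mx_dependent u (i |: A)%SET = ~~ free (u i :: map u (enum A)).
Proof.
move=> iA; rewrite -map_cons -dependent_seq /= ?mem_enum ?iA ?enum_uniq //.
by congr mx_dependent; apply/setP=> j; rewrite !inE mem_enum.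
Qed.

Lemma dependent_sub (A B : {set E}) : A \subset B -> mx_dependent u A -> mx_dependent u B.
Proof.
move=> AB; apply: contra => fB.
have /perm_free H : perm_eq [seq u i | i <- enum B]
    ([seq u i | i <- enum A] ++ [seq u i | i <- enum (B :\: A)%SET]).
  rewrite -map_cat; apply/perm_map/uniq_perm; first exact: enum_uniq.
    rewrite cat_uniq !enum_uniq andbT /=; apply/hasPn=> i; rewrite !mem_enum inE.
    by case/andP.
  move=> i; rewrite mem_cat !mem_enum inE; case: (boolP (i \in A)) => //=.
  by move/(fintype.subsetP AB)->.
by rewrite H in fB; apply: catl_free fB.
Qed.

Variable R : realType.
Implicit Types (x : {ffun E -> R^o}).

(** A circuit inside [j :: s] contains [j], since [s] is free. Its minimum is attained twice, hence
    also at an element of [s]. *)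
Lemma tropical_dependent x s j (r : R) : tropical_linear_space R u x -> uniq (j :: s) ->
  free (map u s) -> ~~ free (map u (j :: s)) -> (forall i, i \in s -> r <= x i) -> r <= x j.
Proof.
move=> tx us fs; rewrite -dependent_seq // => /minset_exists[C minC Cjs] rs.
have [i [i' [iC i'C ii' xii' xmin]]] := tx C minC.
have inC k : k \in C -> k != j -> r <= x k.
  by move=> /(fintype.subsetP Cjs); rewrite !inE => /orP[->//|ks _]; apply: rs.
have jC : j \in C.
  apply: contraLR fs => jC; rewrite -dependent_seq; last by case/andP: us.
  apply: dependent_sub (minsetp minC); apply/fintype.subsetP=> k kC.
  have := fintype.subsetP Cjs _ kC; rewrite !inE => /orP[/eqP kj|//].
  by move: jC; rewrite -kj kC.
have [ij|ij] := eqVneq i j; last exact: le_trans (inC _ iC ij) (xmin _ jC).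
by rewrite -ij xii'; apply: inC; rewrite // -ij eq_sym.
Qed.

(** If a circuit had its minimum only at [i], the vector [n] would kill the rest of the circuit,
    which is free, but not [u i]; then the whole circuit would be free. *)
Lemma tropical_separated x : (forall i, exists2 n : 'cV[K]_4, u i *m n != 0 &
  forall k, x i < x k -> u k *m n = 0) -> tropical_linear_space R u x.
Proof.
move=> sep C minC; have dC := minsetp minC.
have [i0 i0C] : exists i, i \in C.
  apply/finset.set0Pn; apply: contraTneq dC => ->.
  by rewrite /mx_dependent enum_set0 /= nil_free.
case: (@Order.TotalTheory.arg_minP _ _ _ i0 (mem C) (fun i => x i : R) i0C) => i iC imin.
have [/existsP[j /and3P[jC ji /eqP xji]]|/existsPn nj] :=
    boolP [exists j, [&& j \in C, j != i & x j == x i]].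
  by exists i, j; split; rewrite // eq_sym.
have [n uin kn] := sep i; move: dC; rewrite -(finset.setD1K iC).
rewrite dependent_set1U ?inE ?eqxx // -map_cons => /negP[].
apply: (@free_cons_annihilated n) => // [|k]; last first.
  rewrite mem_enum !inE => /andP[ki kC]; apply: kn; rewrite lt_neqAle imin // andbT eq_sym.
  by have := nj k; rewrite kC ki.
apply: contraT => dCi; have /minsetP[_ /(_ _ dCi)] := minC.
move=> /(_ (finset.subsetDl _ _)) e; have : i \in C by [].
by rewrite -e !inE eqxx.
Qed.
End FreeFamilies.

(** * The tropical linear space as the union of the cones over the triangles *)

Section Berg.
Variables (R : realType) (K : fieldType) (L P : finType).
Variables (inF : rel L) (inP : L -> P -> bool) (perpP : P -> L -> bool).
Variable u : L -> 'rV[K]_4.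
Hypothesis IG : incidence_geometry inF inP perpP.
Hypothesis u_neq0 : forall l, u l != 0.
Hypothesis normal_F : forall h, exists2 n : 'cV[K]_4, n != 0 &
  forall l, (u l *m n == 0) = inF l h.
Hypothesis normal_P : forall b m, perpP b m -> exists2 n : 'cV[K]_4, n != 0 &
  forall l, (u l *m n == 0) = inP l b || (l == m).
Local Notation flat := (flat inF inP).
Local Notation triangles := (triangles inF inP perpP).
Local Notation vtx := (L + P + L)%type.
Implicit Types (x : {ffun L -> R^o}) (c r : R) (l h k i j : L) (b : P).

Lemma mcone3 (v1 v2 v3 : vtx) x c (a1 a2 a3 : R) :
  v1 != v2 -> v1 != v3 -> v2 != v3 -> 0 <= a1 -> 0 <= a2 -> 0 <= a3 ->
  (forall i, x i = c + (if i \in flat v1 then a1 else 0) +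
     (if i \in flat v2 then a2 else 0) + (if i \in flat v3 then a3 else 0)) ->
  mcone R flat [set v1; v2; v3]%SET x.
Proof.
move=> v12 v13 v23 a10 a20 a30 xE.
exists c, (fun v => if v == v1 then a1 else if v == v2 then a2 else a3).
split=> [v _|]; first by case: ifP => // _; case: ifP.
apply/ffunP=> i; rewrite combE xE big_mkcondr /= -!addrA; congr (_ + _).
rewrite -finset.setUA big_setU1 /=; last by rewrite !inE negb_or v12.
rewrite big_setU1 /=; last by rewrite inE.
by rewrite big_set1 !eqxx [v2 == v1]eq_sym (negbTE v12) ![v3 == _]eq_sym (negbTE v13) (negbTE v23).
Qed.

Lemma comb_lt (A : {set vtx}) c (a : vtx -> R) i k : (forall v, v \in A -> 0 <= a v) ->
  comb flat A c a i < comb flat A c a k ->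
  exists v, [/\ v \in A, k \in flat v & i \notin flat v].
Proof.
move=> a0; rewrite !combE ltrD2l => ik.
have [/existsP[v /and3P[]]|/existsPn nv] :=
    boolP [exists v, [&& v \in A, k \in flat v & i \notin flat v]].
  by exists v.
move: ik; rewrite ltNge !big_mkcondr /= => /negP[]; apply: ler_sum => v vA.
have := nv v; rewrite vA /=; case: (k \in _); case: (i \in _) => //= _.
exact: a0.
Qed.

(** A coordinate exceeds that of [i] only on a flat of [T] that misses [i]. So for each [i] it
    suffices to find a normal vector killing all those flats but not [u i]. *)
Lemma mcone_tropical T x : T \in triangles -> mcone R flat T x -> tropical_linear_space R u x.
Proof.
move=> TT [c [a [a0 ->]]]; apply: tropical_separated => i.
suff [n uin kn] : exists2 n : 'cV[K]_4, u i *m n != 0 &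
    forall v k, v \in T -> k \in flat v -> i \notin flat v -> u k *m n = 0.
  exists n => // k /(comb_lt a0)[v [vT kv iv]]; exact: kn kv iv.
have F h : ~~ inF i h -> exists2 n : 'cV[K]_4, u i *m n != 0 &
    forall k, inF k h -> u k *m n = 0.
  have [n _ nE] := normal_F h; rewrite -nE => ih; exists n => // k.
  by rewrite -nE => /eqP.
have single l : exists2 n : 'cV[K]_4, u i *m n != 0 &
    forall k, k == l -> i != l -> u k *m n = 0.
  have [<-|il] := eqVneq i l.
    (* Nothing has to be killed here, and the normal vector belonging to [i] itself does not kill
       [u i]. *)
    have [n nl _] := F i (negbT (ig_irr IG i)); by exists n.
  have [h /andP[lh ih]] : exists h, inF l h && ~~ inF i h.
    by apply: (ig_line_separated IG); rewrite eq_sym.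
  by have [n ni nE] := F h ih; exists n => // k /eqP-> _; apply: nE.
have two l l' : inF l l' -> exists2 n : 'cV[K]_4, u i *m n != 0 &
    forall k, (k == l) && (i != l) \/ (k == l') && (i != l') -> u k *m n = 0.
  move=> ll'; have [il|il] := eqVneq i l.
    have [n ni nE] := single l'; exists n => // k [/andP[]//|/andP[]]; exact: nE.
  have [il'|il'] := eqVneq i l'.
    have [n ni nE] := single l; exists n => // k [/andP[k1 _]|/andP[]//]; exact: nE.
  have [h [lh l'h ih]] := ig_ort_separated IG ll' il il'.
  have [n ni nE] := F h ih; exists n => // k [] /andP[/eqP-> _]; exact: nE.
have plane b : ~~ inP i b -> exists2 n : 'cV[K]_4, u i *m n != 0 &
    forall k, inP k b -> u k *m n = 0.
  move=> /(ig_plane_separated IG)[h /andP[bh ih]]; have [n ni nE] := F h ih.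
  by exists n => // k kb; apply/nE/(ig_plane_inF IG kb bh).
case/triangleP: TT => -[x1 [x2 [x3 []]]].
- move=> l12 l1 l2 ->; have [ih|ih] := boolP (inF i x3); last first.
    have [n ni nE] := F _ ih; exists n => // v k.
    rewrite !inE -orbA => /or3P[]/eqP->; rewrite !inE => kv _; apply: nE => //;
      by rewrite (eqP kv).
  have [n ni nE] := two _ _ l12; exists n => // v k.
  rewrite !inE -orbA => /or3P[]/eqP->; rewrite !inE ?ih // => k1 k2; apply: nE.
    by left; rewrite k1.
  by right; rewrite k1.
- move=> lb bh ->; have [ih|ih] := boolP (inF i x3); last first.
    have [n ni nE] := F _ ih; exists n => // v k.
    rewrite !inE -orbA => /or3P[]/eqP->; rewrite !inE => kv _; apply: nE => //.
      by rewrite (eqP kv) (ig_plane_inF IG lb bh).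
    exact: (ig_plane_inF IG kv bh).
  have [ib|ib] := boolP (inP i x2); last first.
    have [n ni nE] := plane _ ib; exists n => // v k.
    rewrite !inE -orbA => /or3P[]/eqP->; rewrite !inE ?ih // => kv _; apply: nE => //.
    by rewrite (eqP kv).
  have [n ni nE] := single x1; exists n => // v k.
  by rewrite !inE -orbA => /or3P[]/eqP->; rewrite !inE ?ih ?ib //; apply: nE.
- move=> lb bl' ->; have [ib|ib] := boolP (inP i x3).
    have [n ni nE] := two _ _ (ig_plane_inF IG lb bl'); exists n => // v k.
    rewrite !inE -orbA => /or3P[]/eqP->; rewrite !inE ?ib // => k1 k2; apply: nE.
      by left; rewrite k1.
    by right; rewrite k1.
  have [il|il] := eqVneq i x2.
    have [n ni nE] := plane _ ib; exists n => // v k.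
    rewrite !inE -orbA => /or3P[]/eqP->; rewrite !inE ?il ?eqxx // => kv _; apply: nE => //.
    by rewrite (eqP kv).
  (* Now [i] misses [b] and the line of $b^\perp$. Their union is a reducible hyperplane of the
     matroid, the case for which [normal_P] is needed. *)
  have [n _ nE] := normal_P bl'; exists n; first by rewrite nE (negbTE ib) (negbTE il).
  move=> v k; rewrite !inE -orbA => /or3P[]/eqP->; rewrite !inE => kv _; apply/eqP;
    by rewrite nE ?kv ?orbT // (eqP kv) lb.
Qed.

Lemma max_on (S : {set L}) x : S != finset.set0 ->
  exists2 l, l \in S & forall k, k \in S -> x k <= x l.
Proof.
move=> /finset.set0Pn[i0 i0S].
case: (@Order.TotalTheory.arg_maxP _ _ _ i0 (mem S) (fun i => x i : R) i0S) => l lS lmax.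
by exists l.
Qed.

Lemma free_pair l1 l2 : l2 != l1 -> free (map u [:: l2; l1]).
Proof.
move=> l21; have [h /andP[l1h l2h]] : exists h, inF l1 h && ~~ inF l2 h.
  by apply: (ig_line_separated IG); rewrite eq_sym.
have [n _ nE] := normal_F h; apply: (free_cons_annihilated (n := n)); last by rewrite nE.
  by rewrite /= seq1_free.
by move=> k; rewrite inE => /eqP->; apply/eqP; rewrite nE.
Qed.

(** Two distinct lines [h], [h'] of $b^\perp$ give two normal vectors killing the lines of [b]. If
    three of these were independent, adding some [k] in $h^\perp$ outside $h'^\perp$ would give four
    independent forms, all killed by the normal vector of [h]. *)
Lemma plane_dependent b l1 l2 j : inP l1 b -> inP l2 b -> inP j b ->
  ~~ free (map u [:: j; l2; l1]).
Proof.
move=> l1b l2b jb; apply/negP=> fr.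
have /finset.set0Pn[h] : [set h | perpP b h]%SET != finset.set0.
  by rewrite -card_gt0 (ig_card_perpP IG).
rewrite inE => bh; have [h' [bh' h'h _ _]] := ig_perp_plane IG bh.
have [k /andP[hk h'k]] : exists k, inF h k && ~~ inF h' k.
  by apply: (ig_line_separated IG); rewrite eq_sym.
rewrite (ig_sym IG) in hk; rewrite (ig_sym IG) in h'k.
have bF g l : perpP b g -> l \in [:: j; l2; l1] -> inF l g.
  by move=> bg; rewrite !inE => /or3P[]/eqP->; apply: (ig_plane_inF IG) bg.
have [n' _ n'E] := normal_F h'; have [n n0 nE] := normal_F h.
have f4 : free (map u [:: k; j; l2; l1]).
  apply: (free_cons_annihilated (n := n') fr); last by rewrite n'E.
  by move=> l lb; apply/eqP; rewrite n'E bF.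
have /negP[] : ~~ free (map u [:: k; j; l2; l1]); last exact: f4.
apply: (not_free_annihilated n0) => // l; rewrite inE => /orP[/eqP->|lb]; apply/eqP.
  by rewrite nE.
by rewrite nE bF.
Qed.

(** [l3] and [l4] are chosen maximal outside [F2] and [F3]. Any other element of the same stratum
    depends on the elements chosen so far, so its value cannot be smaller than theirs; thus [x] is
    constant on each stratum. *)
Lemma flag_values (F2 F3 : {set L}) (n : 'cV[K]_4) x l1 l2 l3 :
  tropical_linear_space R u x -> n != 0 -> (forall l, (u l *m n == 0) = (l \in F3)) ->
  F3 != [set: L]%SET -> free (map u [:: l3; l2; l1]) -> uniq [:: l3; l2; l1] ->
  l1 \in F2 -> l2 \in F2 -> F2 \subset F3 -> l3 \in F3 -> l3 \notin F2 ->
  x l3 <= x l2 -> x l2 <= x l1 -> (forall k, k \in F2 -> k != l1 -> x k = x l2) ->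
  (forall k, k \notin F2 -> x k <= x l3) ->
  exists a b c d : R, [/\ 0 <= a, 0 <= b, 0 <= c & forall i, x i = d +
    (if i \in F3 then a else 0) + (if i \in F2 then b else 0) + (if i == l1 then c else 0)].
Proof.
move=> tx n0 nE F3T fr us l1F l2F F23 l3F3 l3F2 x32 x21 xF2 xnF2.
have xl k : k \in [:: l3; l2; l1] -> x l3 <= x k.
  by rewrite !inE => /or3P[]/eqP->; rewrite // (le_trans x32).
have lF3 k : k \in [:: l3; l2; l1] -> k \in F3.
  by rewrite !inE => /or3P[]/eqP-> //; rewrite (fintype.subsetP F23).
have xF3 k : k \in F3 -> k \notin F2 -> x k = x l3.
  move=> kF3 kF2; have [->//|kl3] := eqVneq k l3.
  apply/eqP; rewrite eq_le xnF2 //=.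
  apply: (tropical_dependent tx _ fr) => //.
    rewrite cons_uniq us andbT !inE !negb_or kl3 /=; apply/andP; split.
      by apply: contraNneq kF2 => ->.
    by apply: contraNneq kF2 => ->.
  apply: (not_free_annihilated n0) => // l; rewrite inE => /orP[/eqP->|/lF3 lF]; apply/eqP;
    by rewrite nE.
have [l4 l4F3 l4max] : exists2 l, l \in (~: F3)%SET & forall k, k \in (~: F3)%SET -> x k <= x l.
  apply: max_on; apply: contra F3T => /eqP F30.
  by rewrite -(finset.setCK F3) F30 finset.setC0.
rewrite finset.in_setC in l4F3.
have xnF3 k : k \notin F3 -> x k = x l4.
  move=> kF3; have [->//|kl4] := eqVneq k l4.
  have f4 : free (map u [:: l4; l3; l2; l1]).
    apply: (free_cons_annihilated (n := n) fr); last by rewrite nE.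
    by move=> l /lF3 lF; apply/eqP; rewrite nE.
  have l43 : x l4 <= x l3.
    by apply: xnF2; apply: contra l4F3; apply: (fintype.subsetP F23).
  have nin i : i \notin F3 -> i \notin [:: l3; l2; l1] by apply: contra; apply: lF3.
  apply/eqP; rewrite eq_le l4max ?finset.in_setC //=.
  apply: (tropical_dependent tx _ f4).
  - by rewrite cons_uniq inE negb_or kl4 nin // cons_uniq nin.
  - exact: not_free_size5.
  - by move=> i; rewrite inE => /orP[/eqP->//|/xl]; apply: le_trans.
exists (x l3 - x l4), (x l2 - x l3), (x l1 - x l2), (x l4); rewrite !subr_ge0; split=> //.
  by apply: xnF2; apply: contra l4F3; apply: (fintype.subsetP F23).
move=> i; have [->|il1] := eqVneq i l1.
  by rewrite (fintype.subsetP F23) // l1F; lra.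
have [iF2|iF2] := boolP (i \in F2); first by rewrite (fintype.subsetP F23) // xF2 //; lra.
have [iF3|iF3] := boolP (i \in F3); first by rewrite xF3 //; lra.
by rewrite xnF3 //; lra.
Qed.

(** If [l1] and [l2] are orthogonal, the second flat is just this pair. The third is a hyperplane
    when [l3] is orthogonal to both or to neither, and otherwise a plane with a line of its
    complement. If they are not orthogonal, the second flat is the plane through them, and the third
    depends on whether [l3] lies in its complement. *)
Lemma tropical_mcone x : tropical_linear_space R u x ->
  exists2 T, T \in triangles & mcone R flat T x.
Proof.
move=> tx.
have cS (S : {set L}) : (#|S| < 40)%N -> (~: S)%SET != finset.set0.
  by move=> S40; rewrite -card_gt0 cardsCs finset.setCK (ig_card_line IG) subn_gt0.
have [l1 _ m1] : exists2 l, l \in (~: finset.set0)%SET &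
      forall k, k \in (~: finset.set0)%SET -> x k <= x l.
  by apply/max_on/cS; rewrite cards0.
have [l2 l2P m2] : exists2 l, l \in (~: [set l1])%SET &
      forall k, k \in (~: [set l1])%SET -> x k <= x l.
  by apply/max_on/cS; rewrite cards1.
rewrite !inE in l2P; have x21 : x l2 <= x l1 by apply: m1; rewrite !inE.
have FT h : flat (vF h) != [set: L]%SET by apply: (flat_neqT IG).
have PT b m : (m |: flat (vP b))%SET != [set: L]%SET.
  apply/eqP=> /(congr1 (fun S : {set L} => #|S|)) /eqP.
  rewrite cardsT (ig_card_line IG) cardsU1 (ig_card_inP IG).
  by case: (_ \notin _).
have nF h : exists2 n : 'cV[K]_4, n != 0 & forall l, (u l *m n == 0) = (l \in flat (vF h)).
  by have [n n0 nE] := normal_F h; exists n => // l; rewrite nE inE.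
have nP b m : perpP b m -> exists2 n : 'cV[K]_4, n != 0 &
    forall l, (u l *m n == 0) = (l \in m |: flat (vP b))%SET.
  by move=> bm; have [n n0 nE] := normal_P bm; exists n => // l; rewrite nE !inE orbC.
have [l12|l12] := boolP (inF l1 l2).
  have [l3 l3P m3] : exists2 l, l \in (~: [set l1; l2])%SET &
      forall k, k \in (~: [set l1; l2])%SET -> x k <= x l.
    by apply/max_on/cS; rewrite cards2; case: (_ != _).
  have : l3 \notin [set l1; l2]%SET by rewrite -finset.in_setC.
  rewrite !inE negb_or => /andP[l31 l32].
  have x32 : x l3 <= x l2 by apply: m2; rewrite !inE.
  have fr : free (map u [:: l3; l2; l1]).
    have [h [l1h l2h l3h]] := ig_ort_separated IG l12 l31 l32.
    have [n _ nE] := normal_F h; apply: (free_cons_annihilated (n := n) (free_pair l2P)).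
      by move=> k; rewrite !inE => /orP[]/eqP->; apply/eqP; rewrite nE.
    by rewrite nE.
  have us : uniq [:: l3; l2; l1] by rewrite /= !inE negb_or l31 l32 l2P.
  have V (F3 : {set L}) (n : 'cV[K]_4) : n != 0 -> (forall l, (u l *m n == 0) = (l \in F3)) ->
      F3 != [set: L]%SET -> [set l1; l2]%SET \subset F3 -> l3 \in F3 ->
      exists a b c d : R, [/\ 0 <= a, 0 <= b, 0 <= c & forall i, x i = d +
        (if i \in F3 then a else 0) + (if i \in [set l1; l2]%SET then b else 0) +
        (if i == l1 then c else 0)].
    move=> n0 nE F3T F23 l3F; apply: (flag_values tx n0 nE F3T fr us) => //.
    - by rewrite !inE eqxx.
    - by rewrite !inE eqxx orbT.
    - by rewrite !inE negb_or l31.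
    - by move=> k; rewrite !inE => /orP[/eqP->|/eqP->//]; rewrite eqxx.
    - by move=> k kF; apply: m3; rewrite finset.in_setC.
  have [l3E|l3E] := eqVneq (inF l1 l3) (inF l2 l3).
    have [h [l1h l2h l3h]] := ig_inF_triple IG l12 l31 l32 l3E.
    exists [set vL l1; vL l2; vF h]%SET; first exact: triangle_LLF.
    have [n n0 nE] := nF h; have [||a [b [c [d [a0 b0 c0 xE]]]]] := V _ n n0 nE (FT h).
    - by rewrite finset.subUset !finset.sub1set !inE l1h.
    - by rewrite inE.
    (* The indicator of the disconnected flat [{l1, l2}] is the sum of those of its two lines, so
       its coefficient [b] goes to both. *)
    apply: (@mcone3 _ _ _ x d (b + c) b a) => //; rewrite ?addr_ge0 //.
      by apply: contra l2P => /eqP[->].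
    move=> i; rewrite xE !inE; have [->|il1] := eqVneq i l1.
      by rewrite l1h (negbTE (inF_neq IG l12)) /=; lra.
    by case: (i == l2); case: (inF i h) => /=; lra.
  have VP b m : perpP b m -> l1 \in (m |: flat (vP b))%SET -> l2 \in (m |: flat (vP b))%SET ->
      inP l3 b -> exists a b' c d : R, [/\ 0 <= a, 0 <= b', 0 <= c & forall i, x i = d +
        (if (i == m) || inP i b then a else 0) + (if (i == l1) || (i == l2) then b' else 0) +
        (if i == l1 then c else 0)].
    move=> bm l1b l2b l3b; have [n n0 nE] := nP _ _ bm.
    have [||a [b' [c [d [a0 b0 c0 xE]]]]] := V _ n n0 nE (PT b m).
    - by rewrite finset.subUset !finset.sub1set l1b.
    - by rewrite !inE l3b orbT.
    by exists a, b', c, d; split=> // i; rewrite xE !inE.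
  have [l13|l13] := boolP (inF l1 l3).
    have l23 : ~~ inF l2 l3 by move: l3E; rewrite l13; case: (inF l2 l3).
    have [b /andP[l2b l3b]] : exists b, inP l2 b && inP l3 b.
      by apply: (ig_plane_exists IG) => //; rewrite eq_sym.
    have bl1 : perpP b l1.
      by apply: (ig_plane_perp IG (l := l2) (l' := l3)) => //;
        by [rewrite eq_sym|rewrite (ig_sym IG)].
    have l1b := ig_plane_perpN IG bl1.
    have [||//|a [b' [c [d [a0 b0 c0 xE]]]]] := VP _ _ bl1; rewrite ?inE ?eqxx ?l2b ?orbT //.
    exists [set vL l2; vL l1; vP b]%SET; first exact: triangle_LLP.
    (* Both larger flats of the flag are disconnected: [a] goes to [b] and [l1], and [b'] to [l1]
       and [l2]. *)
    apply: (@mcone3 _ _ _ x d b' (a + b' + c) a) => //; first by rewrite !addr_ge0.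
    move=> i; rewrite xE !inE; have [->|il1] := eqVneq i l1.
      by rewrite eq_sym (negbTE l2P) (negbTE l1b) /=; lra.
    by case: (i == l2); case: (inP i b) => /=; lra.
  have l23 : inF l2 l3 by move: l3E; rewrite (negbTE l13); case: (inF l2 l3).
  have [b /andP[l1b l3b]] : exists b, inP l1 b && inP l3 b.
    by apply: (ig_plane_exists IG) => //; rewrite eq_sym.
  have bl2 : perpP b l2.
    by apply: (ig_plane_perp IG (l := l1) (l' := l3)) => //;
        by [rewrite eq_sym|rewrite (ig_sym IG)].
  have l2b := ig_plane_perpN IG bl2.
  have [||//|a [b' [c [d [a0 b0 c0 xE]]]]] := VP _ _ bl2; rewrite ?inE ?eqxx ?l1b ?orbT //.
  exists [set vL l1; vL l2; vP b]%SET; first exact: triangle_LLP.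
  apply: (@mcone3 _ _ _ x d (b' + c) (a + b') a) => //; rewrite ?addr_ge0 //.
    by apply: contra l2P => /eqP[->].
  move=> i; rewrite xE !inE; have [->|il1] := eqVneq i l1.
    by rewrite eq_sym (negbTE l2P) l1b /=; lra.
  have [->|il2] := eqVneq i l2; first by rewrite (negbTE l2b) /=; lra.
  by case: (inP i b) => /=; lra.
have [b /andP[l1b l2b]] : exists b, inP l1 b && inP l2 b.
  by apply: (ig_plane_exists IG); rewrite // eq_sym.
have [l3 l3P m3] : exists2 l, l \in (~: flat (vP b))%SET &
    forall k, k \in (~: flat (vP b))%SET -> x k <= x l.
  by apply/max_on/cS; rewrite (ig_card_inP IG).
have l3b : ~~ inP l3 b by move: l3P; rewrite finset.in_setC inE.
have neq k : inP k b -> l3 != k by move=> kb; apply: contraNneq l3b => ->.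
have x32 : x l3 <= x l2 by apply: m2; rewrite !inE neq.
have us : uniq [:: l3; l2; l1] by rewrite /= !inE negb_or !neq // l2P.
have fr : free (map u [:: l3; l2; l1]).
  have [h /andP[bh l3h]] := ig_plane_separated IG l3b.
  have [n _ nE] := normal_F h; apply: (free_cons_annihilated (n := n) (free_pair l2P)).
    by move=> k; rewrite !inE => /orP[]/eqP->; apply/eqP; rewrite nE (ig_plane_inF IG _ bh).
  by rewrite nE.
have xb k : k \in flat (vP b) -> k != l1 -> x k = x l2.
  rewrite inE => kb kl1; have [->//|kl2] := eqVneq k l2.
  apply/eqP; rewrite eq_le m2 ?inE //=.
  apply: (tropical_dependent tx _ (free_pair l2P)).
  - by rewrite /= !inE negb_or kl1 kl2 l2P.
  - exact: plane_dependent l1b l2b kb.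
  - by move=> i; rewrite !inE => /orP[]/eqP->.
have V (F3 : {set L}) (n : 'cV[K]_4) : n != 0 -> (forall l, (u l *m n == 0) = (l \in F3)) ->
    F3 != [set: L]%SET -> flat (vP b) \subset F3 -> l3 \in F3 ->
    exists a b' c d : R, [/\ 0 <= a, 0 <= b', 0 <= c & forall i, x i = d +
      (if i \in F3 then a else 0) + (if i \in flat (vP b) then b' else 0) +
      (if i == l1 then c else 0)].
  move=> n0 nE F3T F23 l3F; apply: (flag_values tx n0 nE F3T fr us) => //; rewrite ?inE //.
  by move=> k kF; apply: m3; rewrite finset.in_setC.
have [bl3|bl3] := boolP (perpP b l3).
  have [n n0 nE] := nP _ _ bl3.
  have [||a [b' [c [d [a0 b0 c0 xE]]]]] := V _ n n0 nE (PT b l3).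
  - exact: finset.subsetU1.
  - by rewrite !inE eqxx.
  exists [set vL l1; vL l3; vP b]%SET; first exact: triangle_LLP.
  apply: (@mcone3 _ _ _ x d c a (a + b')) => //; rewrite ?addr_ge0 //.
    by apply: contraTneq l1b => -[->].
  move=> i; rewrite xE !inE; have [->|il3] := eqVneq i l3.
    by rewrite (negbTE l3b) (negbTE (neq _ l1b)) /=; lra.
  by case: (inP i b); case: (i == l1) => /=; lra.
have [h /andP[bh l3h]] := ig_plane_line IG l3b bl3.
have [n n0 nE] := nF h.
have [||a [b' [c [d [a0 b0 c0 xE]]]]] := V _ n n0 nE (FT h).
- exact: (flat_sub IG).
- by rewrite inE.
exists [set vL l1; vP b; vF h]%SET; first exact: triangle_LPF.
apply: (@mcone3 _ _ _ x d c b' a) => // i; rewrite xE !inE.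
by case: (inP i b); case: (inF i h); case: (i == l1) => /=; lra.
Qed.

End Berg.

(** * Lines and planes of the symplectic space *)

Section Symplectic.
Implicit Types (x y z : V34) (U : {vspace V34}).

Definition sformr y : V34 -> ('F_3)^o := fun x => sform x y.

Lemma sformr_linear y : linear (sformr y).
Proof. by move=> a x z; rewrite /sformr /sform !mxE /GRing.scale /=; ring. Qed.
HB.instance Definition _ y :=
  GRing.isLinear.Build 'F_3 V34 ('F_3)^o _ (sformr y) (sformr_linear y).

Lemma sformN x y : sform x y = - sform y x.
Proof. by rewrite /sform; ring. Qed.

Lemma sform_sym x y : (sform x y == 0) = (sform y x == 0).
Proof. by rewrite sformN oppr_eq0. Qed.

Lemma sform_span y (X : seq V34) x : x \in <<X>>%VS ->
  (forall z, z \in X -> sform z y = 0) -> sform x y = 0.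
Proof.
move=> xX X0; rewrite (@coord_span _ _ _ (in_tuple X) x xX) -[LHS]/(sformr y _).
rewrite linear_sum big1 //= => i _.
by rewrite linearZ /= /sformr X0 ?scaler0 // mem_nth.
Qed.

Lemma mem_perp U x : (x \in perp U) = [forall y, (y \in U) ==> (sform x y == 0)].
Proof.
apply/idP/idP => [xU|xU]; last by rewrite memv_span // mem_filter xU mem_enum.
apply/forall_inP=> y yU; apply/eqP/(sform_span xU) => z.
by rewrite mem_filter => /andP[/forall_inP/(_ y yU)/eqP].
Qed.

Lemma mem_perp_span (X : seq V34) x :
  (x \in perp <<X>>%VS) = all (fun y => sform x y == 0) X.
Proof.
rewrite mem_perp; apply/forall_inP/allP => H y yX; first exact/H/memv_span.
rewrite sform_sym; apply/eqP/(sform_span yX) => z /H.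
by rewrite sform_sym => /eqP.
Qed.

Lemma mem_line x y : (x \in <[y]>)%VS -> [\/ x = 0, x = y | x = - y].
Proof.
move=> /vlineP[a ->]; case: a => -[|[|[|//]]] a3.
- by constructor 1; rewrite (_ : Ordinal a3 = 0) ?scale0r //; apply/val_inj.
- by constructor 2; rewrite (_ : Ordinal a3 = 1) ?scale1r //; apply/val_inj.
- by constructor 3; rewrite (_ : Ordinal a3 = -1) ?scaleN1r //; apply/val_inj.
Qed.
End Symplectic.

(** * Vectors over $\mathbb{F}_3$ as lists of digits, for evaluation *)

Section Digits.
Definition vec (s : seq nat) : V34 := \row_(k < 4) (nth 0%N s k)%:R.
Definition digits (x : V34) : seq nat := [:: val (x 0 0); val (x 0 1); val (x 0 2); val (x 0 3)].
Definition vadd (s t : seq nat) := [seq (nth 0 s k + nth 0 t k) %% 3 | k <- iota 0 4]%N.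
Definition vneg (s : seq nat) := [seq (2 * nth 0 s k) %% 3 | k <- iota 0 4]%N.
Definition vdot (s t : seq nat) : nat :=
  ((nth 0 s 0 * nth 0 t 2 + nth 0 s 1 * nth 0 t 3 +
    2 * (nth 0 s 2 * nth 0 t 0 + nth 0 s 3 * nth 0 t 1)) %% 3)%N.
Definition all_digits : seq (seq nat) :=
  iter 4 (fun L => [seq a :: s | a <- iota 0 3, s <- L]) [:: [::]].

Lemma F3_nat (n : nat) : (n%:R : 'F_3) = (n %% 3)%:R.
Proof. by apply: val_inj; rewrite /= !val_Fp_nat // modn_mod. Qed.

Lemma F3_opp (n : nat) : - n%:R = (2 * n)%:R :> 'F_3.
Proof.
apply/eqP; rewrite eq_sym -subr_eq0 opprK -natrD -mulSnr.
by rewrite natrM (_ : 3%:R = 0) ?mul0r //; apply: val_inj.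
Qed.

Lemma vec_digits x : vec (digits x) = x.
Proof.
apply/rowP=> k; rewrite mxE; case: k => -[|[|[|[|//]]]] k4 /=; rewrite natr_Zp;
  by congr (x 0 _); apply: val_inj.
Qed.

Lemma digits_vec s : s \in all_digits -> digits (vec s) = s.
Proof.
have H : all (fun s => s == [seq (nth 0 s k) %% 3 | k <- iota 0 4])%N all_digits by vm_compute.
move=> /(allP H)/eqP {2}->; rewrite /digits !mxE /=.
by rewrite !val_Fp_nat.
Qed.

Lemma mem_all_digits x : digits x \in all_digits.
Proof.
rewrite /digits; move: (x 0 0) (x 0 1) (x 0 2) (x 0 3).
by do 4![case=> -[|[|[|//]]] ?].
Qed.

Lemma vec_inj : {in all_digits &, injective vec}.
Proof. by move=> s t sA tA e; rewrite -(digits_vec sA) e digits_vec. Qed.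

Lemma vec_add s t : vec s + vec t = vec (vadd s t).
Proof.
apply/rowP=> k; rewrite !mxE -natrD F3_nat.
by case: k => -[|[|[|[|//]]]].
Qed.

Lemma vec_opp s : - vec s = vec (vneg s).
Proof.
apply/rowP=> k; rewrite !mxE.
rewrite F3_opp F3_nat; by case: k => -[|[|[|[|//]]]].
Qed.

Lemma sform_vec s t : sform (vec s) (vec t) = (vdot s t)%:R.
Proof.
rewrite /vdot -F3_nat !(natrD, natrM) /sform !mxE /=.
have -> : 2%:R = -1 :> 'F_3 by apply: val_inj.
by ring.
Qed.

Lemma sform_vec0 s t : (sform (vec s) (vec t) == 0) = (vdot s t == 0%N).
Proof.
rewrite sform_vec; apply/eqP/eqP => [/(congr1 val)|-> //].
by rewrite /= val_Fp_nat // modn_mod.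
Qed.

End Digits.

(* Lines are coded by their position in the table, sets of lines by the binary
   digits of a number. *)
Section Codes.
Definition bit (M : N) (k : nat) : bool := N.testbit M (N.of_nat k).
Definition mask (s : seq nat) : N := foldr (fun k M => N.setbit M (N.of_nat k)) N0 s.

Lemma bit_mask s k : bit (mask s) k = (k \in s).
Proof.
elim: s => [|a s IH]; first exact: N.bits_0.
rewrite inE -IH /bit /= N.setbit_eqb eq_sym; congr (_ || _).
by apply/N.eqb_spec/eqP => [/Nat2N.inj|->].
Qed.

Lemma mask_neq0 M : ~~ N.eqb M N0 -> exists k, bit M k.
Proof.
move=> /negP M0; exists (N.to_nat (N.log2 M)); rewrite /bit N2Nat.id.
by apply: N.bit_log2 => e; apply: M0; rewrite e.
Qed.

Lemma bit_land M M' k : bit (N.land M M') k = bit M k && bit M' k.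
Proof. exact: N.land_spec. Qed.

Lemma bit_ldiff M M' k : bit (N.ldiff M M') k = bit M k && ~~ bit M' k.
Proof. exact: N.ldiff_spec. Qed.

Lemma allI n (P : pred nat) k : all P (iota 0 n) -> (k < n)%N -> P k.
Proof. by move=> /allP PP kn; apply: PP; rewrite mem_iota. Qed.

(** In the order of [G32_table], so that one position indexes both a line and its form. *)
Definition points : seq (seq nat) := (
  [:: [:: 1; 0; 0; 0]; [:: 0; 1; 0; 0]; [:: 1; 2; 0; 0]; [:: 1; 1; 0; 0]]
  ++ [seq [:: i; j; 0; 1] | i <- iota 0 3, j <- iota 0 3]
  ++ [seq [:: i; j; 1; 0] | i <- iota 0 3, j <- iota 0 3]
  ++ [seq [:: i; j; 1; 1] | i <- iota 0 3, j <- iota 0 3]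
  ++ [seq [:: i; j; 1; 2] | i <- iota 0 3, j <- iota 0 3])%N.

Definition point i := nth [::] points i.
Definition pt i : V34 := vec (point i).
Definition line_of s := find (fun t => (s == t) || (s == vneg t)) points.
Definition orth i j := vdot (point i) (point j) == 0%N.

Lemma points_digits : all (mem all_digits) points. Proof. by vm_compute. Qed.
Lemma points_cover : all (fun s => (s == nseq 4 0%N) || (line_of s < 40)%N) all_digits.
Proof. by vm_compute. Qed.
Lemma line_of_points : all (fun i => (line_of (point i) == i) &&
  (line_of (vneg (point i)) == i) && (vneg (point i) \in all_digits) &&
  (point i != nseq 4 0%N)) (iota 0 40).
Proof. by vm_compute. Qed.

Lemma point_digits i : (i < 40)%N -> point i \in all_digits.
Proof. by move=> i40; apply: (allP points_digits); apply: mem_nth. Qed.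

Lemma vec0 s : s \in all_digits -> (vec s == 0) = (s == nseq 4 0%N).
Proof.
have -> : 0 = vec (nseq 4 0%N).
  by apply/rowP=> k; rewrite !mxE; case: k => -[|[|[|[|]]]].
by move=> sA; apply/eqP/eqP => [|->//]; apply: vec_inj.
Qed.

Lemma pt_neq0 i : (i < 40)%N -> pt i != 0.
Proof.
move=> i40; rewrite vec0 ?point_digits //.
by have /andP[] := allI line_of_points i40.
Qed.

Lemma line_ofP s : s \in all_digits -> vec s != 0 ->
  (line_of s < 40)%N /\ (vec s = pt (line_of s) \/ vec s = - pt (line_of s)).
Proof.
move=> sA s0; have := allP points_cover _ sA; rewrite -vec0 // (negbTE s0) /= => l40.
split=> //; move: l40; rewrite -[40%N]/(size points) -has_find => /(nth_find [::]).
by rewrite -/(line_of s) => /orP[] /eqP e; [left|right; rewrite vec_opp]; rewrite {1}e.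
Qed.

Lemma line_of_pt s i : (i < 40)%N -> s \in all_digits ->
  vec s = pt i \/ vec s = - pt i -> line_of s = i.
Proof.
move=> i40 sA; have /andP[/andP[/andP[/eqP e1 /eqP e2] nA] _] := allI line_of_points i40.
case=> e; first by rewrite (vec_inj sA (point_digits i40) e) e1.
by rewrite vec_opp in e; rewrite (vec_inj sA nA e) e2.
Qed.

Lemma vline_opp (x : V34) : <[- x]>%VS = <[x]>%VS.
Proof. by apply/eqP; rewrite eqEsubv -!memvE !memvN memv_line -{1}[x]opprK memvN memv_line. Qed.

Lemma vline_of x : x != 0 -> exists2 i, (i < 40)%N & <[x]>%VS = <[pt i]>%VS.
Proof.
rewrite -(vec_digits x) => x0; have [i40 e] := line_ofP (mem_all_digits x) x0.
by exists (line_of (digits x)) => //; case: e => ->; rewrite ?vline_opp.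
Qed.

Lemma pt_line_inj i j : (i < 40)%N -> (j < 40)%N -> pt i \in <[pt j]>%VS -> i = j.
Proof.
move=> i40 j40 /mem_line[/eqP||] e; first by rewrite (negbTE (pt_neq0 i40)) in e.
  rewrite -(line_of_pt i40 (point_digits i40)); last by left.
  by apply: line_of_pt (point_digits i40) _ => //; left.
rewrite -(line_of_pt i40 (point_digits i40)); last by left.
by apply: line_of_pt (point_digits i40) _ => //; right.
Qed.

(* Locked, as unification would otherwise try to run the search. *)
Fact lcode_key : unit. Proof. exact: tt. Qed.
Definition lcode : line -> nat :=
  locked_with lcode_key (fun l => find (fun v => <[v]>%VS == val l) (map vec points)).

Lemma lcode_def l : lcode l = find (fun v => <[v]>%VS == val l) (map vec points).
Proof. by rewrite /lcode unlock. Qed.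

Lemma lcodeP l : (lcode l < 40)%N /\ val l = <[pt (lcode l)]>%VS.
Proof.
have [x x0 lE] : exists2 x, x != 0 & val l = <[x]>%VS.
  have := valP l; rewrite /= => /eqP dl; exists (vpick (val l)).
    by rewrite vpick0 -dimv_eq0 dl.
  apply/esym/eqP; rewrite eqEdim dl dim_vline vpick0 -dimv_eq0 dl andbT.
  by rewrite -memvE memv_pick.
have [i i40 xE] := vline_of x0.
have hp : has (fun v => <[v]>%VS == val l) (map vec points).
  by apply/hasP; exists (pt i); [by rewrite /pt map_f // mem_nth|rewrite lE xE].
have l40 : (lcode l < 40)%N by move: hp; rewrite lcode_def has_find size_map.
split=> //; have /eqP := nth_find 0 hp.
by rewrite -lcode_def (nth_map [::]).
Qed.

Lemma lcode_lt l : (lcode l < 40)%N. Proof. by case: (lcodeP l). Qed.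
Lemma lcodeE l : val l = <[pt (lcode l)]>%VS. Proof. by case: (lcodeP l). Qed.

Lemma lcode_inj : injective lcode.
Proof. by move=> l l' e; apply: val_inj; rewrite !lcodeE e. Qed.

Lemma lcode_surj i : (i < 40)%N -> exists l, lcode l = i.
Proof.
move=> i40; have d1 : \dim <[pt i]> == 1%N by rewrite dim_vline pt_neq0.
exists (Sub <[pt i]>%VS d1); apply/esym/pt_line_inj; rewrite ?lcode_lt //.
by rewrite -lcodeE SubK memv_line.
Qed.

Lemma line_sub l (U : {vspace V34}) : (val l <= U)%VS = (pt (lcode l) \in U).
Proof. by rewrite memvE lcodeE. Qed.

Lemma line_perp l l' : (val l <= perp (val l'))%VS = orth (lcode l) (lcode l').
Proof.
by rewrite line_sub (lcodeE l') -span_seq1 mem_perp_span /= andbT sform_vec0.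
Qed.

Lemma dim_nonorth (x y : V34) : sform x y != 0 -> \dim <<[:: x; y]>> = 2%N.
Proof.
move=> xy; suff /eqP : free [:: x; y] by [].
have sN z : sform z (- y) = - sform z y by rewrite sformN /sform !mxE; ring.
have s0 z : sform z z = 0 by rewrite /sform; ring.
have s00 : sform 0 y = 0 by rewrite /sform !mxE; ring.
rewrite free_cons seq1_free span_seq1; apply/andP; split.
  apply: contra xy => /mem_line[->|->|->]; first by rewrite s00.
    by rewrite s0.
  by rewrite sformN sN s0 !oppr0.
by apply: contra xy => /eqP->; rewrite sformN -[sform _ _]/(sformr x 0) linear0 oppr0.
Qed.

Lemma niplane_span (b : niplane) : exists i j, [/\ (i < 40)%N, (j < 40)%N, ~~ orth i j &
  val b = <<[:: pt i; pt j]>>%VS].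
Proof.
have /andP[/eqP d2] := valP b; rewrite negb_forall => /existsP[x].
rewrite negb_forall => /existsP[y]; rewrite negb_imply => /andP[/andP[xb yb] xy].
have nz z : z \in val b -> z != 0 ->
    exists2 i, (i < 40)%N & pt i \in val b /\ <[z]>%VS = <[pt i]>%VS.
  move=> zb /vline_of[i i40 e]; exists i => //; split=> //.
  by rewrite memvE -e -memvE.
have x0 : x != 0 by apply: contraNneq xy => ->; rewrite -[sform _ _]/(sformr y 0) linear0.
have y0 : y != 0.
  by apply: contraNneq xy => ->; rewrite sform_sym -[sform _ _]/(sformr x 0) linear0.
have [i i40 [ib ix]] := nz _ xb x0; have [j j40 [jb jy]] := nz _ yb y0.
have ij : ~~ orth i j.
  apply: contra xy; rewrite /orth -sform_vec0 -/(pt i) -/(pt j) => ij.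
  have : x \in perp <<[:: pt j]>>.
    rewrite memvE ix -memvE mem_perp_span /= ij //.
  rewrite span_seq1 -jy -span_seq1 mem_perp_span /= andbT //.
exists i, j; split=> //; apply/esym/eqP; rewrite eqEdim d2 dim_nonorth ?leqnn ?andbT.
  by apply/span_subvP=> z; rewrite !inE => /orP[]/eqP->.
by rewrite sform_vec0.
Qed.
End Codes.

(** * Incidence tables as bit masks *)

Definition lines := iota 0 40.
(** The lines spanned by $a$, $b$, $a+b$ and $a-b$. *)
Definition plane_lines i j : seq nat := [:: i; j;
  line_of (vadd (point i) (point j)); line_of (vadd (point i) (vneg (point j)))].

(* Bit k of the i-th number tells whether line k is orthogonal to line i and distinct
   from it. *)
Definition orth_masks : seq N := Eval vm_compute in
  [seq mask [seq k <- lines | orth k i && (k != i)] | i <- lines].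
Definition plane_masks : seq N := Eval vm_compute in
  undup [seq mask (plane_lines p.1 p.2) |
    p <- [seq (i, j) | i <- lines, j <- lines] & ~~ orth p.1 p.2].
Definition omask i := nth N0 orth_masks i.
Definition pmask c := nth N0 plane_masks c.
Definition perp_masks : seq N := Eval vm_compute in
  [seq mask [seq h <- lines | all (fun k => bit M k ==> orth k h) lines] | M <- plane_masks].
Definition ppmask c := nth N0 perp_masks c.
Definition planes := iota 0 90.
Definition plane_of i j := find (fun M => bit M i && bit M j) plane_masks.

Lemma orth_masksE :
  orth_masks = [seq mask [seq k <- lines | orth k i && (k != i)] | i <- lines].
Proof. by vm_compute. Qed.

(** Nested [if] replaces conjunction and implication in the tables, so that evaluation by value
    skips irrelevant branches. [omask] leaves out the line itself, hence the [setbit]. *)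
Lemma plane_of_masks : all (fun i => all (fun j => if orth i j then true else
  let c := plane_of i j in if (c < 90)%N then
  if N.eqb (pmask c) (mask (plane_lines i j)) then
    N.eqb (ppmask c) (N.land (N.setbit (omask i) (N.of_nat i)) (N.setbit (omask j) (N.of_nat j)))
  else false else false) lines) lines.
Proof. by vm_compute. Qed.

Lemma plane_of_unique : all (fun i => all (fun j => if orth i j then true else
  let p := plane_of i j in
  all (fun c => if bit (pmask c) i then if bit (pmask c) j then c == p else true else true)
    planes) lines) lines.
Proof. by vm_compute. Qed.

(** The two highest bits of the mask of a plane provide two lines spanning it. *)
Lemma plane_generators : all (fun c =>
   let i := N.to_nat (N.log2 (pmask c)) in
   let j := N.to_nat (N.log2 (N.clearbit (pmask c) (N.of_nat i))) in
   [&& (i < 40)%N, (j < 40)%N, ~~ orth i j & plane_of i j == c]) planes.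
Proof. by vm_compute. Qed.

Lemma omaskE i k : (i < 40)%N -> bit (omask i) k = [&& (k < 40)%N, orth k i & k != i].
Proof.
move=> i40; rewrite /omask orth_masksE (nth_map 0%N) ?size_iota // nth_iota //.
by rewrite bit_mask mem_filter mem_iota add0n andbC.
Qed.

Lemma orth_sym i j : orth i j = orth j i.
Proof. by rewrite /orth -!sform_vec0 sform_sym. Qed.

Lemma orth_refl i : orth i i.
Proof. by rewrite /orth -sform_vec0 /sform; apply/eqP; ring. Qed.

Lemma oset_maskE i k : (i < 40)%N ->
  bit (N.setbit (omask i) (N.of_nat i)) k = (k < 40)%N && orth k i.
Proof.
move=> i40; rewrite /bit N.setbit_eqb -/(bit (omask i) k) omaskE //.
have -> : N.eqb (N.of_nat i) (N.of_nat k) = (k == i).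
  by apply/N.eqb_spec/eqP => [/Nat2N.inj|->].
by have [->|ki] := eqVneq k i; rewrite ?i40 ?orth_refl ?andbT.
Qed.

Lemma plane_ofP i j : (i < 40)%N -> (j < 40)%N -> ~~ orth i j -> [/\ (plane_of i j < 90)%N,
  forall k, bit (pmask (plane_of i j)) k = (k \in plane_lines i j) &
  forall k, bit (ppmask (plane_of i j)) k = [&& (k < 40)%N, orth k i & orth k j]].
Proof.
move=> i40 j40 /negbTE ij; have := allI (allI plane_of_masks i40) j40; rewrite ij.
set c := plane_of i j; cbv zeta.
case: ifP => // c90; case: ifP => // /N.eqb_spec -> /N.eqb_spec ->; split=> // k.
  exact: bit_mask.
by rewrite bit_land !oset_maskE //; case: (k < 40)%N.
Qed.

Lemma plane_of_eq i j c : (i < 40)%N -> (j < 40)%N -> ~~ orth i j -> (c < 90)%N ->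
  bit (pmask c) i -> bit (pmask c) j -> c = plane_of i j.
Proof.
move=> i40 j40 /negbTE ij c90 ci cj; have := allI (allI plane_of_unique i40) j40.
by rewrite ij; cbv zeta => /allI/(_ c90); rewrite ci cj => /eqP.
Qed.

Lemma vadd_digits s t : vadd s t \in all_digits.
Proof.
rewrite /vadd /=; move: (ltn_pmod (nth 0 s 0 + nth 0 t 0) (isT : 0 < 3))%N.
move: (ltn_pmod (nth 0 s 1 + nth 0 t 1) (isT : 0 < 3))%N.
move: (ltn_pmod (nth 0 s 2 + nth 0 t 2) (isT : 0 < 3))%N.
move: (ltn_pmod (nth 0 s 3 + nth 0 t 3) (isT : 0 < 3))%N.
by do 4![case: (_ %% 3)%N => [|[|[|//]]] _].
Qed.

Lemma plane_mem i j k : (i < 40)%N -> (j < 40)%N -> (k < 40)%N -> ~~ orth i j ->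
  (pt k \in <<[:: pt i; pt j]>>%VS) = (k \in plane_lines i j).
Proof.
move=> i40 j40 k40 ij.
set a := pt i; set b := pt j; set U := <<_>>%VS.
have aU : a \in U by rewrite memv_span ?mem_head.
have bU : b \in U by rewrite memv_span // !inE eqxx orbT.
have Es : vec (vadd (point i) (point j)) = a + b by rewrite -vec_add.
have Ed : vec (vadd (point i) (vneg (point j))) = a - b by rewrite -vec_add -vec_opp.
have nz x : x \in <[b]>%VS -> a != x.
  apply: contraTneq => <-; apply: contra ij.
  rewrite /orth -sform_vec0 -/(pt i) -/(pt j) -/a -/b => /mem_line.
  have sbb : sform b b = 0 by rewrite /sform; ring.
  by case=> ->; rewrite -[sform _ _]/(sformr b _) ?linear0 ?linearN /= /sformr ?sbb ?oppr0.
have s0 : a + b != 0 by rewrite addr_eq0 nz // memvN memv_line.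
have d0 : a - b != 0 by rewrite subr_eq0 nz // memv_line.
rewrite -{}Es in s0; rewrite -{}Ed in d0.
have Es : vec (vadd (point i) (point j)) = a + b by rewrite -vec_add.
have Ed : vec (vadd (point i) (vneg (point j))) = a - b by rewrite -vec_add -vec_opp.
have [_ Ls] := line_ofP (vadd_digits _ _) s0; have [_ Ld] := line_ofP (vadd_digits _ _) d0.
apply/idP/idP => [|].
  rewrite /U span_cons span_seq1 => /memv_addP[u /mem_line ua [v /mem_line vb kE]].
  (* The nine combinations of [a] and [b] with coefficients $0$, $1$, $-1$. *)
  rewrite !inE; case: ua vb kE => -> [] ->; rewrite ?add0r ?addr0 => kE.
  - by have := pt_neq0 k40; rewrite kE eqxx.
  - by rewrite (pt_line_inj k40 j40) ?eqxx ?orbT // kE memv_line.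
  - by rewrite (pt_line_inj k40 j40) ?eqxx ?orbT // kE memvN memv_line.
  - by rewrite (pt_line_inj k40 i40) ?eqxx ?orbT // kE memv_line.
  - rewrite (line_of_pt k40 (vadd_digits (point i) (point j))) ?eqxx ?orbT //.
    by left; rewrite Es.
  - rewrite (line_of_pt k40 (vadd_digits (point i) (vneg (point j)))) ?eqxx ?orbT //.
    by left; rewrite Ed.
  - by rewrite (pt_line_inj k40 i40) ?eqxx ?orbT // kE memvN memv_line.
  - rewrite (line_of_pt k40 (vadd_digits (point i) (vneg (point j)))) ?eqxx ?orbT //.
    by right; rewrite Ed kE opprD !opprK.
  - rewrite (line_of_pt k40 (vadd_digits (point i) (point j))) ?eqxx ?orbT //.
    by right; rewrite Es kE opprD !opprK.
rewrite !inE => /or4P[]/eqP -> //.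
  by case: Ls => e; [rewrite -e|rewrite -memvN -e]; rewrite Es memvD.
by case: Ld => e; [rewrite -e|rewrite -memvN -e]; rewrite Ed memvB.
Qed.

Fact pcode_key : unit. Proof. exact: tt. Qed.
Definition pcode : niplane -> nat := locked_with pcode_key (fun b =>
  find (fun M => [forall l : line, (val l <= val b)%VS == bit M (lcode l)]) plane_masks).

Lemma pcode_def b : pcode b =
  find (fun M => [forall l : line, (val l <= val b)%VS == bit M (lcode l)]) plane_masks.
Proof. by rewrite /pcode unlock. Qed.

Lemma pcode_span (b : niplane) i j : (i < 40)%N -> (j < 40)%N -> ~~ orth i j ->
  val b = <<[:: pt i; pt j]>>%VS -> pcode b = plane_of i j.
Proof.
move=> i40 j40 ij bE; have [c90 cE _] := plane_ofP i40 j40 ij.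
pose P M := [forall l : line, (val l <= val b)%VS == bit M (lcode l)]; have hP : has P plane_masks.
  apply/hasP; exists (pmask (plane_of i j)); first exact: mem_nth.
  by apply/forallP=> l; rewrite cE line_sub bE plane_mem ?lcode_lt.
have b90 : (pcode b < 90)%N by move: hP; rewrite pcode_def has_find.
have /forallP := nth_find N0 hP; rewrite -pcode_def => bP.
have [li liE] := lcode_surj i40; have [lj ljE] := lcode_surj j40.
apply: plane_of_eq => //.
  by have /eqP := bP li; rewrite liE => <-; rewrite line_sub liE bE memv_span ?mem_head.
by have /eqP := bP lj; rewrite ljE => <-; rewrite line_sub ljE bE memv_span ?inE ?eqxx ?orbT.
Qed.

Lemma pcode_lt b : (pcode b < 90)%N.
Proof.
have [i [j [i40 j40 ij bE]]] := niplane_span b.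
by rewrite (pcode_span i40 j40 ij bE); have [] := plane_ofP i40 j40 ij.
Qed.

Lemma line_plane (l : line) (b : niplane) :
  (val l <= val b)%VS = bit (pmask (pcode b)) (lcode l).
Proof.
have [i [j [i40 j40 ij bE]]] := niplane_span b.
rewrite (pcode_span i40 j40 ij bE); have [_ -> _] := plane_ofP i40 j40 ij.
by rewrite line_sub bE plane_mem ?lcode_lt.
Qed.

Lemma plane_perp_line (l : line) (b : niplane) :
  (val b <= perp (val l))%VS = bit (ppmask (pcode b)) (lcode l).
Proof.
have [i [j [i40 j40 ij bE]]] := niplane_span b.
rewrite (pcode_span i40 j40 ij bE); have [_ _ ->] := plane_ofP i40 j40 ij.
rewrite lcode_lt bE (lcodeE l) -(span_seq1 (pt (lcode l))) /=.
rewrite orth_sym [X in _ && X]orth_sym /orth -!sform_vec0.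
apply/idP/andP => [/subvP H|[H1 H2]].
  have Hi x : x \in [:: pt i; pt j] -> sform x (pt (lcode l)) == 0.
    by move=> /memv_span/H; rewrite mem_perp_span /= andbT.
  by rewrite !Hi ?inE ?eqxx ?orbT.
by apply/span_subvP=> x; rewrite !inE => /orP[]/eqP->; rewrite mem_perp_span /= andbT.
Qed.

Lemma line_perp_plane (l : line) (b : niplane) :
  (val l <= perp (val b))%VS = (val b <= perp (val l))%VS.
Proof.
have H (U W : {vspace V34}) : (U <= perp W)%VS -> (W <= perp U)%VS.
  move=> /subvP UW; apply/subvP=> x xW; rewrite mem_perp; apply/forall_inP=> y yU.
  by rewrite sform_sym; have := UW _ yU; rewrite mem_perp => /forall_inP/(_ _ xW).
by apply/idP/idP; apply: H.
Qed.

Lemma pcode_inj : injective pcode.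
Proof.
move=> b b' e; have [i [j [i40 j40 ij bE]]] := niplane_span b.
have bb' (l : line) : (val l <= val b)%VS = (val l <= val b')%VS by rewrite !line_plane e.
have [li liE] := lcode_surj i40; have [lj ljE] := lcode_surj j40.
have /andP[/eqP d _] := valP b; have /andP[/eqP d' _] := valP b'.
apply/val_inj/eqP; rewrite eqEdim d d' leqnn andbT {1}bE; apply/span_subvP=> x.
rewrite !inE => /orP[]/eqP->.
  by rewrite -liE -line_sub -bb' line_sub liE bE memv_span ?mem_head.
by rewrite -ljE -line_sub -bb' line_sub ljE bE memv_span ?inE ?eqxx ?orbT.
Qed.

Lemma pcode_surj c : (c < 90)%N -> exists b, pcode b = c.
Proof.
move=> c90; have := allI plane_generators c90; cbv zeta; set i := N.to_nat _; set j := N.to_nat _.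
move=> /and4P[i40 j40 ij /eqP cE].
have sij : sform (pt i) (pt j) != 0 by rewrite sform_vec0.
have nb : (\dim <<[:: pt i; pt j]>> == 2%N) && ~~ isotropic <<[:: pt i; pt j]>>%VS.
  rewrite dim_nonorth //= negb_forall; apply/existsP; exists (pt i).
  rewrite negb_forall; apply/existsP; exists (pt j); rewrite negb_imply sij andbT.
  by rewrite !memv_span ?inE ?eqxx ?orbT.
by exists (Sub <<[:: pt i; pt j]>>%VS nb); rewrite -cE; apply: pcode_span; rewrite ?SubK.
Qed.

(** * The lines and planes of $\mathbb{F}_3^4$ as an incidence geometry *)

Section Incidence.
Implicit Types (l h : line) (b : niplane).

Fact incidence_key : unit. Proof. exact: tt. Qed.
Definition ort : rel line :=
  locked_with incidence_key (fun l h => val l <= perp (val h))%VS.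
Definition inF : rel line := locked_with incidence_key (fun l h => ort l h && (l != h)).
Definition inP : line -> niplane -> bool :=
  locked_with incidence_key (fun l b => val l <= val b)%VS.
Definition perpP : niplane -> line -> bool :=
  locked_with incidence_key (fun b h => val b <= perp (val h))%VS.

Lemma ortE l h : ort l h = (val l <= perp (val h))%VS.
Proof. by rewrite /ort unlock. Qed.

Lemma inFE l h : inF l h = ort l h && (l != h).
Proof. by rewrite /inF unlock. Qed.

Lemma inPE l b : inP l b = (val l <= val b)%VS.
Proof. by rewrite /inP unlock. Qed.

Lemma perpPE b h : perpP b h = (val b <= perp (val h))%VS.
Proof. by rewrite /perpP unlock. Qed.

Lemma ort_code l h : ort l h = orth (lcode l) (lcode h).
Proof. by rewrite ortE line_perp. Qed.

Lemma ort_sym l h : ort l h = ort h l.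
Proof. by rewrite ort_code orth_sym -ort_code. Qed.

Lemma ort_refl l : ort l l.
Proof. by rewrite ort_code orth_refl. Qed.

Lemma inF_sym l h : inF l h = inF h l.
Proof. by rewrite !inFE ort_sym eq_sym. Qed.

Lemma inFxx l : inF l l = false.
Proof. by rewrite inFE eqxx andbF. Qed.

Lemma inF_code l h : inF l h = bit (omask (lcode h)) (lcode l).
Proof. by rewrite (omaskE _ (lcode_lt h)) lcode_lt andTb inFE ort_code (inj_eq lcode_inj). Qed.

Lemma inP_code l b : inP l b = bit (pmask (pcode b)) (lcode l).
Proof. by rewrite inPE line_plane. Qed.

Lemma perpP_code b h : perpP b h = bit (ppmask (pcode b)) (lcode h).
Proof. by rewrite perpPE plane_perp_line. Qed.

Lemma plane_perp_ort b l h : inP l b -> perpP b h -> ort l h.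
Proof. by rewrite inPE perpPE ortE; apply: subv_trans. Qed.

Lemma omask_lt l k : bit (omask (lcode l)) k -> (k < 40)%N.
Proof. by rewrite (omaskE _ (lcode_lt l)) => /and3P[]. Qed.

Lemma ppmask_lt b k : bit (ppmask (pcode b)) k -> (k < 40)%N.
Proof.
have [i [j [i40 j40 ij bE]]] := niplane_span b.
rewrite (pcode_span i40 j40 ij bE); have [_ _ ->] := plane_ofP i40 j40 ij.
by case/and3P.
Qed.

Lemma omask_exists M l : ~~ N.eqb (N.land (omask (lcode l)) M) N0 ->
  exists h, inF l h && bit M (lcode h).
Proof.
move=> /mask_neq0[k]; rewrite bit_land => /andP[kl kM].
have k40 := omask_lt kl.
by have [h hE] := lcode_surj k40; exists h; rewrite inF_sym inF_code hE kl.
Qed.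

Lemma card_lcode (P : pred nat) : #|[set l | P (lcode l)]%SET| = count P lines.
Proof.
have /permP <- : perm_eq (map lcode (enum {: line})) lines.
  apply: uniq_perm; rewrite ?iota_uniq ?(map_inj_uniq lcode_inj) ?enum_uniq // => k.
  rewrite mem_iota /=; apply/mapP/idP => [[l _ ->]|/lcode_surj[l <-]]; first exact: lcode_lt.
  by exists l; rewrite ?mem_enum.
by rewrite count_map cardsE cardE -size_filter enumT; congr size; apply: eq_filter.
Qed.

Lemma card_pcode (P : pred nat) : #|[set b | P (pcode b)]%SET| = count P planes.
Proof.
have /permP <- : perm_eq (map pcode (enum {: niplane})) planes.
  apply: uniq_perm; rewrite ?iota_uniq ?(map_inj_uniq pcode_inj) ?enum_uniq // => k.
  rewrite mem_iota /=; apply/mapP/idP => [[l _ ->]|/pcode_surj[l <-]]; first exact: pcode_lt.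
  by exists l; rewrite ?mem_enum.
by rewrite count_map cardsE cardE -size_filter enumT; congr size; apply: eq_filter.
Qed.

Lemma card_lines : #|{: line}| = 40%N.
Proof.
by rewrite -cardsT -[RHS](count_predT lines) -card_lcode; apply: eq_card => l; rewrite !inE.
Qed.

Lemma card_niplanes : #|{: niplane}| = 90%N.
Proof.
by rewrite -cardsT -[RHS](count_predT planes) -card_pcode; apply: eq_card => l; rewrite !inE.
Qed.

Lemma masks_card : all (fun i => count (bit (omask i)) lines == 12)%N lines &&
  all (fun c => (count (bit (pmask c)) lines == 4)%N &&
    (count (bit (ppmask c)) lines == 4)%N) planes.
Proof. by vm_compute. Qed.

Lemma card_inF h : #|[set l | inF l h]%SET| = 12%N.
Proof.
have /andP[/allI/(_ (lcode_lt h))/eqP e _] := masks_card.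
by rewrite -[RHS]e -card_lcode; apply: eq_card => l; rewrite !inE inF_code.
Qed.

Lemma card_inP b : #|[set l | inP l b]%SET| = 4%N.
Proof.
have /andP[_ /allI/(_ (pcode_lt b))/andP[/eqP e _]] := masks_card.
by rewrite -[RHS]e -card_lcode; apply: eq_card => l; rewrite !inE inP_code.
Qed.

Lemma card_perpP b : #|[set h | perpP b h]%SET| = 4%N.
Proof.
have /andP[_ /allI/(_ (pcode_lt b))/andP[_ /eqP e]] := masks_card.
by rewrite -[RHS]e -card_lcode; apply: eq_card => l; rewrite !inE perpP_code.
Qed.

Lemma masks_inF2 : all (fun i => all (fun j => if bit (omask i) j then
   count (bit (N.land (omask j) (omask i))) lines == 2 else true)%N lines) lines.
Proof. by vm_compute. Qed.

Lemma card_inF2 l h : inF l h -> #|[set k | inF k l && inF k h]%SET| = 2%N.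
Proof.
rewrite inF_code => lh; have := allI (allI masks_inF2 (lcode_lt h)) (lcode_lt l).
rewrite lh => /eqP e; rewrite -[RHS]e -card_lcode; apply: eq_card => k.
by rewrite !inE (inF_code k l) (inF_code k h) bit_land.
Qed.

Lemma masks_plane : all (fun c => N.eqb (N.land (pmask c) (ppmask c)) N0 &&
  all (fun i => if bit (pmask c) i then N.eqb (N.land (pmask c) (omask i)) N0 else true)
    lines) planes.
Proof. by vm_compute. Qed.

Lemma plane_ort b l l' : inP l b -> inP l' b -> ort l l' -> l = l'.
Proof.
move=> lb l'b ll'; apply/eqP/negPn/negP => nll'.
have /andP[_ /allI/(_ (lcode_lt l'))] := allI masks_plane (pcode_lt b).
rewrite -inP_code l'b => /N.eqb_spec H.
have : bit (N.land (pmask (pcode b)) (omask (lcode l'))) (lcode l).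
  by rewrite bit_land -inP_code -inF_code lb inFE ll' nll'.
by rewrite H /bit N.bits_0.
Qed.

Lemma plane_perpN b l : perpP b l -> ~~ inP l b.
Proof.
move=> bl; apply/negP=> lb.
have /andP[/N.eqb_spec H _] := allI masks_plane (pcode_lt b).
have : bit (N.land (pmask (pcode b)) (ppmask (pcode b))) (lcode l).
  by rewrite bit_land -inP_code -perpP_code lb.
by rewrite H /bit N.bits_0.
Qed.

Lemma plane_inF b l h : inP l b -> perpP b h -> inF l h.
Proof.
move=> lb bh; rewrite inFE (plane_perp_ort lb bh); apply: contraTneq bh => <-.
by apply: contraL lb; apply: plane_perpN.
Qed.

Lemma plane_uniq b b' l l' : l != l' -> inP l b -> inP l' b -> inP l b' -> inP l' b' -> b = b'.
Proof.
move=> ll' lb l'b lb' l'b'; have nO : ~~ orth (lcode l) (lcode l').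
  by rewrite -ort_code; apply: contra ll' => /(plane_ort lb l'b)->.
move: lb l'b lb' l'b'; rewrite !inP_code => lb l'b lb' l'b'; apply: pcode_inj.
rewrite (plane_of_eq (lcode_lt l) (lcode_lt l') nO (pcode_lt b) lb l'b).
by rewrite -(plane_of_eq (lcode_lt l) (lcode_lt l') nO (pcode_lt b') lb' l'b').
Qed.

Lemma plane_perp b l l' h : l != l' -> inP l b -> inP l' b -> inF l h -> inF l' h -> perpP b h.
Proof.
move=> ll' lb l'b; rewrite !inFE => /andP[lh _] /andP[l'h _].
have nO : ~~ orth (lcode l) (lcode l').
  by rewrite -ort_code; apply: contra ll' => /(plane_ort lb l'b)->.
rewrite inP_code in lb; rewrite inP_code in l'b.
have e := plane_of_eq (lcode_lt l) (lcode_lt l') nO (pcode_lt b) lb l'b.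
have [_ _ H] := plane_ofP (lcode_lt l) (lcode_lt l') nO.
rewrite perpP_code e H lcode_lt -(ort_code h l) -(ort_code h l') (ort_sym h l) lh.
by rewrite ort_sym l'h.
Qed.

Lemma plane_exists l l' : ~~ ort l l' -> exists b, inP l b && inP l' b.
Proof.
rewrite ort_code => nO; have [c90 cE _] := plane_ofP (lcode_lt l) (lcode_lt l') nO.
have [b bE] := pcode_surj c90; exists b.
rewrite (inP_code l) (inP_code l') bE (cE (lcode l)) (cE (lcode l')).
by rewrite /plane_lines !in_cons !eqxx orbT.
Qed.

Lemma masks_flag : all (fun i => all (fun j => if bit (omask i) j then
  has (fun c => if bit (pmask c) i then bit (ppmask c) j else false) planes else true) lines) lines.
Proof. by vm_compute. Qed.

Lemma plane_flag l h : inF l h -> exists b, inP l b && perpP b h.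
Proof.
rewrite inF_sym inF_code => lh; have := allI (allI masks_flag (lcode_lt l)) (lcode_lt h).
rewrite lh => /hasP[c]; rewrite mem_iota => /pcode_surj[b <-].
case: ifP => [lb bh|//]; exists b.
by rewrite inP_code lb perpP_code bh.
Qed.

Lemma masks_triple : all (fun i => all (fun j => if bit (omask i) j then
  let M := N.land (omask i) (omask j) in
  all (fun k => if (k == i) || (k == j) then true else
     if bit (omask i) k == bit (omask j) k then ~~ N.eqb (N.land M (omask k)) N0 else true)
  lines else true) lines) lines.
Proof. by vm_compute. Qed.

(** Lines orthogonal to [l1] and [l2] lie in the isotropic plane they span. If [l3] is orthogonal to
    both, it lies in this plane and [h] is the fourth line. If to neither, $l_3^\perp$ cuts the
    plane in a line other than [l1] and [l2]. *)
Lemma inF_triple l1 l2 l3 : inF l1 l2 -> l3 != l1 -> l3 != l2 -> inF l1 l3 = inF l2 l3 ->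
  exists h, [/\ inF l1 h, inF l2 h & inF l3 h].
Proof.
move=> l12 l31 l32 l3E.
have := allI (allI masks_triple (lcode_lt l1)) (lcode_lt l2).
rewrite -inF_code inF_sym l12; cbv zeta => /allI/(_ (lcode_lt l3)).
rewrite !(inj_eq lcode_inj) (negbTE l31) (negbTE l32) -!inF_code ![inF l3 _]inF_sym l3E eqxx.
rewrite -N.land_assoc => /omask_exists[h /andP[h1]].
rewrite bit_land -inF_code -inF_code => /andP[h2 h3]; exists h.
by split; [exact: h1|rewrite inF_sym h2|rewrite inF_sym h3].
Qed.

Lemma ppmask_exists M b : ~~ N.eqb (N.land (ppmask (pcode b)) M) N0 ->
  exists h, perpP b h && bit M (lcode h).
Proof.
move=> /mask_neq0[k]; rewrite bit_land => /andP[kl kM].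
have k40 := ppmask_lt kl.
by have [h hE] := lcode_surj k40; exists h; rewrite perpP_code hE kl.
Qed.

(** Serves two facts: some hyperplane through the plane misses the line, and, outside the orthogonal
    complement, some hyperplane contains it. *)
Lemma masks_plane_line : all (fun c => all (fun k => if bit (pmask c) k then true else
  if N.eqb (N.ldiff (ppmask c) (omask k)) N0 then false else
  if bit (ppmask c) k then true else ~~ N.eqb (N.land (ppmask c) (omask k)) N0) lines) planes.
Proof. by vm_compute. Qed.

Lemma plane_line_hyperplane b l : ~~ inP l b -> ~~ perpP b l ->
  exists h, perpP b h && inF l h.
Proof.
rewrite inP_code perpP_code => /negbTE lb /negbTE bl.
have := allI (allI masks_plane_line (pcode_lt b)) (lcode_lt l); rewrite lb bl.
case: ifP => [//|_ /ppmask_exists[h /andP[bh hl]]]; exists h.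
by rewrite bh inF_sym inF_code hl.
Qed.

Lemma plane_separated b l : ~~ inP l b -> exists h, perpP b h && ~~ inF l h.
Proof.
rewrite inP_code => /negbTE lb.
have := allI (allI masks_plane_line (pcode_lt b)) (lcode_lt l); rewrite lb.
case: ifP => [//|/negbT/mask_neq0[k]]; rewrite bit_ldiff => /andP[kb kl] _.
have [h hE] := lcode_surj (ppmask_lt kb); exists h.
by rewrite perpP_code inF_sym inF_code hE kb kl.
Qed.

Lemma masks_line : all (fun i => all (fun j => if i == j then true else
  if N.eqb (N.ldiff (omask i) (omask j)) N0 then false else
  if bit (omask i) j then
    let M := N.land (omask i) (omask j) in
    all (fun k => if (k == i) || (k == j) then true else ~~ N.eqb (N.ldiff M (omask k)) N0) lines
  else true) lines) lines.
Proof. by vm_compute. Qed.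

Lemma line_separated l l' : l != l' -> exists h, inF l h && ~~ inF l' h.
Proof.
move=> ll'; have := allI (allI masks_line (lcode_lt l)) (lcode_lt l').
rewrite (inj_eq lcode_inj) (negbTE ll').
case: ifP => [//|/negbT/mask_neq0[k]]; rewrite bit_ldiff => /andP[kl kl'] _.
have [h hE] := lcode_surj (omask_lt kl); exists h.
by rewrite (inF_sym l) (inF_sym l') !inF_code hE kl kl'.
Qed.

Lemma ort_separated l l' k : inF l l' -> k != l -> k != l' ->
  exists h, [/\ inF l h, inF l' h & ~~ inF k h].
Proof.
move=> ll' kl kl'; have := allI (allI masks_line (lcode_lt l)) (lcode_lt l').
rewrite -inF_code inF_sym ll' (inj_eq lcode_inj).
have /negbTE-> : l != l' by apply: contraTneq ll' => ->; rewrite inFxx.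
case: ifP => [//|_]; cbv zeta => /allI/(_ (lcode_lt k)).
rewrite !(inj_eq lcode_inj) (negbTE kl) (negbTE kl') => /mask_neq0[c].
rewrite bit_ldiff bit_land => /andP[/andP[cl cl'] ck].
have [h hE] := lcode_surj (omask_lt cl); exists h.
split; [rewrite inF_sym inF_code hE; exact: cl
       |rewrite inF_sym inF_code hE; exact: cl'|rewrite inF_sym inF_code hE; exact: ck].
Qed.

Lemma masks_perp : all (fun c => all (fun i => if bit (ppmask c) i then
  has (fun j => if bit (ppmask c) j then if orth i j then false else
     N.eqb (N.land (omask i) (omask j)) (pmask c) else false) lines else true) lines) planes.
Proof. by vm_compute. Qed.

(** $b^\perp$ is again non-isotropic, so it is spanned by [l] and a line [l'] not orthogonal to it,
    and $b=l^\perp\cap l'^\perp$. *)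
Lemma perp_plane b l : perpP b l -> exists l', [/\ perpP b l', ~~ ort l l' &
  forall k, inF k l -> inF k l' -> inP k b].
Proof.
rewrite perpP_code => bl; have := allI (allI masks_perp (pcode_lt b)) (lcode_lt l).
rewrite bl => /hasP[j]; rewrite mem_iota => /lcode_surj[l' <-].
case: ifP => [bl'|//]; case: ifP => [//|/negbT ll' /N.eqb_spec H]; exists l'; split.
- by rewrite perpP_code.
- by rewrite ort_code.
- by move=> k; rewrite inP_code -H bit_land -inF_code -inF_code => -> ->.
Qed.
Lemma G32_incidence : incidence_geometry inF inP perpP.
Proof.
split.
- exact: inF_sym.
- exact: inFxx.
- exact: card_lines.
- exact: card_niplanes.
- exact: card_inF.
- exact: card_inP.
- exact: card_perpP.
- exact: card_inF2.
- move=> b l l' lb l'b; rewrite inFE; apply/negP=> /andP[/(plane_ort lb l'b)->].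
  by rewrite eqxx.
- exact: plane_perpN.
- exact: plane_inF.
- exact: plane_uniq.
- exact: plane_perp.
- move=> l l' ll'; rewrite inFE ll' andbT; exact: plane_exists.
- exact: plane_flag.
- exact: inF_triple.
- exact: plane_line_hyperplane.
- exact: plane_separated.
- exact: line_separated.
- exact: ort_separated.
- move=> b l /perp_plane[l' [bl' ll' H]]; exists l'; split.
  + exact: bl'.
  + by apply: contraNneq ll' => ->; apply: ort_refl.
  + by rewrite inFE negb_and ll'.
  + exact: H.
Qed.

End Incidence.

(** * The normal vectors of the arrangement *)

(* Eisenstein integers: (a, b) stands for a + b omega. *)
Definition eis := (Z * Z)%type.

Section Eisenstein.
Local Open Scope Z_scope.
Definition eint (a : Z) : eis := (a, 0).
Definition esqrt : eis := (1, 2).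
Definition eadd (x y : eis) : eis := (x.1 + y.1, x.2 + y.2).
Definition eopp (x : eis) : eis := (- x.1, - x.2).
Definition emul (x y : eis) : eis :=
  (x.1 * y.1 - x.2 * y.2, x.1 * y.2 + x.2 * y.1 - x.2 * y.2).
Definition econj (x : eis) : eis := (x.1 - x.2, - x.2).
Definition eis0 (x : eis) : bool := Z.eqb x.1 0 && Z.eqb x.2 0.
Definition omega_pow (e : nat) : eis := nth (eint 0) [:: (1, 0); (0, 1); (-1, -1)] (e %% 3)%N.

(** Exponents count modulo $3$, so $-i$ is written $2i$. *)
Definition form_table : seq (seq eis) :=
  let o := eint 0 in let l := eint 1 in let s := esqrt in let w := omega_pow in
  [:: [:: s; o; o; o]; [:: o; s; o; o]; [:: o; o; s; o]; [:: o; o; o; s]]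
  ++ [seq [:: o; l; w (i + 2 * j); w (2 * i + 2 * j)]%N | i <- iota 0 3, j <- iota 0 3]
  ++ [seq [:: w (i + 2 * j); o; l; eopp (w j)]%N | i <- iota 0 3, j <- iota 0 3]
  ++ [seq [:: w i; eopp (w j); o; l] | i <- iota 0 3, j <- iota 0 3]
  ++ [seq [:: l; w (2 * i + 2 * j); eopp (w (2 * i)); o]%N | i <- iota 0 3, j <- iota 0 3].

Definition edot (s t : seq eis) : eis :=
  foldr (fun k x => eadd (emul (nth (eint 0) s k) (econj (nth (eint 0) t k))) x)
    (eint 0) (iota 0 4).

Definition gram_table : seq (seq eis) := Eval vm_compute in
  [seq [seq edot s t | t <- form_table] | s <- form_table].
Definition gram i j : eis := nth (eint 0) (nth [::] gram_table i) j.
End Eisenstein.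

Lemma gram_edot : gram_table = [seq [seq edot s t | t <- form_table] | s <- form_table].
Proof. by vm_compute. Qed.

Lemma gram_orth : all (fun i => all (fun j => eis0 (gram i j) == bit (omask j) i) lines) lines.
Proof. by vm_compute. Qed.

(** The tested number is the product of $u_k$ with $3\bar u_j-\langle u_i,u_j\rangle\bar u_i$, a
    multiple of the projection of $\bar u_j$ away from $u_i$. It vanishes just for $k=i$ and for the
    lines of the plane $i^\perp\cap j^\perp$. *)
Lemma gram_proj : all (fun i => all (fun j => if orth i j then true else
  let g := gram i j in
  all (fun k => eis0 (eadd (emul (eint (Zpos (xI xH))) (gram k j)) (eopp (emul g (gram k i)))) ==
    if k == i then true else if bit (omask i) k then bit (omask j) k else false)
  lines) lines) lines.
Proof. by vm_compute. Qed.

Section EisensteinEval.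
Variable K : fieldType.
Hypothesis char0 : [pchar K] =i pred0.

Definition zeval (z : Z) : K := (int_of_Z z)%:~R.

Lemma zeval0 : zeval Z0 = 0. Proof. by []. Qed.
Lemma zeval1 : zeval (Zpos xH) = 1. Proof. by []. Qed.
Lemma zeval2 : zeval (Zpos (xO xH)) = 2%:R. Proof. by []. Qed.
Lemma zevalN1 : zeval (Zneg xH) = - 1. Proof. by []. Qed.
Definition zevalE := (zeval0, zeval1, zeval2, zevalN1).

Lemma zevalD a b : zeval (Z.add a b) = zeval a + zeval b.
Proof. by rewrite /zeval -[Z.add a b]/(a + b) rmorphD rmorphD. Qed.
Lemma zevalN a : zeval (Z.opp a) = - zeval a.
Proof. by rewrite /zeval -[Z.opp a]/(- a) rmorphN rmorphN. Qed.
Lemma zevalB a b : zeval (Z.sub a b) = zeval a - zeval b.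
Proof. by rewrite /Z.sub zevalD zevalN. Qed.
Lemma zevalM a b : zeval (Z.mul a b) = zeval a * zeval b.
Proof. by rewrite /zeval -[Z.mul a b]/(a * b) rmorphM rmorphM. Qed.

Lemma zeval_eq0 a : zeval a = 0 -> a = Z0.
Proof.
have /pcharf0P n0 := char0; rewrite /zeval => a0; apply: (can_inj int_of_ZK).
case: (int_of_Z a) a0 => n; rewrite ?NegzE ?mulrNz => /eqP; rewrite ?oppr_eq0.
  by rewrite n0 => /eqP->.
by rewrite n0.
Qed.

Definition eeval (w : K) (x : eis) : K := zeval x.1 + zeval x.2 * w.

Variable w : K.
Hypothesis w_root : w ^+ 2 + w + 1 = 0.

Let w2 : w ^+ 2 = - w - 1.
Proof. by rewrite -[LHS](addrK (w + 1)) addrA w_root sub0r opprD. Qed.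

Lemma eevalD x y : eeval w (eadd x y) = eeval w x + eeval w y.
Proof. by rewrite /eeval /= !zevalD; ring. Qed.

Lemma eevalN x : eeval w (eopp x) = - eeval w x.
Proof. by rewrite /eeval /= !zevalN; ring. Qed.

Lemma eevalM x y : eeval w (emul x y) = eeval w x * eeval w y.
Proof.
rewrite /eeval /= !(zevalB, zevalD, zevalM).
set a := zeval x.1; set b := zeval x.2; set c := zeval y.1; set d := zeval y.2.
transitivity (a * c + (a * d + b * c) * w + b * d * (- w - 1)); first by ring.
by rewrite -w2; ring.
Qed.

Lemma eeval_conj x : eeval w (econj x) = eeval (w ^+ 2) x.
Proof. by rewrite /eeval /= zevalB zevalN w2; ring. Qed.

(** Multiplying by the conjugate gives the norm $a^2-ab+b^2$, an integer that is zero only for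
    $a=b=0$ and stays nonzero in characteristic $0$. *)
Lemma eeval_eq0 x : (eeval w x == 0) = eis0 x.
Proof.
apply/eqP/idP => [x0|/andP[/Z.eqb_spec x1 /Z.eqb_spec x2]]; last first.
  by rewrite /eeval x1 x2 zeval0 mul0r addr0.
have : eeval w (emul x (econj x)) = 0 by rewrite eevalM x0 mul0r.
have -> : emul x (econj x) = (Z.add (Z.sub (Z.mul x.1 x.1) (Z.mul x.1 x.2)) (Z.mul x.2 x.2), Z0).
  by rewrite /emul /econj /=; congr (_, _); nia.
rewrite /eeval /= zeval0 mul0r addr0 => /zeval_eq0 nx.
have x2 : x.2 = Z0 by nia.
by rewrite /eis0; apply/andP; split; apply/Z.eqb_spec => //; nia.
Qed.

Lemma eeval_omega_pow e : eeval w (omega_pow e) = w ^+ (e %% 3).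
Proof.
rewrite /omega_pow; case: (e %% 3)%N (ltn_pmod e (isT : 0 < 3)%N) => [|[|[|//]]] _;
  rewrite /eeval /= !zevalE ?w2; ring.
Qed.

Definition erow (s : seq eis) : 'rV[K]_4 := \row_(k < 4) eeval w (nth (eint Z0) s k).

Lemma vec4_erow (a b c d : K) (a' b' c' d' : eis) : a = eeval w a' -> b = eeval w b' ->
  c = eeval w c' -> d = eeval w d' -> vec4 a b c d = erow [:: a'; b'; c'; d'].
Proof.
move=> -> -> -> ->; apply/rowP=> k; rewrite !mxE.
by case: k => -[|[|[|[|//]]]].
Qed.
End EisensteinEval.

Lemma enum_F3 : enum 'F_3 = [seq n%:R | n <- iota 0 3].
Proof.
apply: (inj_map val_inj); transitivity (iota 0 3); first exact: (val_enum_ord 3).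
by [].
Qed.

Lemma eq_map_cat (S S' T : Type) (f : S -> T) (g : S' -> T) a b a' b' :
  map f a = map g a' -> map f b = map g b' -> map f (a ++ b) = map g (a' ++ b').
Proof. by rewrite !map_cat => -> ->. Qed.

Lemma eq_map_F3_pairs (S S' T : Type) (f : S -> T) (g : S' -> T)
    (F : 'F_3 -> 'F_3 -> S) (G : nat -> nat -> S') :
  (forall i j : nat, f (F i%:R j%:R) = g (G i j)) ->
  map f [seq F i j | i <- enum 'F_3, j <- enum 'F_3] =
  map g [seq G i j | i <- iota 0 3, j <- iota 0 3].
Proof. by move=> FG; rewrite enum_F3 /= !FG. Qed.

Lemma G32_table_points (K : fieldType) (w : K) : unzip1 (G32_table w) = map vec points.
Proof.
have E (i j c d : nat) : vec4 i%:R j%:R c%:R d%:R = vec [:: i; j; c; d].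
  by apply/rowP=> k; rewrite !mxE; case: k => -[|[|[|[|]]]].
apply: eq_map_cat; first by rewrite /= -!E.
by do 3![apply: eq_map_cat; first by apply: eq_map_F3_pairs => i j; rewrite -E];
  apply: eq_map_F3_pairs => i j; rewrite -E.
Qed.

Lemma G32_table_forms (K : fieldType) (w : K) : w ^+ 2 + w + 1 = 0 ->
  unzip2 (G32_table w) = map (erow w) form_table.
Proof.
move=> w_root.
have e0 : 0 = eeval w (eint Z0) by rewrite /eeval /= !zevalE; ring.
have e1 : 1 = eeval w (eint (Zpos xH)) by rewrite /eeval /= !zevalE; ring.
have es : w - w ^+ 2 = eeval w esqrt.
  have -> : w ^+ 2 = - w - 1 by rewrite -[LHS](addrK (w + 1)) addrA w_root sub0r opprD.
  by rewrite /eeval /= !zevalE; ring.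
have ew (n : nat) : w ^+ (n%:R : 'F_3) = eeval w (omega_pow n).
  by rewrite eeval_omega_pow // val_Fp_nat.
have eN (n : nat) : - w ^+ (n%:R : 'F_3) = eeval w (eopp (omega_pow n)).
  by rewrite eevalN ew.
have ew2 (i j : nat) : w ^+ (i%:R - j%:R : 'F_3)%R = eeval w (omega_pow (i + 2 * j)).
  by rewrite F3_opp -natrD ew.
have ewN (i : nat) : w ^+ (- i%:R : 'F_3)%R = eeval w (omega_pow (2 * i)).
  by rewrite F3_opp ew.
have ewN2 (i j : nat) : w ^+ (- i%:R - j%:R : 'F_3)%R = eeval w (omega_pow (2 * i + 2 * j)).
  by rewrite !F3_opp -natrD ew.
apply: eq_map_cat; first by rewrite /=; do 4![congr (_ :: _); first by apply: vec4_erow].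
do 3![apply: eq_map_cat; first by apply: eq_map_F3_pairs => i j; apply: vec4_erow;
  rewrite ?eevalN ?ewN2 ?ew2 ?ewN ?ew].
by apply: eq_map_F3_pairs => i j; apply: vec4_erow; rewrite ?eevalN ?ewN2 ?ew2 ?ewN ?ew.
Qed.

Lemma G32_formE (K : fieldType) (w : K) l : w ^+ 2 + w + 1 = 0 ->
  G32_form w l = erow w (nth [::] form_table (lcode l)).
Proof.
move=> w_root; have s40 : size (G32_table w) = 40%N.
  by rewrite -(size_map fst) -/(unzip1 _) G32_table_points size_map.
rewrite /G32_form; set k := find _ _.
have kE : k = lcode l by rewrite lcode_def -(G32_table_points w) /unzip1 find_map.
rewrite kE -(nth_map _ 0 snd) ?s40 ?lcode_lt // -/(unzip2 _) G32_table_forms //.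
by rewrite (nth_map [::]) // lcode_lt.
Qed.

Lemma mulmx_comb (K : fieldType) (A : 'rV[K]_4) (X Y : 'cV[K]_4) (a b x y : K) :
  A *m X = x%:M -> A *m Y = y%:M -> A *m (a *: X - b *: Y) = (a * x - b * y)%:M.
Proof.
by move=> AX AY; rewrite mulmxBr -!scalemxAr AX AY !scale_scalar_mx raddfB.
Qed.

Section Normals.
Variables (K : fieldType) (w : K).
Hypothesis char0 : [pchar K] =i pred0.
Hypothesis w_root : w ^+ 2 + w + 1 = 0.
Local Notation form := (G32_form w).

Let w4_root : (w ^+ 2) ^+ 2 + w ^+ 2 + 1 = 0.
Proof.
have -> : (w ^+ 2) ^+ 2 + w ^+ 2 + 1 = (w ^+ 2 + w + 1) * (w ^+ 2 - w + 1) by ring.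
by rewrite w_root mul0r.
Qed.

(** Replacing [w] by its square takes the place of complex conjugation in [K]. *)
Definition conj_col l : 'cV[K]_4 := (G32_form (w ^+ 2) l)^T.

Lemma form_conj l h : form l *m conj_col h = (eeval w (gram (lcode l) (lcode h)))%:M.
Proof.
apply/rowP=> i; rewrite ord1 !mxE eqxx mulr1n.
rewrite /gram gram_edot (nth_map [::]) ?lcode_lt // (nth_map [::]) ?lcode_lt //.
rewrite /conj_col !G32_formE //; set s := nth _ _ _; set t := nth _ _ _.
rewrite !big_ord_recl big_ord0 !mxE /= /edot /=.
rewrite !(eevalD, eevalM) // !eeval_conj // /bump /=.
by rewrite [eeval w (eint _)](_ : _ = 0) // /eeval /= !zevalE mul0r addr0.
Qed.

Lemma form_conj_eq0 l h : (form l *m conj_col h == 0) = inF l h.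
Proof.
have -> : (form l *m conj_col h == 0) = (eeval w (gram (lcode l) (lcode h)) == 0).
  rewrite form_conj; apply/eqP/eqP => [/matrixP/(_ 0 0)|->]; last exact: raddf0.
  by rewrite !mxE eqxx mulr1n.
rewrite eeval_eq0 // inF_code.
exact: (eqP (allI (allI gram_orth (lcode_lt l)) (lcode_lt h))).
Qed.

Lemma form_neq0 l : form l != 0.
Proof.
have := form_conj_eq0 l l; rewrite inFxx; apply: contraFneq => ->.
by rewrite mul0mx.
Qed.

Lemma normal_line h : exists2 n : 'cV[K]_4, n != 0 & forall l, (form l *m n == 0) = inF l h.
Proof.
exists (conj_col h); last by move=> l; apply: form_conj_eq0.
by have := form_conj_eq0 h h; rewrite inFxx; apply: contraFneq => ->; rewrite mulmx0.
Qed.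

(* For m and m' in a non-isotropic plane, the projection of the root of m'
   orthogonally to the root of m; each root has norm 3. *)
Lemma normal_plane b m : perpP b m -> exists2 n : 'cV[K]_4, n != 0 &
  forall l, (form l *m n == 0) = inP l b || (l == m).
Proof.
move=> bm; have [m' [bm' mm' kb]] := perp_plane bm.
pose n := eeval w (eint (Zpos (xI xH))) *: conj_col m' -
  eeval w (gram (lcode m) (lcode m')) *: conj_col m.
have nE l : (form l *m n == 0) = inP l b || (l == m).
  pose z := eadd (emul (eint (Zpos (xI xH))) (gram (lcode l) (lcode m')))
    (eopp (emul (gram (lcode m) (lcode m')) (gram (lcode l) (lcode m)))).
  have -> : (form l *m n == 0) = (eeval w z == 0).
    rewrite (mulmx_comb _ _ (form_conj l m') (form_conj l m)).
    rewrite /z eevalD eevalN !eevalM //.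
    by apply/eqP/eqP => [/matrixP/(_ 0 0)|->]; [rewrite !mxE eqxx mulr1n|exact: raddf0].
  have nO : orth (lcode m) (lcode m') = false by rewrite -ort_code (negbTE mm').
  have := allI (allI gram_proj (lcode_lt m)) (lcode_lt m'); rewrite nO; cbv zeta.
  move=> /allI/(_ (lcode_lt l))/eqP; rewrite eeval_eq0 // => ->.
  rewrite (inj_eq lcode_inj) -inF_code -inF_code; case: (l == m); first by rewrite orbT.
  rewrite orbF; case: (boolP (inF l m)) => [lm|/negbTE lm].
    case: (boolP (inF l m')) => [lm'|/negbTE lm']; first by rewrite kb.
    by apply/esym/negP=> lb; rewrite (plane_inF lb bm') in lm'.
  by apply/esym/negP=> lb; rewrite (plane_inF lb bm) in lm.
exists n => //; have : (form m' *m n == 0) = false.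
  rewrite nE (negbTE (plane_perpN bm')) /=; apply: contraNF mm' => /eqP->.
  exact: ort_refl.
by apply: contraFneq => ->; rewrite mulmx0.
Qed.
End Normals.

(** * The Bergman complex of the arrangement *)

Lemma sum_sign_by_card (V : finType) (F : {set {set V}}) :
  (forall A : {set V}, A \in F -> (#|A| < 4)%N) ->
  \sum_(A in F) (-1 : int) ^+ #|A|.+1 =
  #|[set A in F | #|A| == 3]%SET|%:R - #|[set A in F | #|A| == 2]%SET|%:R +
  #|[set A in F | #|A| == 1%N]%SET|%:R - #|[set A in F | #|A| == 0%N]%SET|%:R.
Proof.
move=> F4; pose N k := #|[set A in F | #|A| == k]%SET|.
have -> : \sum_(A in F) (-1 : int) ^+ #|A|.+1 = \sum_(k < 4) (-1) ^+ k.+1 * (N k)%:R.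
  transitivity (\sum_(A in F) \sum_(k < 4) ((-1) ^+ k.+1 * (#|A| == k)%:R : int)).
    apply: eq_bigr => A AF; rewrite (bigD1 (Ordinal (F4 _ AF))) //= eqxx mulr1.
    rewrite big1 ?addr0 // => k; rewrite eq_sym => kA.
    by rewrite (_ : (#|A| == k) = false) ?mulr0 //; apply: negbTE.
  rewrite exchange_big /=; apply: eq_bigr => k _; rewrite -mulr_sumr -natr_sum.
  congr (_ * _%:R); rewrite /N -sum1_card big_mkcond [RHS]big_mkcond /=.
  by apply: eq_bigr => A _; rewrite inE; case: (A \in F); case: (#|A| == k).
rewrite !big_ord_recl big_ord0 /= /bump /= !exprS expr0 /N; ring.
Qed.

Lemma eq_imset_cond (T T' : finType) (f : T -> T') (P Q : pred T) : P =1 Q ->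
  [set f p | p : T & P p]%SET = [set f p | p : T & Q p]%SET.
Proof.
by move=> PQ; apply/setP=> y; apply/imsetP/imsetP => -[x xP ->]; exists x => //;
  move: xP; rewrite !inE PQ.
Qed.

Lemma sum_unit_vec (R : realType) (E : finType) (Q : pred E) :
  \sum_(l | Q l) unit_vec R l = [ffun l => (Q l)%:R] :> {ffun E -> R^o}.
Proof.
apply/ffunP=> k; rewrite sum_ffunE ffunE.
have [Qk|Qk] := boolP (Q k).
  rewrite (bigD1 k) //= ffunE eqxx big1 ?addr0 // => l /andP[_ lk].
  by rewrite ffunE eq_sym (negbTE lk).
rewrite big1 // => l Ql; rewrite ffunE; case: eqP => // kl.
by move: Qk; rewrite kl Ql.
Qed.

Section G32.
Local Notation IG := G32_incidence.

Lemma edges_aaE : edges_aa = edge_LL niplane inF.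
Proof. by apply: eq_imset_cond => -[l h]; rewrite inFE ortE andbC. Qed.

Lemma edges_abE : edges_ab = edge_LP inP.
Proof. by apply: eq_imset_cond => -[l b]; rewrite inPE. Qed.

Lemma edges_ahE : edges_ah = edge_LF niplane inF.
Proof. by apply: eq_imset_cond => -[l h]; rewrite inFE ortE andbC. Qed.

Lemma edges_bhE : edges_bh = edge_PF perpP.
Proof. by apply: eq_imset_cond => -[b h]; rewrite perpPE. Qed.

Lemma edges_ab_perpE : edges_ab_perp = edge_LP_perp perpP.
Proof. by apply: eq_imset_cond => -[l b]; rewrite perpPE line_perp_plane. Qed.

Lemma triangles_aahE : triangles_aah = tri_LLF niplane inF.
Proof.
have H a b c d e f : [&& a, b, c, d, e & f] = [&& b && a, e && c & f && d].
  by case: a b c d e f => [] [] [] [] [] [].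
by apply: eq_imset_cond => -[[l l'] h]; rewrite !inFE !ortE; apply: H.
Qed.

Lemma triangles_abhE : triangles_abh = tri_LPF inP perpP.
Proof. by apply: eq_imset_cond => -[[l b] h]; rewrite inPE perpPE. Qed.

Lemma triangles_aabE : triangles_aab = tri_LLP inP perpP.
Proof. by apply: eq_imset_cond => -[[l l'] b]; rewrite inPE perpPE -(line_perp_plane l' b). Qed.

Variable R : realType.

Lemma vertex_vecE v : vertex_vec R v = ind R (flat inF inP) v.
Proof.
case: v => [[l|b]|h] /=.
- by apply/ffunP=> k; rewrite !ffunE inE.
- by rewrite sum_unit_vec; apply/ffunP=> k; rewrite !ffunE inE inPE.
- by rewrite sum_unit_vec; apply/ffunP=> k; rewrite !ffunE inE inFE ortE.
Qed.

Lemma vertex_rayE : vertex_ray R = iray R (flat inF inP).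
Proof. by apply/funext=> v; rewrite /vertex_ray vertex_vecE. Qed.

Lemma coarsest_G32 : coarsest_fan_structure
  (\bigcup_(s in fan0 R (flat inF inP) (triangles inF inP perpP)) s)
  (fan0 R (flat inF inP) (triangles inF inP perpP)).
Proof.
apply: coarsest_fan0.
- exact: (flat_separated IG).
- exact: (flat_uncovered IG).
- exact: (flat_laminar IG).
- exact: (flat_inj IG).
- exact: (flat_neqT IG).
- exact: (flat_neq0 IG).
- by exists 3 => T; apply: (card_triangle IG).
- exact: (flat_wall IG).
Qed.

Lemma vertex_face v : [set v]%SET \in faces (triangles inF inP perpP).
Proof.
have [T TT vT] := vertex_in_triangle IG v.
by apply/facesP; exists T; rewrite ?finset.sub1set.
Qed.

Lemma Berg_G32E (K : fieldType) (w : K) : [pchar K] =i pred0 -> w ^+ 2 + w + 1 = 0 ->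
  Berg_G32 R w = \bigcup_(s in fan0 R (flat inF inP) (triangles inF inP perpP)) s.
Proof.
move=> char0 w_root; have NF := normal_line char0 w_root.
have NP := normal_plane char0 w_root; have N0 := form_neq0 char0 w_root.
apply/seteqP; split=> x.
  move=> /(tropical_mcone IG N0 NF NP)[T TT xT]; exists (mcone R (flat inF inP) T) => //.
  by exists T => //; apply/facesP; exists T.
move=> [_ [A /facesP[T TT AT] <-] /(mcone_sub_mono AT)].
exact: (mcone_tropical IG NF NP TT).
Qed.
End G32.

Unset Implicit Arguments.

Theorem lemma4p1 (R : realType) (K : closedFieldType) (omega : K)
    (char0 : [pchar K] =i pred0) (prim_omega : 3.-primitive_root omega) :
  (exists F : set (set {ffun line -> R^o}),
     coarsest_fan_structure (Berg_G32 R omega) F) /\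
  (forall F : set (set {ffun line -> R^o}),
     coarsest_fan_structure (Berg_G32 R omega) F ->
     let D := fan_complex F in
     let realize (A : {set vertex}) : set (set {ffun line -> R^o}) :=
       [set vertex_ray R v | v in [set` A]] in
     simplicial_fan F /\
     [/\ (simplices D 0 #= `I_170)%card,
         (simplices D 1 #= `I_1800)%card,
         (simplices D 2 #= `I_3360)%card &
         forall d, (2 < d)%N -> simplices D d = set0] /\
     (reduced_euler_char D = 3360 - 1800 + 170 - 1 /\
      reduced_euler_char D = 1729) /\
     injective (vertex_ray R) /\
     rays F = range (vertex_ray R) /\
     [/\ #|[set vA l | l : line]%SET| = 40%N,
         #|[set vB b | b : niplane]%SET| = 90%N,
         #|[set vH h | h : line]%SET| = 40%N &
         forall h : line,
           #|[set l : line | (val l <= perp (val h))%VS && (l != h)]%SET|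
             = 12%N] /\
     simplices D 1 =
       [set realize A | A in [set` (edges_aa :|: edges_ab :|: edges_ah
                                    :|: edges_bh :|: edges_ab_perp)%SET]] /\
     [/\ #|edges_aa| = 240%N, #|edges_ab| = 360%N, #|edges_ah| = 480%N,
         #|edges_bh| = 360%N & #|edges_ab_perp| = 360%N] /\
     simplices D 2 =
       [set realize A | A in [set` (triangles_aah :|: triangles_abh
                                    :|: triangles_aab)%SET]] /\
     [/\ #|triangles_aah| = 480%N, #|triangles_abh| = 1440%N
       & #|triangles_aab| = 1440%N]).
Proof.
have IG := G32_incidence.
have w_root : omega ^+ 2 + omega + 1 = 0.
  have w1 : omega - 1 != 0.
    by rewrite subr_eq0 -(expr1 omega) -(expr0 omega) (eq_prim_root_expr prim_omega).
  apply: (mulfI w1); rewrite mulr0; transitivity (omega ^+ 3 - 1); first by ring.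
  by rewrite (prim_expr_order prim_omega) subrr.
rewrite (Berg_G32E R char0 w_root); split; first by eexists; apply: coarsest_G32.
(* By uniqueness, an arbitrary coarsest structure is the explicit fan over the triangles. *)
move=> F /(coarsest_unique (coarsest_G32 R)) <- {F} D realize.
have sep := flat_separated IG; have unc := flat_uncovered IG; have lam := flat_laminar IG.
have inj := flat_inj IG; have neqT := flat_neqT IG; have neq0 := flat_neq0 IG.
have wal := flat_wall IG; have vf := vertex_face.
(* Some coordinate must exist for [all_ones] to be nonzero. *)
have [l0 _] := lcode_surj (isT : 0 < 40)%N.
have realizeE A : realize A = ray_set R (flat inF inP) A.
  by rewrite /realize vertex_rayE.
have realizeI (B : {set {set vertex}}) : [set realize A | A in [set` B]] =
    [set ray_set R (flat inF inP) A | A in [set` B]].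
  by apply: eq_imagel => A _; apply: realizeE.
have sD d : simplices D d = [set realize A | A in
    [set` [set A in simplices_of (triangles inF inP perpP) | #|A| == d.+1]%SET]].
  by rewrite realizeI; apply: (simplices_fan0 R sep unc lam inj neqT neq0 vf l0).
have cardD d n : #|[set A in simplices_of (triangles inF inP perpP) | #|A| == d.+1]%SET| = n ->
    (simplices D d #= `I_n)%card.
  move=> <-; rewrite sD realizeI.
  exact: (card_ray_set_image R unc lam inj neqT neq0 vf).
have edgesE : edges_aa :|: edges_ab :|: edges_ah :|: edges_bh :|: edges_ab_perp =
    edges inF inP perpP.
  by rewrite edges_aaE edges_abE edges_ahE edges_bhE edges_ab_perpE.
have trianglesE : triangles_aah :|: triangles_abh :|: triangles_aab = triangles inF inP perpP.
  by rewrite triangles_aahE triangles_abhE triangles_aabE.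
have euler : reduced_euler_char D = 3360 - 1800 + 170 - 1.
  rewrite (reduced_euler_char_fan0 R sep unc lam inj neqT neq0 vf l0).
  (* [faces] and [simplices_of] unfold to the same set. *)
  rewrite -/(simplices_of (triangles inF inP perpP)) sum_sign_by_card; last first.
    by move=> A; apply: (simplices_card_le3 IG).
  rewrite (simplices_card3 IG) (simplices_card2 IG) (simplices_card1 IG) (simplices_card0 IG).
  by rewrite (card_triangles IG) (card_edges IG) (card_vertices IG) cards1.
split; first exact: (simplicial_fan0 sep l0).
split.
  split.
  - by apply: cardD; rewrite (simplices_card1 IG) (card_vertices IG).
  - by apply: cardD; rewrite (simplices_card2 IG) (card_edges IG).
  - by apply: cardD; rewrite (simplices_card3 IG) (card_triangles IG).
  - move=> d d3; rewrite sD; apply/seteqP; split=> // X [A + _].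
    rewrite /= inE => /andP[/(simplices_card_le3 IG) A3 /eqP dA].
    by move: A3; rewrite dA ltnS ltnNge d3.
split; first by split; rewrite euler.
split; first by rewrite vertex_rayE; exact: (iray_inj unc lam inj neqT neq0 vf).
split; first by rewrite vertex_rayE; apply: (rays_fan0 R sep unc lam inj neqT neq0 vf l0).
split.
  split.
  - by rewrite card_imset ?card_lines // => l l' [].
  - by rewrite card_imset ?card_niplanes // => b b' [].
  - by rewrite card_imset ?card_lines // => l l' [].
  - move=> h; rewrite -(card_inF h); apply: eq_card => l; rewrite !inE inFE ortE.
    by [].
split; first by rewrite edgesE sD (simplices_card2 IG).
split.
  rewrite edges_aaE edges_abE edges_ahE edges_bhE edges_ab_perpE.
  by rewrite (card_edge_LL IG) (card_edge_LP IG) (card_edge_LF IG) (card_edge_PF IG)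
    (card_edge_LP_perp IG).
split; first by rewrite trianglesE sD (simplices_card3 IG).
rewrite triangles_aahE triangles_abhE triangles_aabE.
by rewrite (card_tri_LLF IG) (card_tri_LPF IG) (card_tri_LLP IG).
Qed.
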